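(* Fix an integer $p\ge 3$. For every integer $k\ge 1$, there exists a V-link $L_k$ with braid index $p$ such that $L_k$ has at least $k$ distinct V-link presentations. Moreover, $L_k$ has at least $2k$ distinct T-link presentations.
   Context: T-links: for integers $2\le r_1<\dots<r_n$ and $s_1,\dots,s_n>0$, the T-link $T((r_1,s_1),\dots,(r_n,s_n))$ is the closure in $S^3$ of the braid $(\sigma_1\cdots\sigma_{r_1-1})^{s_1}\cdots(\sigma_1\cdots\sigma_{r_n-1})^{s_n}$ on $r_n$ strands. A T-link presentation of a link $L$ is such a parameter list, with last exponent $s_n>1$ (the case $s_n=1$ is excluded because the last block could be removed by a destabilization), whose T-link is isotopic to $L$ in $S^3$. V-links: let $P,Q$ be integers with $2\le P\le Q$, let $2\le u_1<\dots<u_m\le P$ and $2\le r_1<\dots<r_n<P$ be possibly empty sequences of integers, and let $v_1,\dots,v_m,s_1,\dots,s_n$ be positive integers. The V-link $V((u_1,\overline{v_1}),\dots,(u_m,\overline{v_m}),(r_1,s_1),\dots,(r_n,s_n),(P,Q))$ is the closure of the braid on $P$ strands $$(\sigma_{P-1}\cdots\sigma_{P-u_1+1})^{v_1}\cdots(\sigma_{P-1}\cdots\sigma_{P-u_m+1})^{v_m}(\sigma_1\cdots\sigma_{r_1-1})^{s_1}\cdots(\sigma_1\cdots\sigma_{r_n-1})^{s_n}(\sigma_1\cdots\sigma_{P-1})^{Q}.$$ A V-link presentation of a link $L$ is such a parameter list whose V-link is isotopic to $L$ in $S^3$. Two presentations are distinct if they differ as ordered parameter lists (with the overlined/non-overlined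 distinction taken into account for V-links). *)

(* Defs.v *)
From HB Require Import structures.
From mathcomp Require Import all_boot all_order all_algebra.
From mathcomp Require Import all_classical all_reals all_analysis.
Import Order.TTheory GRing.Theory Num.Theory numFieldNormedType.Exports.

Set Implicit Arguments.
Unset Strict Implicit.
Unset Printing Implicit Defensive.

Local Open Scope classical_set_scope.
Local Open Scope ring_scope.

(* S^3 is R^3 together with a point at infinity. *)
Notation S3 R := (one_point_compactification 'rV[R]_3).

Definition homeomorphism (X Y : topologicalType) (f : X -> Y) :=
  exists g : Y -> X,
    [/\ cancel f g, cancel g f, continuous f & continuous g].

(* Ambient isotopy of subsets of S^3; links are unoriented. *)
Definition isotopic (R : realType) (K L : set (S3 R)) :=
  exists H : R -> S3 R -> S3 R,
    [/\ {within `[0, 1] `*` [set: S3 R],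
           continuous (fun p : R * S3 R => H p.1 p.2)},
        forall t, t \in `[0, 1] -> homeomorphism (H t),
        H 0 = id & H 1 @` K = L].

(* The letter (k, true) is sigma_k and (k, false) is its inverse; generators
   are numbered from 1, so the letters of an n-strand braid have 0 < k < n. *)
Definition braid_word := seq (nat * bool).

Definition on_strands (n : nat) (w : braid_word) : bool :=
  all (fun l => (0 < l.1 < n)%N) w.

Section GeometricClosure.
Variable R : realType.

Definition point (x y z : R) : 'rV[R]_3 := \row_(i < 3) [:: x; y; z]`_i.

Definition segment (a b : 'rV[R]_3) : set 'rV[R]_3 :=
  [set (1 - t) *: a + t *: b | t in `[0, 1]].

Fixpoint polyline (a : 'rV[R]_3) (s : seq 'rV[R]_3) : set 'rV[R]_3 :=
  if s is b :: s' then segment a b `|` polyline b s' else set0.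

(* Strands run upwards in z and sit at (1, 0), ..., (n, 0) in the (x, y)-plane
   at integer heights.  Between heights j and j + 1 the letter (k, e) makes
   strands k and k + 1 exchange places, passing on opposite sides of the plane
   y = 0; e decides which of the two has y >= 0. *)
Definition crossing (j : nat) (l : nat * bool) : set 'rV[R]_3 :=
  let k := l.1 in
  let e : R := if l.2 then 1 else - 1 in
  let h : R := 2^-1 in
  polyline (point k%:R 0 j%:R)
    [:: point (k%:R + h) e (j%:R + h); point k.+1%:R 0 j.+1%:R] `|`
  polyline (point k.+1%:R 0 j%:R)
    [:: point (k%:R + h) (- e) (j%:R + h); point k%:R 0 j.+1%:R].

Definition layer (n j : nat) (l : nat * bool) : set 'rV[R]_3 :=
  crossing j l `|`
  \bigcup_(i in [set i : nat | (1 <= i <= n)%N /\ i <> l.1 /\ i <> l.1.+1])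
    segment (point i%:R 0 j%:R) (point i%:R 0 j.+1%:R).

(* The closing arc joins the top (height m) and the bottom (height 0) of
   position i in the plane y = 0, around the right of the braid; the n arcs
   are nested, the i-th one descending at x = 2n + 1 - i. *)
Definition closing_arc (n m i : nat) : set 'rV[R]_3 :=
  let d : R := n.+1%:R - i%:R in
  polyline (point i%:R 0 m%:R)
    [:: point i%:R 0 (m%:R + d); point (n%:R + d) 0 (m%:R + d);
        point (n%:R + d) 0 (- d); point i%:R 0 (- d); point i%:R 0 0].

Definition closure_R3 (n : nat) (w : braid_word) : set 'rV[R]_3 :=
  (\bigcup_(j in `I_(size w)) layer n j (nth (0%N, true) w j)) `|`
  (\bigcup_(i in [set i : nat | (1 <= i <= n)%N]) closing_arc n (size w) i).

Definition braid_closure (n : nat) (w : braid_word) : set (S3 R) :=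
  Some @` closure_R3 n w.

End GeometricClosure.

Arguments braid_closure : clear implicits.


Definition braid_index (R : realType) (L : set (S3 R)) (n : nat) :=
  (exists w, on_strands n w /\ isotopic (braid_closure R n w) L) /\
  (forall m w, on_strands m w -> isotopic (braid_closure R m w) L -> (n <= m)%N).

(* (sigma_1 ... sigma_{r-1})^s *)
Definition up_block (rs : nat * nat) : braid_word :=
  flatten (nseq rs.2 [seq (i, true) | i <- iota 1 rs.1.-1]).

(* (sigma_{P-1} ... sigma_{P-u+1})^v *)
Definition down_block (P : nat) (uv : nat * nat) : braid_word :=
  flatten (nseq uv.2 [seq ((P - i)%N, true) | i <- iota 1 uv.1.-1]).

(* Both T- and V-links use lists (r_1, s_1), ..., (r_n, s_n) with
   2 <= r_1 < ... < r_n and all s_i > 0. *)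
Definition increasing_list (a : seq (nat * nat)) : bool :=
  sorted ltn (map fst a) && all (fun rs => (1 < rs.1)%N && (0 < rs.2)%N) a.

Definition T_param := seq (nat * nat).

Definition T_valid (a : T_param) : bool := (a != [::]) && increasing_list a.

Definition T_link (R : realType) (a : T_param) : set (S3 R) :=
  braid_closure R (last (0%N, 0%N) a).1 (flatten (map up_block a)).

Arguments T_link : clear implicits.

Definition T_presentation (R : realType) (L : set (S3 R)) (a : T_param) :=
  [/\ T_valid a, (1 < (last (0%N, 0%N) a).2)%N & isotopic (T_link R a) L].

Record V_param := VParam {
  V_over : seq (nat * nat);   (* the overlined pairs (u_i, v_i) *)
  V_plain : seq (nat * nat);  (* the pairs (r_i, s_i) other than (P, Q) *)
  V_P : nat;
  V_Q : nat
}.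

Definition V_valid (v : V_param) : bool :=
  [&& (2 <= V_P v)%N, (V_P v <= V_Q v)%N,
      increasing_list (V_over v),
      all (fun uv => (uv.1 <= V_P v)%N) (V_over v),
      increasing_list (V_plain v) &
      all (fun rs => (rs.1 < V_P v)%N) (V_plain v)].

Definition V_link (R : realType) (v : V_param) : set (S3 R) :=
  braid_closure R (V_P v)
    (flatten (map (down_block (V_P v)) (V_over v)) ++
     flatten (map up_block (V_plain v)) ++ up_block (V_P v, V_Q v)).

Arguments V_link : clear implicits.

Definition V_presentation (R : realType) (L : set (S3 R)) (v : V_param) :=
  V_valid v /\ isotopic (V_link R v) L.

(* Main.v *)
(* All presentations are of one torus link: the closure L of delta^(p (2k + 2)) on
   p strands, where delta = sigma_1 ... sigma_(p-1).  The full twist delta^p equals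
   the p-th power of the reversed word, so a factor delta^(p (a + 1)) of the braid
   can be written with overlined blocks; this gives the V-presentations.  In the
   T-link ((p, c), (p + p a, p)) each of the p a outermost strands can be removed by
   a Markov destabilization, which leaves behind one factor sigma_(p-1) ... sigma_1;
   these factors form a full twists, and c + p + p a is the total exponent.  The
   pure braid delta^(p (2k + 2)) closes up to p components, and the closure of a
   braid with m strands has at most m.

   The ambient isotopies are composed of maps v |-> v + g v, where g is bounded and
   becomes a contraction once some coordinates are fixed.  Arcs that are graphs over
   a common coordinate can be moved along straight lines in this way, which gives the
   braid relations.  For the destabilization, a shear in the y-direction first turns
   the kink into a graph over y. *)

(* The definition of [isotopic] asks for a continuous family of homeomorphisms of the whole sphere,
   so deforming the link alone is not enough: every move has to say where all other points go. This
   is why the lemmas carry a passive set [C], to be kept fixed, together with a quantitative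
   distance from it to the moving arcs. Boundedness of [g] is what extends [v |-> v + t *: g v]
   continuously to the point at infinity. A straight-line motion fails exactly when two arcs meet on
   the way. Disjointness is certified by linear functionals of [x] and [y] that are positive on both
   pictures. When the straight line between two pictures produces a collision, intermediate pictures
   are inserted. The kink of a destabilization needs more care, because the shear that straightens
   it also moves the rest of the diagram. The rest has to leave the range of [y] in which the kink
   is then contracted, and the slopes of the strands in a layer decide how strong the shear must
   be. *)
Require Import Defs.
From HB Require Import structures.
From mathcomp Require Import all_boot all_order all_algebra.
From mathcomp Require Import all_classical all_reals all_analysis.
From mathcomp Require Import ring lra zify.
Import Order.TTheory GRing.Theory Num.Theory numFieldNormedType.Exports.
Import Defs.
Set Implicit Arguments.
Unset Strict Implicit.
Unset Printing Implicit Defensive.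
Local Open Scope classical_set_scope.
Local Open Scope ring_scope.

(** Joins completeness to the normed structure of row vectors, as Banach's fixed point theorem in
    [perturb_isotopy] requires. *)
HB.instance Definition _ (R : realType) (n : nat) :=
  Uniform_isComplete.Build 'rV[R]_n.+1
    (@cauchy_cvg ('rV[R]_n.+1 : completeType)).

(** * Continuity within a set, and homeomorphisms *)

Lemma within_continuous_comp (T U V : topologicalType) (A : set T) (B : set U)
    (g : T -> U) (f : U -> V) :
  {within A, continuous g} -> {within B, continuous f} ->
  (forall x, A x -> B (g x)) -> {within A, continuous (f \o g)}.
Proof.
move=> /subspace_continuousP cg /subspace_continuousP cf AB.
apply/subspace_continuousP => x Ax W /(cf _ (AB _ Ax)).
rewrite /= !nbhs_simpl /= => /(cg _ Ax); rewrite /= !nbhs_simpl /=.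
rewrite /within /= => H; near=> y => Ay.
by apply: (near H) => //; exact: AB.
Unshelve. all: by end_near. Qed.

Lemma within_continuous_pair (T U V : topologicalType) (A : set T)
    (f : T -> U) (g : T -> V) :
  {within A, continuous f} -> {within A, continuous g} ->
  {within A, continuous (fun x => (f x, g x))}.
Proof.
move=> /subspace_continuousP cf /subspace_continuousP cg.
by apply/subspace_continuousP => x Ax; apply: cvg_pair; [exact: cf|exact: cg].
Qed.

Lemma continuous_pair (T U V : topologicalType) (f : T -> U) (g : T -> V) :
  continuous f -> continuous g -> continuous (fun x => (f x, g x)).
Proof. by move=> cf cg x; exact: cvg_pair (cf x) (cg x). Qed.

Lemma homeomorphism_comp (X Y Z : topologicalType) (f : X -> Y) (g : Y -> Z) :
  homeomorphism f -> homeomorphism g -> homeomorphism (g \o f).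
Proof.
move=> [f' [fK f'K cf cf']] [g' [gK g'K cg cg']]; exists (f' \o g'); split.
- by move=> x /=; rewrite gK fK.
- by move=> x /=; rewrite f'K g'K.
- by move=> x; apply: continuous_comp; [exact: cf|exact: cg].
- by move=> x; apply: continuous_comp; [exact: cg'|exact: cf'].
Qed.

Lemma homeomorphism_inv (X Y : topologicalType) (f : X -> Y) (g : Y -> X) :
  cancel f g -> cancel g f -> continuous f -> continuous g -> homeomorphism g.
Proof. by move=> fK gK cf cg; exists f. Qed.

(** * Isotopies of subsets of S^3 *)

Section IsotopyEquivalence.
Variable R : realType.
Implicit Types K L M : set (S3 R).

Lemma isotopic_refl K : isotopic K K.
Proof.
exists (fun _ => id); split => //.
- by apply: continuous_subspaceT => p; exact: cvg_snd.
- by move=> t _; exists id; split => // x; exact: cvg_id.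
- by rewrite image_id.
Qed.

(** The reversed family is [H (1 - t)] after the inverse of [H 1], which is the identity at time 0.
    Only the inverse at the single time 1 occurs, so no joint continuity of the inverses in [t] has
    to be shown. *)
Lemma isotopic_sym K L : isotopic K L -> isotopic L K.
Proof.
move=> [H [cH hH H0 HKL]].
have [|g [gK gK' cH1 cg]] := hH 1.
  by rewrite in_itv /= ler01 lexx.
exists (fun t => H (1 - t) \o g); split.
- apply: (@within_continuous_comp (R * S3 R)%type (R * S3 R)%type (S3 R) _
    (`[0, 1] `*` [set: S3 R])
    (fun p : R * S3 R => (1 - p.1, g p.2)) (fun p => H p.1 p.2)) => //.
    apply: continuous_subspaceT; apply: continuous_pair => -[t x] /=.
      apply: (cvg_comp fst (fun s : R => 1 - s)); first exact: cvg_fst.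
      by apply: cvgB; [exact: cvg_cst|exact: cvg_id].
    by apply: (cvg_comp snd g); [exact: cvg_snd|exact: cg].
  move=> [t x] [/= + _]; rewrite /= !in_itv /= => /andP[t0 t1].
  by split => //=; rewrite ?in_itv /= subr_ge0 t1 lerBlDr lerDl t0.
- move=> t; rewrite in_itv /= => /andP[t0 t1].
  apply: homeomorphism_comp; first exact: (homeomorphism_inv gK).
  by apply: hH; rewrite in_itv /= subr_ge0 t1 lerBlDr lerDl t0.
- by rewrite subr0; apply/funext => x /=; rewrite gK'.
- rewrite subrr H0 -HKL eqEsubset; split => x.
    by move=> [_ [z Kz <-] <-] /=; rewrite gK.
  by move=> Kx; exists (H 1 x); [exists x|rewrite /= gK].
Qed.

Lemma isotopic_trans L K M : isotopic K L -> isotopic L M -> isotopic K M.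
Proof.
move=> [H [cH hH H0 HKL]] [G [cG hG G0 GLM]].
exists (fun t => G t \o H t); split.
- apply: (@within_continuous_comp (R * S3 R)%type (R * S3 R)%type (S3 R) _
    (`[0, 1] `*` [set: S3 R])
    (fun p : R * S3 R => (p.1, H p.1 p.2)) (fun p => G p.1 p.2)) => //.
    apply: within_continuous_pair => //.
    by apply: continuous_subspaceT => p; exact: cvg_fst.
- by move=> t t01; apply: homeomorphism_comp; [exact: hH|exact: hG].
- by rewrite H0 G0.
- by rewrite -GLM -HKL image_comp.
Qed.

End IsotopyEquivalence.

(** * Isotopies from bounded perturbations of the identity *)

Section Perturbation.
Variable R : realType.
Implicit Types v w : 'rV[R]_3.

Lemma normv_coord v (i : 'I_3) : `|v 0 i| <= `|v|.
Proof.
rewrite [leRHS]/Num.norm /= mx_normrE; apply/bigmax_geP; right => /=.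
by exists (0, i).
Qed.

Lemma normv_le v (B : R) : 0 <= B -> (forall i, `|v 0 i| <= B) -> `|v| <= B.
Proof.
move=> B0 vB; rewrite /Num.norm /= mx_normrE.
by apply/bigmax_leP; split => // -[i j] _ /=; rewrite (ord1 i).
Qed.

Lemma closed_coord_eq (P : pred 'I_3) w :
  closed [set v : 'rV[R]_3 | forall i, P i -> v 0 i = w 0 i].
Proof.
rewrite (_ : mkset _ = \bigcap_(i in [set i | P i])
    [set v : 'rV[R]_3 | v 0 i = w 0 i]); last first.
  by apply/seteqP; split => v /= H i; exact: H.
apply: closed_bigI => i _.
apply: (@preimage_closed _ _ (fun v : 'rV[R]_3 => v 0 i) [set w 0 i]).
  by move=> x _; exact: coord_continuous.
exact: closed_eq.
Qed.

Lemma compact_ball0 (B : R) : compact [set v : 'rV[R]_3 | `|v| <= B].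
Proof.
apply: bounded_closed_compact.
  exists B; split; first exact: num_real.
  by move=> M BM v /= vB; rewrite (le_trans vB)// ltW.
apply: (@preimage_closed _ _ (fun v : 'rV[R]_3 => `|v|) [set x | x <= B]).
  by move=> x _; exact: norm_continuous.
exact: closed_le.
Qed.

Lemma closed_ball0 (B : R) : closed [set v : 'rV[R]_3 | `|v| <= B].
Proof. by apply: compact_closed; [exact: norm_hausdorff|exact: compact_ball0]. Qed.

Lemma S3_hausdorff : hausdorff_space (S3 R).
Proof.
apply: one_point_compactification_hausdorff; last exact: norm_hausdorff.
move=> v _; rewrite withinET; exists [set w | `|w| <= `|v| + 1].
  apply/nbhs_ballP; exists 1 => //= w; rewrite -ball_normE /= => vw.
  rewrite -[w](subKr v) (le_trans (ler_normB _ _))// lerD2l.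
  exact: ltW.
by split; [exact: compact_ball0|exact: closed_ball0].
Qed.

(** A continuous map from a compact space to a Hausdorff space is closed, so the inverse of a
    bijection is continuous without any estimate. *)
Lemma S3_homeomorphism (f : S3 R -> S3 R) :
  continuous f -> bijective f -> homeomorphism f.
Proof.
move=> cf [g fK gK]; exists g; split => //.
apply/continuous_closedP => C cC.
rewrite (_ : g @^-1` C = f @` C); last first.
  apply/seteqP; split => x /=; first by move=> Cx; exists (g x).
  by move=> [y Cy <-]; rewrite fK.
apply: compact_closed; first exact: S3_hausdorff.
apply: continuous_compact; first exact: continuous_subspaceT.
apply: (subclosed_compact cC (one_point_compactification_compact)) => //.
Qed.

(* Every elementary move below has the form [v |-> v + g v], where [g] is a
   contraction on each affine subspace with the coordinates in [P] fixed;
   bijectivity is then Banach's fixed point theorem. *)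
Lemma perturb_isotopy (P : pred 'I_3) (g : 'rV[R]_3 -> 'rV[R]_3) (B k : R)
    (K : set 'rV[R]_3) :
  continuous g -> (forall v, `|g v| <= B) ->
  (forall v i, P i -> g v 0 i = 0) -> 0 <= k < 1 ->
  (forall v w, (forall i, P i -> v 0 i = w 0 i) ->
    `|g v - g w| <= k * `|v - w|) ->
  isotopic (Some @` K) (Some @` ((fun v => v + g v) @` K)).
Proof.
move=> cg gB gP /andP[k0 k1] gk.
pose F (t : R) v := v + t *: g v.
pose H (t : R) : S3 R -> S3 R := omap (F t).
have cF : continuous (fun p : R * 'rV[R]_3 => F p.1 p.2).
  move=> p; apply: cvgD; first exact: cvg_snd.
  apply: cvgZ; first exact: cvg_fst.
  by apply: (cvg_comp snd g); [exact: cvg_snd|exact: cg].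
have cH : {within `[0, 1] `*` [set: S3 R],
    continuous (fun p : R * S3 R => H p.1 p.2)}.
  apply/subspace_continuousP => -[t [v|]] [/= t01 _].
    move=> W WF.
    suff N : nbhs ((t, Some v) : R * S3 R) [set p | W (H p.1 p.2)].
      by rewrite /= nbhs_simpl /within /=; apply: filterS N.
    have [[/= U V] [Ut Vv] UV] := cF (t, v) _ WF.
    exists (U, Some @` V).
      by split => //=; exact: one_point_compactification_some_nbhs.
    by move=> [s x] [/= Us [w Vw <-]] /=; exact: (UV (s, w)).
  (* Continuity at infinity: no point moves by more than [B], so points outside the ball of radius
     [M + 1 + B] stay outside the compact set [C], which lies in the ball of radius [M + 1]. *)
  move=> /= W [C [cC _] CW]; rewrite !nbhs_simpl /=.
  have [M [_ /(_ _ (ltr_pwDr ltr01 (lexx _))) CM]] := compact_bounded cC.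
  exists (setT, (Some @` (~` [set v | `|v| <= M + 1 + B])) `|` [set None]).
    split => /=; first exact: filterT.
    exists [set v | `|v| <= M + 1 + B] => //.
    by split; [exact: compact_ball0|exact: closed_ball0].
  move=> [s x] [/= _ xV] [s01 _]; apply: CW.
  case: x xV => [x [[y + [<-]]|//]|_]; last by right.
  move=> yM; left; exists (F s y) => // CF; apply: yM => /=.
  have := CM _ CF; rewrite /F => yB.
  rewrite -[y](addrK (s *: g y)) (le_trans (ler_normB _ _))// lerD//.
  move: s01; rewrite /= in_itv /= => /andP[s0 s1].
  rewrite normrZ ger0_norm// (le_trans _ (gB y))//.
  by rewrite ler_piMl.
have bH t : t \in `[0, 1] -> bijective (F t).
  rewrite in_itv /= => /andP[t0 t1].
  (* The coordinates in [P] do not move, so points with the same image lie in a common affine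
     subspace, where the contraction gives [|v - w| <= k * |v - w|]. *)
  have Finj v w : F t v = F t w -> v = w.
    move=> Fvw; have vwP i : P i -> v 0 i = w 0 i.
      move=> Pi; have /(congr1 (fun u : 'rV[R]_3 => u 0 i)) := Fvw.
      by rewrite /F !mxE !gP// mulr0 !addr0.
    have E : v - w = t *: (g w - g v).
      move/eqP: Fvw; rewrite /F -subr_eq0 opprD addrACA -scalerBr.
      by rewrite addr_eq0 -scalerN opprB => /eqP.
    have : `|v - w| <= k * `|v - w|.
      rewrite {1}E normrZ ger0_norm// (distrC (g w)).
      apply: le_trans (gk _ _ vwP).
      by rewrite ler_piMl.
    rewrite -subr_le0 -{1}[`|v - w|]mul1r -mulrBl pmulr_rle0 ?subr_gt0//.
    by rewrite normr_le0 subr_eq0 => /eqP.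
  (* A preimage of [w] is a fixed point of [v |-> w - t *: g v], which preserves the closed affine
     subspace through [w]. *)
  have Fsurj w : exists v, F t v = w.
    pose U := [set v : 'rV[R]_3 | forall i, P i -> v 0 i = w 0 i].
    have fU : set_fun U U (fun v => w - t *: g v).
      by move=> v Uv i Pi; rewrite !mxE gP// mulr0 oppr0 addr0.
    pose f : {fun U >-> U} := mkfun_fun fU.
    have fE v : f v = w - t *: g v by [].
    have [] := @banach_fixed_point R ('rV[R]_3) U f.
    - exists (NngNum k0); split => //=.
      move=> [v u] [/= Uv Uu]; rewrite !fE.
      rewrite opprD addrACA subrr add0r opprK -scalerN -scalerDr normrZ.
      rewrite ger0_norm// addrC distrC.
      apply: le_trans (gk _ _ _); last by move=> i Pi; rewrite Uv// Uu.
      by rewrite distrC ler_piMl// distrC.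
    - exact: closed_coord_eq.
    - by exists w.
    - by move=> v _; rewrite fE => vE; exists v; rewrite /F {1}vE subrK.
  have [G GK] := choice Fsurj.
  by exists G => v //; apply: Finj.
exists H; split => //.
- move=> t t01; apply: S3_homeomorphism.
    move=> x; have := cH => /subspace_continuousP.
    move/(_ (t, x) (conj t01 I)) => HW W WF; have {WF HW} := HW W WF.
    move=> -[[/= A A'] [At A'x] AW]; rewrite /= nbhs_simpl /=.
    apply: filterS A'x => y A'y.
    by apply: (AW (t, y)) => //=; split => //=; exact: nbhs_singleton.
  have [G FK GK] := bH _ t01.
  by exists (omap G); case=> //= v; rewrite ?FK ?GK.
- by apply/funext => -[v|] //=; rewrite /F scale0r addr0.
- apply/seteqP; split => x.
    move=> [_ [v Kv <-] <-] /=; exists (v + g v); first by exists v.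
    by rewrite /F scale1r.
  move=> [_ [v Kv <-] <-]; exists (Some v); first by exists v.
  by rewrite /H /= /F scale1r.
Qed.

End Perturbation.

(** * Moving graphs over a coordinate axis *)

Section LevelMove.
Variables (R : realType) (c : 'I_3) (N : nat).

Definition arcs (f : 'I_N -> R -> 'rV[R]_3) (a b : R) : set 'rV[R]_3 :=
  [set v | exists i s, a <= s <= b /\ v = f i s].

(** Inside each level of the coordinate [c], a bump of radius [r] around the [i]-th arc carries the
    displacement [d i]. The bumps are Lipschitz with constant [1 / r] on a level, so their weighted
    sum has constant [N * e / r < 1] there. Other arcs and points of [C] at moving levels are at
    distance at least [r], where the bump vanishes. *)
Lemma push_isotopy (f d : 'I_N -> R -> 'rV[R]_3) (a b e r : R)
    (C : set 'rV[R]_3) :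
  (forall i, continuous (f i)) -> (forall i, continuous (d i)) ->
  (forall i s, a <= s <= b -> f i s 0 c = s) ->
  (forall i s, d i s 0 c = 0) ->
  (forall i s, ~~ (a < s < b) -> d i s = 0) ->
  (forall i s, `|d i s| <= e) -> 0 < r -> N%:R * e < r ->
  (forall i j s, i != j -> a <= s <= b -> r <= `|f i s - f j s|) ->
  (forall q, C q -> forall i, a < q 0 c < b -> r <= `|q - f i (q 0 c)|) ->
  isotopic (Some @` (C `|` arcs f a b))
    (Some @` (C `|` arcs (fun i s => f i s + d i s) a b)).
Proof.
move=> cf cd fc dc d0 de r0 Ner fij fC.
have coordc (v : 'rV[R]_3) : {for v, continuous (fun v : 'rV[R]_3 => v 0 c)}.
  exact: coord_continuous.
pose bump i (v : 'rV[R]_3) : R := Num.max 0 (1 - r^-1 * `|v - f i (v 0 c)|).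
pose g v := \sum_i bump i v *: d i (v 0 c).
have bump_le1 i v : 0 <= bump i v <= 1.
  rewrite le_max lexx /= ge_max ler01 /= gerBl mulr_ge0// invr_ge0.
  exact: ltW.
have cbump i : continuous (bump i).
  have cb : continuous (fun v : 'rV[R]_3 => 1 - r^-1 * `|v - f i (v 0 c)|).
    move=> v; apply: (@cvgB _ _ _ (nbhs v)); first exact: cvg_cst.
    apply: (@cvgM _ _ (nbhs v)); first exact: cvg_cst.
    apply: (@cvg_norm _ _ _ (nbhs v)); apply: (@cvgB _ _ _ (nbhs v)).
      exact: cvg_id.
    exact: (cvg_comp _ (f i) (coordc v)) (cf i _).
  move=> v; apply: (@continuous_max _ _ (fun=> 0)
    (fun v : 'rV[R]_3 => 1 - r^-1 * `|v - f i (v 0 c)|)) (cb v).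
  exact: cst_continuous.
have bumpLip i (v w : 'rV[R]_3) : v 0 c = w 0 c ->
    `|bump i v - bump i w| <= r^-1 * `|v - w|.
  move=> vw; rewrite /bump vw.
  have maxLip (x y : R) : `|Num.max 0 x - Num.max 0 y| <= `|x - y|.
    have h1 := ler_norm (x - y).
    have h2 : y - x <= `|x - y| by rewrite distrC ler_norm.
    have h3 := normr_ge0 (x - y).
    by rewrite ler_norml; case: (leP 0 x); case: (leP 0 y) => *; lra.
  apply: le_trans (maxLip _ _) _.
  rewrite opprB addrC addrA subrK -mulrBr normrM ger0_norm ?invr_ge0 ?(ltW r0)//.
  rewrite ler_wpM2l ?invr_ge0 ?(ltW r0)//.
  apply: le_trans (ler_dist_dist _ _) _.
  by rewrite opprB addrA subrK distrC.
have e0 : 'I_N -> 0 <= e by move=> i; apply: le_trans (de i 0).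
have gC q : C q -> g q = 0.
  move=> Cq; apply: big1 => i _; have [qab|qab] := boolP (a < q 0 c < b).
    rewrite /bump (max_idPl _) ?scale0r// subr_le0 mulrC ler_pdivlMr// mul1r.
    exact: fC.
  by rewrite d0// scaler0.
have gf i s : a <= s <= b -> g (f i s) = d i s.
  move=> sab; rewrite /g (bigD1 i)//= big1 => [|j ji].
    rewrite addr0 fc// /bump fc// subrr normr0 mulr0 subr0.
    by rewrite (max_idPr _) ?ler01// scale1r.
  rewrite /bump fc// (max_idPl _) ?scale0r//.
  by rewrite subr_le0 mulrC ler_pdivlMr// mul1r fij// eq_sym.
rewrite [X in isotopic _ (_ @` X)](_ : _ =
    (fun v => v + g v) @` (C `|` arcs f a b)); last first.
  apply/seteqP; split => v.
    move=> [Cv|[i [s [sab ->]]]].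
      by exists v; [left|rewrite gC// addr0].
    by exists (f i s); [right; exists i, s|rewrite gf].
  move=> [w [Cw|[i [s [sab ->]]]] <-].
    by rewrite gC// addr0; left.
  by rewrite gf//; right; exists i, s.
apply: (@perturb_isotopy _ (pred1 c) g (N%:R * e) (N%:R * e / r)).
- apply: continuous_big; first exact: add_continuous.
  move=> i _ v.
  apply: (@cvgZ _ _ _ (nbhs v)); first exact: cbump.
  exact: (cvg_comp _ (d i) (coordc v)) (cd i _).
- move=> v; apply: le_trans (ler_norm_sum _ _ _) _.
  apply: (@le_trans _ _ (\sum_(i < N) e)).
    apply: ler_sum => i _; rewrite normrZ.
    have /andP[b0 b1] := bump_le1 i v.
    by rewrite ger0_norm// -[leRHS]mul1r ler_pM.
  by rewrite sumr_const card_ord mulr_natl.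
- move=> v i /eqP ->; rewrite summxE big1// => j _.
  by rewrite mxE dc mulr0.
- apply/andP; split; last by rewrite ltr_pdivrMr// mul1r.
  rewrite mulr_ge0 ?invr_ge0 ?(ltW r0)//.
  have [->|N0] := posnP N; first by rewrite mul0r.
  by rewrite mulr_ge0// (e0 (Ordinal N0)).
- move=> v w vw; have {}vw : v 0 c = w 0 c by apply: vw; rewrite /= eqxx.
  rewrite /g vw -sumrB; apply: le_trans (ler_norm_sum _ _ _) _.
  apply: (@le_trans _ _ (\sum_(i < N) (e / r * `|v - w|))).
    apply: ler_sum => i _; rewrite -scalerBl normrZ mulrAC mulrC.
    rewrite -mulrA ler_pM ?de// mulrC; exact: bumpLip.
  by rewrite sumr_const card_ord -[leLHS]mulr_natl mulrA mulrA.
Qed.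

Lemma finite_min_pos (I : finType) (P : I -> R -> Prop) :
  (forall i x y, x <= y -> P i y -> P i x) ->
  (forall i, exists2 r, 0 < r & P i r) ->
  exists2 r, 0 < r & forall i, P i r.
Proof.
move=> Pmon Pex; have [r rP] := choice (fun i => let: ex_intro2 r r0 Pr := Pex i in
  ex_intro (fun r => 0 < r /\ P i r) r (conj r0 Pr)).
exists (\big[Num.min/1]_i r i).
  by apply: lt_bigmin => // i _; have [] := rP i.
by move=> i; apply: (Pmon i _ (r i)); [exact: bigmin_le_cond|have [] := rP i].
Qed.

(* The straight-line homotopy is cut into steps so short that bump functions
   around the arcs turn each of them into a [push_isotopy]. *)
Lemma level_move (f0 f1 : 'I_N -> R -> 'rV[R]_3) (a b r : R)
    (C : set 'rV[R]_3) :
  (forall i, continuous (f0 i)) -> (forall i, continuous (f1 i)) ->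
  (forall i s, a <= s <= b -> f0 i s 0 c = s /\ f1 i s 0 c = s) ->
  (forall i s, ~~ (a < s < b) -> f0 i s = f1 i s) ->
  (forall i j t s, i != j -> 0 <= t <= 1 -> a <= s <= b ->
     (1 - t) *: f0 i s + t *: f1 i s <> (1 - t) *: f0 j s + t *: f1 j s) ->
  0 < r ->
  (forall q, C q -> a < q 0 c < b -> forall i t, 0 <= t <= 1 ->
     r <= `|q - ((1 - t) *: f0 i (q 0 c) + t *: f1 i (q 0 c))|) ->
  isotopic (Some @` (C `|` arcs f0 a b)) (Some @` (C `|` arcs f1 a b)).
Proof.
move=> cf0 cf1 fc f01 fD r0 fC.
have [ba|ab] := ltP b a.
  have arcs0 f : arcs f a b = set0.
    apply/seteqP; split => // v [i [s [/andP[sa sb] _]]].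
    by have := lt_le_trans ba (le_trans sa sb); rewrite ltxx.
  by rewrite !arcs0; exact: isotopic_refl.
pose f t i s := (1 - t) *: f0 i s + t *: f1 i s.
pose D i s := f1 i s - f0 i s.
have fE t i s : f t i s = f0 i s + t *: D i s.
  by rewrite /f /D scalerBl scale1r scalerBr addrA addrAC.
have cD i : continuous (D i) by move=> s; apply: cvgB; [exact: cf1|exact: cf0].
have cf t i : continuous (f t i).
  move=> s; apply: cvgD; apply: cvgZ; try exact: cvg_cst; [exact: cf0|exact: cf1].
have Dout i s : ~~ (a < s < b) -> D i s = 0 by move=> /f01; rewrite /D => ->; rewrite subrr.
have Dc i s : D i s 0 c = 0.
  have [sab|sab] := boolP (a < s < b); last by rewrite Dout// mxE.
  have [|E0 E1] := fc i s; first by case/andP: sab => *; rewrite !ltW.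
  by rewrite !mxE E0 E1 subrr.
(* The displacement vanishes outside the interval from [a] to [b], so its maximum on this compact
   interval bounds it everywhere. *)
have [B DB] : exists B, forall i s, `|D i s| <= B.
  suff H i : exists B, forall s, `|D i s| <= B.
    have [B DB] := choice H; exists (\sum_i `|B i|) => i s.
    rewrite (bigD1 i)//= (le_trans (DB i s))// (le_trans (ler_norm _))//.
    by rewrite lerDl sumr_ge0.
  have [||x _ xmax] := @compact_EVT_max _ _ (fun s => `|D i s|) _ _
    (@segment_compact _ a b).
  - by exists a; rewrite /= in_itv /= lexx.
  - by apply: continuous_subspaceT => s; apply: cvg_norm; exact: cD.
  exists `|D i x| => s; have [sab|sab] := boolP (a < s < b).
    apply: xmax; rewrite inE /= in_itv /=.
    by case/andP: sab => *; rewrite !ltW.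
  by rewrite Dout// normr0.
(* By compactness in time and height, arcs that never meet during the homotopy keep a positive
   distance. *)
have [r1 r10 fr1] : exists2 r, 0 < r & forall p : 'I_N * 'I_N, p.1 != p.2 ->
    forall t s, 0 <= t <= 1 -> a <= s <= b -> r <= `|f t p.1 s - f t p.2 s|.
  apply: (@finite_min_pos _ (fun p r => p.1 != p.2 -> forall t s,
    0 <= t <= 1 -> a <= s <= b -> r <= `|f t p.1 s - f t p.2 s|)).
    by move=> p x y xy H p12 t s t01 sab; apply: le_trans xy _; exact: H.
  move=> [i j] /=; have [->|ij] := eqVneq i j; first by exists 1.
  have [||[t s] tsin tsmin] := @compact_EVT_min _ _
    (fun p : R * R => `|f p.1 i p.2 - f p.1 j p.2|) _ _
    (compact_setX (@segment_compact _ 0 1) (@segment_compact _ a b)).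
  - by exists (0, a); split; rewrite /= in_itv /= lexx ?ler01 ?ab.
  - have cF k : continuous (fun p : R * R => f p.1 k p.2).
      move=> p; apply: cvgD; apply: cvgZ.
      + by apply: cvgB; [exact: cvg_cst|exact: cvg_fst].
      + by apply: (cvg_comp snd (f0 k)); [exact: cvg_snd|exact: cf0].
      + exact: cvg_fst.
      + by apply: (cvg_comp snd (f1 k)); [exact: cvg_snd|exact: cf1].
    by apply: continuous_subspaceT => p; apply: cvg_norm; apply: cvgB; exact: cF.
  move: tsin; rewrite inE => -[] /=; rewrite !in_itv /= => t01 sab.
  exists `|f t i s - f t j s|.
    by rewrite normr_gt0 subr_eq0; apply/eqP; exact: fD.
  move=> _ t' s' t01' sab'; apply: (tsmin (t', s')).
  by rewrite inE; split; rewrite /= in_itv.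
pose r' := Num.min r r1.
have r'0 : 0 < r' by rewrite lt_min r0.
(* The number of steps: each one moves by [D / M], and [N * B / M < r'] is the smallness that
   [push_isotopy] asks for. *)
pose M := (Num.bound (`|N%:R * B| / r')).+1.
have M0 : 0 < M%:R :> R by rewrite ltr0n.
have MB : N%:R * (M%:R^-1 * B) < r'.
  rewrite mulrCA mulrC ltr_pdivrMr// -ltr_pdivrMl// mulrC.
  apply: (@lt_trans _ _ (Num.bound (`|N%:R * B| / r'))%:R); last first.
    by rewrite ltr_nat.
  apply: le_lt_trans (archi_boundP _); last by rewrite divr_ge0// ltW.
  by rewrite ler_wpM2r ?invr_ge0 ?(ltW r'0)// ler_norm.
have step k : (k <= M)%N -> isotopic (Some @` (C `|` arcs (f 0) a b))
    (Some @` (C `|` arcs (f (k%:R / M%:R)) a b)).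
  elim: k => [_|k IH kM]; first by rewrite mul0r; exact: isotopic_refl.
  apply: isotopic_trans (IH (ltnW kM)) _.
  pose t : R := k%:R / M%:R.
  have t01 : 0 <= t <= 1.
    by rewrite divr_ge0// ler_pdivrMr// mul1r ler_nat ltnW.
  rewrite (_ : f (k.+1%:R / M%:R) = fun i s => f t i s + M%:R^-1 *: D i s); last first.
    apply/funext => i; apply/funext => s; rewrite !fE -addrA -scalerDl.
    by rewrite -[k.+1]addn1 natrD mulrDl mul1r.
  apply: (@push_isotopy _ _ a b (M%:R^-1 * B) r').
  - exact: cf.
  - by move=> i s; apply: cvgZ; [exact: cvg_cst|exact: cD].
  - by move=> i s sab; rewrite fE mxE [X in _ + X]mxE Dc mulr0 addr0 (fc i s sab).1.
  - by move=> i s; rewrite mxE Dc mulr0.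
  - by move=> i s sab; rewrite Dout// scaler0.
  - move=> i s; rewrite normrZ ger0_norm ?invr_ge0 ?(ltW M0)//.
    by rewrite ler_wpM2l ?invr_ge0 ?(ltW M0)// DB.
  - exact: r'0.
  - exact: MB.
  - move=> i j s ij sab; apply: le_trans (fr1 (i, j) ij t s t01 sab).
    by rewrite ge_min lexx orbT.
  - move=> q Cq i qab; apply: le_trans (fC q Cq qab i t t01).
    by rewrite ge_min lexx.
have := step M (leqnn _); rewrite divff ?gt_eqF//.
rewrite (_ : f 0 = f0); last first.
  by apply/funext => i; apply/funext => s; rewrite fE scale0r addr0.
rewrite (_ : f 1 = f1)//.
by apply/funext => i; apply/funext => s; rewrite /f subrr scale0r scale1r add0r.
Qed.

End LevelMove.

(** * Segments and piecewise linear paths *)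

Section Segments.
Variable R : realType.
Implicit Types u v w : 'rV[R]_3.

Lemma segmentP u v w :
  segment u v w <-> exists t : R, 0 <= t <= 1 /\ w = (1 - t) *: u + t *: v.
Proof.
split; first by move=> [t /=]; rewrite in_itv /= => t01 <-; exists t.
by move=> [t [t01 ->]]; exists t => //=; rewrite in_itv.
Qed.

Lemma segmentC u v : segment u v = segment v u.
Proof.
suff H a b w : segment a b w -> segment b a w by apply/seteqP; split => w; exact: H.
move=> /segmentP[t [/andP[t0 t1] ->]]; apply/segmentP; exists (1 - t).
by split; [lra|rewrite addrC opprB addrCA subrr addr0].
Qed.

Lemma segment_split u v (t : R) : 0 <= t <= 1 ->
  segment u v = segment u ((1 - t) *: u + t *: v) `|`
                segment ((1 - t) *: u + t *: v) v.
Proof.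
move=> /andP[t0 t1]; set m := _ + _.
apply/seteqP; split => w.
- move=> /segmentP[x [/andP[x0 x1] ->]].
  have [xt|tx] := leP x t.
    left; apply/segmentP.
    have [t00|t_neq0] := eqVneq t 0.
      exists 0; rewrite lexx ler01; split => //.
      have x00 : x = 0 by lra.
      by rewrite x00 !scale0r.
    exists (x / t); have tpos : 0 < t by rewrite lt_def t_neq0.
    split; first by rewrite divr_ge0// ler_pdivrMr// mul1r.
    rewrite /m; apply/rowP => i; rewrite !mxE; field.
    exact: t_neq0.
  right; apply/segmentP; exists ((x - t) / (1 - t)).
  have tpos : 0 < 1 - t by lra.
  split; first by rewrite divr_ge0 ?ler_pdivrMr ?mul1r//=; lra.
  rewrite /m; apply/rowP => i; rewrite !mxE; field.
  by rewrite gt_eqF.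
- move=> [|] /segmentP[x [/andP[x0 x1] ->]]; apply/segmentP.
  + exists (x * t); split; first by rewrite mulr_ge0//= mulr_ile1.
    by rewrite /m; apply/rowP => i; rewrite !mxE; ring.
  + exists (t + x * (1 - t)); split; last first.
      by rewrite /m; apply/rowP => i; rewrite !mxE; ring.
    by apply/andP; split; nra.
Qed.

Lemma segment_left u v : segment u v u.
Proof.
by apply/segmentP; exists 0; rewrite lexx ler01 subr0 scale1r scale0r addr0.
Qed.

Lemma segment_right u v : segment u v v.
Proof.
by apply/segmentP; exists 1; rewrite lexx ler01 subrr scale1r scale0r add0r.
Qed.

End Segments.

Section PiecewiseLinear.
Variables (R : realType) (s : nat -> R).
Implicit Types (P : nat -> 'rV[R]_3) (x : R) (l m r : nat).

Definition ramp (u v x : R) : R := Num.min 1 (Num.max 0 ((x - u) / (v - u))).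

Lemma ramp_le u v x : u < v -> x <= u -> ramp u v x = 0.
Proof.
move=> uv xu; have vu : 0 < v - u by rewrite subr_gt0.
rewrite /ramp (max_idPl _) ?(min_idPr _)//.
by rewrite ler_pdivrMr// mul0r subr_le0.
Qed.

Lemma ramp_ge u v x : u < v -> v <= x -> ramp u v x = 1.
Proof.
move=> uv vx; have vu : 0 < v - u by rewrite subr_gt0.
have h : 1 <= (x - u) / (v - u) by rewrite ler_pdivlMr// mul1r lerD2r.
by rewrite /ramp (max_idPr _) ?(min_idPl _)// (le_trans ler01).
Qed.

Lemma ramp_mid u v x : u < v -> u <= x <= v -> ramp u v x = (x - u) / (v - u).
Proof.
move=> uv /andP[ux xv]; have vu : 0 < v - u by rewrite subr_gt0.
rewrite /ramp (max_idPr _) ?divr_ge0 ?subr_ge0// ?ltW// (min_idPr _)//.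
by rewrite ler_pdivrMr// mul1r lerD2r.
Qed.

Lemma continuous_ramp u v : continuous (ramp u v).
Proof.
have c0 : continuous (fun x : R => (x - u) / (v - u)).
  move=> x; apply: cvgM; last exact: cvg_cst.
  by apply: cvgB; [exact: cvg_id|exact: cvg_cst].
move=> x; apply: (@continuous_min _ _ (fun=> 1)
  (fun x => Num.max 0 ((x - u) / (v - u)))); first exact: cst_continuous.
apply: (@continuous_max _ _ (fun=> 0) (fun x => (x - u) / (v - u))) (c0 x).
exact: cst_continuous.
Qed.

(** A sum of ramps instead of a case distinction: the path is continuous on the whole line, constant
    outside the range of the levels, and linear in the vertices [P], so that mixing two paths mixes
    their vertices. *)
Fixpoint pl P r x : 'rV[R]_3 :=
  if r is r'.+1 then pl P r' x + ramp (s r') (s r) x *: (P r - P r') else P 0%N.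

Lemma continuous_pl P r : continuous (pl P r).
Proof.
elim: r => [|r IH] x /=; first exact: cvg_cst.
apply: cvgD; first exact: IH.
by apply: cvgZ; [exact: continuous_ramp|exact: cvg_cst].
Qed.

Lemma pl_mix P Q (t : R) r x :
  (1 - t) *: pl P r x + t *: pl Q r x =
  pl (fun l => (1 - t) *: P l + t *: Q l) r x.
Proof.
elim: r => [//|r IH] /=; rewrite -IH.
by apply/rowP => i; rewrite !mxE; ring.
Qed.

Variable r : nat.
Hypothesis s_inc : forall l, (l < r)%N -> s l < s l.+1.

Lemma level_le l m : (l <= m <= r)%N -> s l <= s m.
Proof.
elim: m => [|m IH]; first by rewrite leqn0 => /andP[/eqP ->].
rewrite leq_eqVlt => /andP[/orP[/eqP -> //|lm] mr].
by rewrite (le_trans (IH _)) ?(ltW (s_inc mr))//; rewrite -ltnS lm ltnW.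
Qed.

Lemma pl_above P m x : (m <= r)%N -> s m <= x -> pl P m x = P m.
Proof.
elim: m => [//|m IH] mr mx /=.
rewrite ramp_ge//; last exact: s_inc.
rewrite IH ?(ltnW mr)// ?(le_trans (ltW (s_inc mr)))//.
by rewrite scale1r addrC subrK.
Qed.

Lemma pl_below P m x : (m <= r)%N -> x <= s 0%N -> pl P m x = P 0%N.
Proof.
elim: m => [//|m IH] mr x0 /=.
rewrite ramp_le; [|exact: s_inc|].
  by rewrite scale0r addr0 IH// ltnW.
by rewrite (le_trans x0)// level_le//= ltnW.
Qed.

Lemma pl_segment P l x : (l < r)%N -> s l <= x <= s l.+1 ->
  pl P r x = (1 - ramp (s l) (s l.+1) x) *: P l + ramp (s l) (s l.+1) x *: P l.+1.
Proof.
move=> lr /andP[lx xl].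
suff H m : (l < m <= r)%N -> pl P m x = (1 - ramp (s l) (s l.+1) x) *: P l +
    ramp (s l) (s l.+1) x *: P l.+1 by apply: H; rewrite lr leqnn.
elim: m => // m IH /andP[]; rewrite ltnS leq_eqVlt => /orP[/eqP <- _ /=|lm mr /=].
  rewrite pl_above ?(ltnW lr)//.
  by apply/rowP => i; rewrite !mxE; ring.
rewrite IH ?lm ?(ltnW mr)// (@ramp_le (s m)) ?scale0r ?addr0//; first exact: s_inc.
by rewrite (le_trans xl)// level_le// lm ltnW.
Qed.

Lemma ramp01 u v x : 0 <= ramp u v x <= 1.
Proof. by rewrite /ramp le_min ler01 le_max lexx /= ge_min lexx. Qed.

Lemma level_locate x : (0 < r)%N -> s 0%N <= x <= s r ->
  exists2 l, (l < r)%N & s l <= x <= s l.+1.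
Proof.
move=> r0 /andP[x0 xr].
suff H m : (0 < m <= r)%N -> x <= s m -> exists2 l, (l < r)%N & s l <= x <= s l.+1.
  by apply: (H r); rewrite ?r0 ?leqnn.
elim: m => // -[_ mr x1|m IH /andP[_ mr] xm]; first by exists 0%N; rewrite ?x0.
have [xm'|mx] := leP x (s m.+1); last by exists m.+1; rewrite ?xm ?ltW.
by apply: IH => //=; rewrite ltnW.
Qed.

Lemma pl_coord P (c : 'I_3) x : (0 < r)%N -> (forall l, (l <= r)%N -> P l 0 c = s l) ->
  s 0%N <= x <= s r -> pl P r x 0 c = x.
Proof.
move=> r0 Pc xr; have [l lr xl] := level_locate r0 xr.
have sl := s_inc lr.
rewrite (pl_segment _ lr xl) !mxE !Pc ?(ltnW lr)//.
rewrite ramp_mid//; field.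
by rewrite subr_eq0 gt_eqF.
Qed.

Lemma pl_image P : (0 < r)%N ->
  [set v | exists x, s 0%N <= x <= s r /\ v = pl P r x] =
  [set v | exists l, (l < r)%N /\ segment (P l) (P l.+1) v].
Proof.
move=> r0; apply/seteqP; split => v.
  move=> [x [xr ->]]; have [l lr xl] := level_locate r0 xr.
  exists l; split => //; apply/segmentP; exists (ramp (s l) (s l.+1) x).
  by rewrite ramp01 (pl_segment _ lr xl).
move=> [l [lr /segmentP[t [/andP[t0 t1] ->]]]]; have sl := s_inc lr.
exists ((1 - t) * s l + t * s l.+1).
have xl : s l <= (1 - t) * s l + t * s l.+1 <= s l.+1 by apply/andP; split; nra.
split.
  case/andP: xl => xl xl'; rewrite (le_trans (level_le _) xl)/=; last by rewrite ltnW.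
  by rewrite (le_trans xl')// level_le// lr leqnn.
rewrite (pl_segment _ lr xl) ramp_mid//.
suff -> : ((1 - t) * s l + t * s l.+1 - s l) / (s l.+1 - s l) = t by [].
by field; rewrite subr_eq0 gt_eqF.
Qed.

End PiecewiseLinear.

(** * Straight-line moves of polygonal arcs *)

Section TrailMove.
Variables (R : realType) (c : 'I_3) (N r : nat) (s : nat -> R).
Implicit Types P Q : 'I_N -> nat -> 'rV[R]_3.

Definition trails P : set 'rV[R]_3 :=
  [set v | exists i l, (l < r)%N /\ segment (P i l) (P i l.+1) v].

(* Two arcs whose vertices have common heights do not meet during the
   straight-line homotopy as soon as, between consecutive heights, one linear
   functional of [(x, y)] separates them at the beginning and at the end. *)
Lemma trail_move P Q (C : set 'rV[R]_3) :
  (0 < r)%N -> (forall l, (l < r)%N -> s l < s l.+1) ->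
  (forall i l, (l <= r)%N -> P i l 0 c = s l /\ Q i l 0 c = s l) ->
  (forall i, P i 0%N = Q i 0%N /\ P i r = Q i r) ->
  (forall (i j : 'I_N) l, (i < j)%N -> (l < r)%N ->
     exists a b : R, forall m, (l <= m <= l.+1)%N ->
       0 < a * (P i m 0 0 - P j m 0 0) + b * (P i m 0 1 - P j m 0 1) /\
       0 < a * (Q i m 0 0 - Q j m 0 0) + b * (Q i m 0 1 - Q j m 0 1)) ->
  (forall q, C q -> s 0%N < q 0 c < s r ->
     exists k : 'I_3,
       ((forall i l, (l <= r)%N -> P i l 0 k + 1 <= q 0 k /\ Q i l 0 k + 1 <= q 0 k) \/
        (forall i l, (l <= r)%N -> q 0 k + 1 <= P i l 0 k /\ q 0 k + 1 <= Q i l 0 k))) ->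
  isotopic (Some @` (C `|` trails P)) (Some @` (C `|` trails Q)).
Proof.
move=> r0 s_inc Pc PQ sep far.
have trailsE P' : trails P' = arcs (fun i => pl s (P' i) r) (s 0%N) (s r).
  apply/seteqP; split => v.
    move=> [i [l lv]]; have : [set v | exists l, (l < r)%N /\
      segment (P' i l) (P' i l.+1) v] v by exists l.
    by rewrite -(pl_image s_inc)// => -[x xv]; exists i, x.
  move=> [i [x xv]]; exists i.
  have : [set v | exists x, s 0%N <= x <= s r /\ v = pl s (P' i) r x] v by exists x.
  by rewrite (pl_image s_inc).
rewrite !trailsE; apply: (@level_move _ c _ _ _ _ _ 1).
- by move=> i; exact: continuous_pl.
- by move=> i; exact: continuous_pl.
- by move=> i x xr; split; apply: (pl_coord s_inc) => // l lr; have [] := Pc i l lr.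
- move=> i x; rewrite negb_and -!leNgt => /orP[x0|xr].
    by rewrite !(pl_below s_inc)// (PQ i).1.
  by rewrite !(pl_above s_inc)// (PQ i).2.
- move=> i j t x ij /andP[t0 t1] xr; rewrite !pl_mix.
  have [l lr xl] := level_locate r0 xr.
  rewrite !(pl_segment s_inc _ lr xl).
  have /andP[] := ramp01 (s l) (s l.+1) x; set z := ramp _ _ _ => z0 z1.
  wlog ij' : i j {ij} / (i < j)%N.
    move=> W; have := ij; rewrite neq_ltn => /orP[/W //|/W H /esym]; exact: H.
  have [a [b ab]] := sep i j l ij' lr.
  have [|P0 Q0] := ab l; first by rewrite leqnn leqnSn.
  have [|P1 Q1] := ab l.+1; first by rewrite leqnSn leqnn.
  move=> E; have E0 := congr1 (fun v : 'rV[R]_3 => v 0 0) E.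
  have E1 := congr1 (fun v : 'rV[R]_3 => v 0 1) E.
  move: E0 E1; rewrite !mxE => E0 E1.
  (* On the difference of the two arcs the functional is the bilinear interpolation, in the time [t]
     and the relative height [z], of four positive values. If the arcs met, it would be 0. *)
  pose p0 := a * (P i l 0 0 - P j l 0 0) + b * (P i l 0 1 - P j l 0 1).
  pose p1 := a * (P i l.+1 0 0 - P j l.+1 0 0) + b * (P i l.+1 0 1 - P j l.+1 0 1).
  pose q0 := a * (Q i l 0 0 - Q j l 0 0) + b * (Q i l 0 1 - Q j l 0 1).
  pose q1 := a * (Q i l.+1 0 0 - Q j l.+1 0 0) + b * (Q i l.+1 0 1 - Q j l.+1 0 1).
  have S0 : (1 - z) * ((1 - t) * p0 + t * q0) + z * ((1 - t) * p1 + t * q1) = 0.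
    have := congr2 (fun u v => a * u + b * v) E0 E1.
    move/eqP; rewrite -subr_eq0 => /eqP <-; rewrite /p0 /p1 /q0 /q1; ring.
  have A0 : 0 < (1 - t) * p0 + t * q0.
    by have [->|tn] := eqVneq t 0; [rewrite subr0 mul1r mul0r addr0|
      rewrite ltr_wpDl ?mulr_ge0 ?subr_ge0// ?ltW// mulr_gt0// lt_def tn].
  have A1 : 0 < (1 - t) * p1 + t * q1.
    by have [->|tn] := eqVneq t 0; [rewrite subr0 mul1r mul0r addr0|
      rewrite ltr_wpDl ?mulr_ge0 ?subr_ge0// ?ltW// mulr_gt0// lt_def tn].
  have : 0 < (1 - z) * ((1 - t) * p0 + t * q0) + z * ((1 - t) * p1 + t * q1).
    by have [->|zn] := eqVneq z 0; [rewrite subr0 mul1r mul0r addr0|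
      rewrite ltr_wpDl ?mulr_ge0 ?subr_ge0// ?ltW// mulr_gt0// lt_def zn].
  by rewrite S0 ltxx.
- exact: ltr01.
- move=> q Cq qr i t /andP[t0 t1]; have [k Hk] := far q Cq qr.
  apply: le_trans (normv_coord _ k).
  have xr : s 0%N <= q 0 c <= s r by case/andP: qr => *; rewrite !ltW.
  have [l lr xl] := level_locate r0 xr.
  rewrite pl_mix (pl_segment s_inc _ lr xl).
  have /andP[] := ramp01 (s l) (s l.+1) (q 0 c); set z := ramp _ _ _ => z0 z1.
  rewrite !mxE; case: Hk => Hk.
    have [p0 q0] := Hk i l (ltnW lr); have [p1 q1] := Hk i l.+1 lr.
    rewrite (le_trans _ (ler_norm _))//.
    have h0 : (1 - t) * P i l 0 k + t * Q i l 0 k <= q 0 k - 1 by nra.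
    have h1 : (1 - t) * P i l.+1 0 k + t * Q i l.+1 0 k <= q 0 k - 1 by nra.
    by nra.
  have [p0 q0] := Hk i l (ltnW lr); have [p1 q1] := Hk i l.+1 lr.
  rewrite distrC (le_trans _ (ler_norm _))//.
  have h0 : q 0 k + 1 <= (1 - t) * P i l 0 k + t * Q i l 0 k by nra.
  have h1 : q 0 k + 1 <= (1 - t) * P i l.+1 0 k + t * Q i l.+1 0 k by nra.
  by nra.
Qed.

End TrailMove.

(** * The isotopies behind the braid relations *)

Section Zigzags.
Variable R : realType.

Lemma point0 (x y z : R) : point x y z 0 0 = x. Proof. by rewrite mxE. Qed.
Lemma point1 (x y z : R) : point x y z 0 1 = y. Proof. by rewrite mxE. Qed.
Lemma point2 (x y z : R) : point x y z 0 2 = z. Proof. by rewrite mxE. Qed.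

Lemma pointP (v : 'rV[R]_3) : v = point (v 0 0) (v 0 1) (v 0 2).
Proof.
by apply/rowP => -[[|[|[|i]]] iP]; rewrite !mxE //=; congr (v _ _); exact/val_inj.
Qed.

(** The height grows by 1/2 from vertex to vertex, because a crossing strand has its extreme [y] in
    the middle of its layer. *)
Fixpoint zig (z : R) (vs : seq (R * R)) : set 'rV[R]_3 :=
  if vs is p :: vs' then
    (if vs' is q :: _ then
       segment (point p.1 p.2 z) (point q.1 q.2 (z + 2^-1)) else set0)
    `|` zig (z + 2^-1) vs'
  else set0.

Definition zigs (z : R) (vss : seq (seq (R * R))) : set 'rV[R]_3 :=
  foldr (fun vs A => zig z vs `|` A) set0 vss.

Definition vertex (z : R) (vs : seq (R * R)) (l : nat) : 'rV[R]_3 :=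
  let p := nth (0, 0) vs l in point p.1 p.2 (z + l%:R * 2^-1).

Lemma zigE z vs v : zig z vs v <->
  exists l, (l.+1 < size vs)%N /\ segment (vertex z vs l) (vertex z vs l.+1) v.
Proof.
elim: vs z => [|p vs IH] z /=; first by split => // -[l []].
have shift l : vertex (z + 2^-1) vs l = vertex z (p :: vs) l.+1.
  by rewrite /vertex /= -natr1; congr (point _ _ _); ring.
split.
  move=> [|/IH [l [lv lS]]]; last by exists l.+1; rewrite -!shift.
  case: vs {IH shift} => [//|q vs] H; exists 0%N; split => //.
  by rewrite /vertex /= mul0r mul1r addr0.
move=> [[|l] [lv lS]]; last by right; apply/IH; exists l; rewrite !shift.
by left; case: vs {IH shift} lv lS => // q vs _; rewrite /vertex /= mul0r mul1r addr0.
Qed.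

Lemma zigsE z vss v : zigs z vss v <->
  exists i, (i < size vss)%N /\ zig z (nth [::] vss i) v.
Proof.
elim: vss => [|vs vss IH] /=; first by split => // -[l []].
split.
  by move=> [H|/IH[i [iv H]]]; [exists 0%N|exists i.+1].
by move=> [[|i] [iv H]]; [left|right; apply/IH; exists i].
Qed.

Lemma zigs_trails z r vss : all (fun vs => size vs == r.+1) vss ->
  zigs z vss = trails r (fun i : 'I_(size vss) => vertex z (nth [::] vss i)).
Proof.
move=> /(all_nthP [::]) sz; apply/seteqP; split => v.
  move=> /zigsE[i [iv /zigE[l [lv lS]]]]; exists (Ordinal iv), l; split => //.
  by move: lv; rewrite (eqP (sz i iv)).
move=> [i [l [lr lS]]]; apply/zigsE; exists i; split => //.
by apply/zigE; exists l; rewrite (eqP (sz i _)).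
Qed.

(** Reduces a move of strands to a finite table: [sep i j l] is the functional that separates
    strands [i] and [j] between the vertices [l] and [l + 1], and it has to work for both pictures.
    The passive set is kept away in the [x]-direction. *)
Lemma zig_move (z lo hi : R) (r : nat) (vss wss : seq (seq (R * R)))
    (sep : nat -> nat -> nat -> R * R) (C : set 'rV[R]_3) :
  (0 < r)%N -> size vss = size wss ->
  all (fun vs => size vs == r.+1) vss -> all (fun vs => size vs == r.+1) wss ->
  let pos V i l := nth (0, 0) (nth [::] V i) l in
  (forall i l, (i < size vss)%N -> l = 0%N \/ l = r ->
     pos vss i l = pos wss i l) ->
  (forall V i j l m, V = vss \/ V = wss -> (i < j < size vss)%N -> (l < r)%N ->
     m = l \/ m = l.+1 ->
     0 < (sep i j l).1 * ((pos V i m).1 - (pos V j m).1) +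
         (sep i j l).2 * ((pos V i m).2 - (pos V j m).2)) ->
  (forall V i l, V = vss \/ V = wss -> (i < size vss)%N -> (l <= r)%N ->
     lo <= (pos V i l).1 <= hi) ->
  (forall q, C q -> z < q 0 2 < z + r%:R * 2^-1 ->
     q 0 0 <= lo - 1 \/ hi + 1 <= q 0 0) ->
  isotopic (Some @` (C `|` zigs z vss)) (Some @` (C `|` zigs z wss)).
Proof.
move=> r0 vw szv szw pos ends sepP box far.
rewrite (zigs_trails _ szv) (zigs_trails _ szw).
pose Q := fun i : 'I_(size vss) => vertex z (nth [::] wss i).
have -> : trails r (fun i : 'I_(size wss) => vertex z (nth [::] wss i)) = trails r Q.
  by rewrite /Q vw.
apply: (@trail_move _ 2 _ r (fun l => z + l%:R * 2^-1)) => //.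
- by move=> l _; rewrite /= -(natr1 l); lra.
- by move=> i l _; rewrite !point2.
- by move=> i; split; rewrite /Q /vertex -!/(pos _ _ _) ends//; [left|right].
- move=> i j l ij lr; exists (sep i j l).1, (sep i j l).2 => m lm.
  have Hm : m = l \/ m = l.+1.
    case/andP: lm; rewrite leq_eqVlt => /orP[/eqP ->|lm ml]; first by left.
    by right; apply/eqP; rewrite eqn_leq lm ml.
  rewrite /Q /vertex !point0 !point1 -!/(pos _ _ _).
  have ijv : (i < j < size vss)%N by rewrite ij ltn_ord.
  by split; apply: sepP => //; [left|right].
- move=> q Cq qr; exists 0; have := far q Cq; rewrite mul0r addr0 in qr.
  move=> /(_ qr) [qlo|qhi]; [right|left] => i l lr.
    have /andP[v1 _] := box vss i l (or_introl erefl) (ltn_ord i) lr.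
    have /andP[w1 _] := box wss i l (or_intror erefl) (ltn_ord i) lr.
    by rewrite /Q /vertex !point0 -!/(pos _ _ _); split; lra.
  have /andP[_ v1] := box vss i l (or_introl erefl) (ltn_ord i) lr.
  have /andP[_ w1] := box wss i l (or_intror erefl) (ltn_ord i) lr.
  by rewrite /Q /vertex !point0 -!/(pos _ _ _); split; lra.
Qed.

(* The pair of strands of [sigma_k^(+-1)] crosses in the lower half of a slab
   of height 2, or uniformly in the whole slab, or in its upper half. *)
Definition low_pair (k : R) (e : R) : seq (seq (R * R)) :=
  [:: [:: (k, 0); (k + 2^-1, e); (k + 1, 0); (k + 1, 0); (k + 1, 0)];
      [:: (k + 1, 0); (k + 2^-1, - e); (k, 0); (k, 0); (k, 0)]].

Definition slow_pair (k : R) (e : R) : seq (seq (R * R)) :=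
  [:: [:: (k, 0); (k + 4^-1, e / 2); (k + 2^-1, e); (k + 3 / 4, e / 2); (k + 1, 0)];
      [:: (k + 1, 0); (k + 3 / 4, - e / 2); (k + 2^-1, - e); (k + 4^-1, - e / 2); (k, 0)]].

Definition high_pair (k : R) (e : R) : seq (seq (R * R)) :=
  [:: [:: (k, 0); (k, 0); (k, 0); (k + 2^-1, e); (k + 1, 0)];
      [:: (k + 1, 0); (k + 1, 0); (k + 1, 0); (k + 2^-1, - e); (k, 0)]].

(** A direct straight-line homotopy would make the strands collide: at the middle height of the slab
    their places in the plane [y = 0] are interchanged between the low and the high picture. In the
    slow picture they are separated in [y] at that height. *)
Lemma pair_slide (k z : R) (e : bool) (C : set 'rV[R]_3) :
  let s : R := if e then 1 else - 1 in
  (forall q, C q -> z < q 0 2 < z + 2 -> q 0 0 <= k - 1 \/ k + 2 <= q 0 0) ->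
  isotopic (Some @` (C `|` zigs z (low_pair k s)))
           (Some @` (C `|` zigs z (high_pair k s))).
Proof.
move=> s far.
have far' q : C q -> z < q 0 2 < z + 4%:R * 2^-1 -> q 0 0 <= k - 1 \/ k + 1 + 1 <= q 0 0.
  move=> Cq qz; have [|?|?] := far q Cq; [by lra|by left|by right; lra].
have s2 : s = 1 \/ s = - 1 by rewrite /s; case: (e); [left|right].
have s1 : s * s = 1 by case: s2 => ->; lra.
apply: (@isotopic_trans _ (Some @` (C `|` zigs z (slow_pair k s)))).
(* The coefficient of [x] changes sign where the low pair crosses, respectively the high pair in the
   second move; the summand [s * y] outweighs it wherever the slow pair is in the other order. *)
- apply: (@zig_move z k (k + 1) 4 _ _ (fun _ _ l =>
    nth (0, 0) [:: (- 1, s); (1, s); (1, s); (1, s)] l)) => //.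
  + by move=> [|[|i]] l // _ [] ->.
  + move=> V i j l m VE /andP[ij jv] lr; case: j ij jv => [|[|j]] // ij _.
    case: i ij => // _; case: l lr => [|[|[|[|l]]]] // _; case: VE => ->; case => -> /=;
    by case: s2 => ->; lra.
  + move=> V [|[|i]] [|[|[|[|[|l]]]]] // VE _ _; case: VE => -> /=;
    by apply/andP; split; lra.
- apply: (@zig_move z k (k + 1) 4 _ _ (fun _ _ l =>
    nth (0, 0) [:: (- 1, s); (- 1, s); (- 1, s); (1, s)] l)) => //.
  + by move=> [|[|i]] l // _ [] ->.
  + move=> V i j l m VE /andP[ij jv] lr; case: j ij jv => [|[|j]] // ij _.
    case: i ij => // _; case: l lr => [|[|[|[|l]]]] // _; case: VE => ->; case => -> /=;
    by case: s2 => ->; lra.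
  + move=> V [|[|i]] [|[|[|[|[|l]]]]] // VE _ _; case: VE => -> /=;
    by apply/andP; split; lra.
Qed.

(** The first strand stays in [y >= 0] and the third in [y <= 0], while the second passes below the
    first and above the third. The strands are thus stacked in the [y]-direction, and the essential
    motion takes the middle one from [x = k] to [x = k + 2], between the two others at [y = 3] and
    [y = - 3]. *)
Definition yb_word1 (k : R) : seq (seq (R * R)) :=
  [:: [:: (k, 0); (k + 2^-1, 1); (k + 1, 0); (k + 3 / 2, 1); (k + 2, 0); (k + 2, 0); (k + 2, 0)];
      [:: (k + 1, 0); (k + 2^-1, - 1); (k, 0); (k, 0); (k, 0); (k + 2^-1, 1); (k + 1, 0)];
      [:: (k + 2, 0); (k + 2, 0); (k + 2, 0); (k + 3 / 2, - 1); (k + 1, 0); (k + 2^-1, - 1); (k, 0)]].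

Definition yb_push1 (k : R) : seq (seq (R * R)) :=
  [:: [:: (k, 0); (k, 3 / 2); (k, 3); (k + 2^-1, 3); (k + 1, 3); (k + 3 / 2, 3 / 2); (k + 2, 0)];
      [:: (k + 1, 0); (k + 2^-1, - 1); (k, 0); (k, 0); (k, 0); (k + 2^-1, 1); (k + 1, 0)];
      [:: (k + 2, 0); (k + 3 / 2, - 3 / 2); (k + 1, - 3); (k + 2^-1, - 3); (k, - 3); (k, - 3 / 2); (k, 0)]].

Definition yb_push2 (k : R) : seq (seq (R * R)) :=
  [:: [:: (k, 0); (k, 3 / 2); (k, 3); (k + 2^-1, 3); (k + 1, 3); (k + 3 / 2, 3 / 2); (k + 2, 0)];
      [:: (k + 1, 0); (k + 3 / 2, 1); (k + 2, 0); (k + 2, 0); (k + 2, 0); (k + 3 / 2, - 1); (k + 1, 0)];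
      [:: (k + 2, 0); (k + 3 / 2, - 3 / 2); (k + 1, - 3); (k + 2^-1, - 3); (k, - 3); (k, - 3 / 2); (k, 0)]].

Definition yb_word2 (k : R) : seq (seq (R * R)) :=
  [:: [:: (k, 0); (k, 0); (k, 0); (k + 2^-1, 1); (k + 1, 0); (k + 3 / 2, 1); (k + 2, 0)];
      [:: (k + 1, 0); (k + 3 / 2, 1); (k + 2, 0); (k + 2, 0); (k + 2, 0); (k + 3 / 2, - 1); (k + 1, 0)];
      [:: (k + 2, 0); (k + 3 / 2, - 1); (k + 1, 0); (k + 2^-1, - 1); (k, 0); (k, 0); (k, 0)]].

Section YangBaxterMove.
Variables (k z : R) (C : set 'rV[R]_3).
Hypothesis far : forall q, C q -> z < q 0 2 < z + 6%:R * 2^-1 ->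
  q 0 0 <= k - 1 \/ k + 2 + 1 <= q 0 0.

Lemma yb_push1_move : isotopic (Some @` (C `|` zigs z (yb_word1 k))) (Some @` (C `|` zigs z (yb_push1 k))).
Proof.
(* The pairs (0, 1), (0, 2), (1, 2) have the sums 1, 2, 3, so [(i + j).-1] selects the row of the
   pair; the columns are the six half-layers. *)
apply: (@zig_move z k (k + 2) 6 _ _ (fun i j l => nth (0, 0) (nth [::]
         [:: [:: (- 1, 1); (1, 1); (1, 1); (1, 0); (1, 0); (1, - 1)];
          [:: (- 1, 0); (- 1, 0); (- 1, 1); (1, 1); (1, 0); (1, 0)];
          [:: (- 1, - 1); (- 1, 0); (- 1, 0); (- 1, 1); (- 1, 1); (1, 1)]] (i + j).-1) l)) => //.
  + by move=> [|[|[|i]]] l // _ [] ->.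
  + move=> V i j l m VE /andP[ij jv] lr; case: j ij jv => [|[|[|j]]] // ij _;
    case: i ij => [|[|i]] // _; case: l lr => [|[|[|[|[|[|l]]]]]] // _;
    case: VE => ->; case => -> /=; lra.
  + move=> V [|[|[|i]]] [|[|[|[|[|[|[|l]]]]]]] // VE _ _; case: VE => -> /=;
    by apply/andP; split; lra.
Qed.

Lemma yb_push_move : isotopic (Some @` (C `|` zigs z (yb_push1 k))) (Some @` (C `|` zigs z (yb_push2 k))).
Proof.
apply: (@zig_move z k (k + 2) 6 _ _ (fun i j l => nth (0, 0) (nth [::]
         [:: [:: (- 1, 0); (- 1, 1); (- 1, 1); (- 1, 1); (0, 1); (1, 1)];
          [:: (- 1, 0); (- 1, 0); (- 1, 1); (- 1, 1); (- 1, 1); (1, 0)];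
          [:: (- 1, 1); (- 1, 1); (- 1, 1); (- 1, 1); (0, 1); (1, 0)]] (i + j).-1) l)) => //.
  + by move=> [|[|[|i]]] l // _ [] ->.
  + move=> V i j l m VE /andP[ij jv] lr; case: j ij jv => [|[|[|j]]] // ij _;
    case: i ij => [|[|i]] // _; case: l lr => [|[|[|[|[|[|l]]]]]] // _;
    case: VE => ->; case => -> /=; lra.
  + move=> V [|[|[|i]]] [|[|[|[|[|[|[|l]]]]]]] // VE _ _; case: VE => -> /=;
    by apply/andP; split; lra.
Qed.

Lemma yb_push2_move : isotopic (Some @` (C `|` zigs z (yb_push2 k))) (Some @` (C `|` zigs z (yb_word2 k))).
Proof.
apply: (@zig_move z k (k + 2) 6 _ _ (fun i j l => nth (0, 0) (nth [::]
         [:: [:: (- 1, - 1); (- 1, 0); (- 1, 0); (- 1, 0); (- 1, 1); (1, 1)];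
          [:: (- 1, 0); (- 1, 0); (- 1, 1); (1, 1); (1, 0); (1, 0)];
          [:: (- 1, 1); (1, 1); (1, 0); (1, 0); (1, 0); (1, - 1)]] (i + j).-1) l)) => //.
  + by move=> [|[|[|i]]] l // _ [] ->.
  + move=> V i j l m VE /andP[ij jv] lr; case: j ij jv => [|[|[|j]]] // ij _;
    case: i ij => [|[|i]] // _; case: l lr => [|[|[|[|[|[|l]]]]]] // _;
    case: VE => ->; case => -> /=; lra.
  + move=> V [|[|[|i]]] [|[|[|[|[|[|[|l]]]]]]] // VE _ _; case: VE => -> /=;
    by apply/andP; split; lra.
Qed.

End YangBaxterMove.

(* The strand passing over everything ([y] positive) and the one passing
   under everything are first pushed far away from the plane [y = 0]. *)
Lemma yang_baxter_move (k z : R) (C : set 'rV[R]_3) :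
  (forall q, C q -> z < q 0 2 < z + 3 -> q 0 0 <= k - 1 \/ k + 3 <= q 0 0) ->
  isotopic (Some @` (C `|` zigs z (yb_word1 k)))
           (Some @` (C `|` zigs z (yb_word2 k))).
Proof.
move=> far.
have far' q : C q -> z < q 0 2 < z + 6%:R * 2^-1 -> q 0 0 <= k - 1 \/ k + 2 + 1 <= q 0 0.
  move=> Cq qz; have [|?|?] := far q Cq; [by lra|by left|by right; lra].
apply: isotopic_trans (yb_push1_move far') _.
exact: isotopic_trans (yb_push_move far') (yb_push2_move far').
Qed.

End Zigzags.

(** * Braids as unions of strands *)

(** [None] stands for a layer without crossing, such as the one left behind when the crossing of a
    destabilization is pulled away. *)
Definition opt_word := seq (option (nat * bool)).

Definition step (o : option (nat * bool)) (i : nat) : nat :=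
  if o is Some (k, _) then
    if i == k then k.+1 else if i == k.+1 then k else i
  else i.

Section Layers.
Variable R : realType.

(* Position at mid-height of the strand entering a layer at [i]. *)
Definition mid (o : option (nat * bool)) (i : nat) : R * R :=
  if o is Some (k, e) then
    let s : R := if e then 1 else - 1 in
    if i == k then (k%:R + 2^-1, s)
    else if i == k.+1 then (k%:R + 2^-1, - s) else (i%:R, 0)
  else (i%:R, 0).

Definition strand (j : nat) (o : option (nat * bool)) (i : nat) : set 'rV[R]_3 :=
  zig j%:R [:: (i%:R, 0); mid o i; ((step o i)%:R, 0)].

Definition opt_letter (n : nat) (o : option (nat * bool)) :=
  if o is Some l then (0 < l.1 < n)%N else true.

Definition opt_layer (n j : nat) (o : option (nat * bool)) : set 'rV[R]_3 :=
  [set v | exists i, (1 <= i <= n)%N /\ strand j o i v].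

Fixpoint opt_braid (n j : nat) (w : opt_word) : set 'rV[R]_3 :=
  if w is o :: w' then opt_layer n j o `|` opt_braid n j.+1 w' else set0.

Lemma opt_braid_cat n j u w :
  opt_braid n j (u ++ w) = opt_braid n j u `|` opt_braid n (j + size u) w.
Proof.
elim: u j => [|o u IH] j /=; first by rewrite set0U addn0.
by rewrite IH addSnnS setUA.
Qed.

Lemma strandE j o i : strand j o i =
  segment (point i%:R 0 j%:R) (point (mid o i).1 (mid o i).2 (j%:R + 2^-1)) `|`
  segment (point (mid o i).1 (mid o i).2 (j%:R + 2^-1))
          (point (step o i)%:R 0 j.+1%:R).
Proof.
rewrite /strand /= !setU0.
by have -> : j%:R + 2^-1 + 2^-1 = j.+1%:R :> R by rewrite -(natr1 j); lra.
Qed.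

Lemma strand_straight j o i : mid o i = (i%:R, 0) -> step o i = i ->
  strand j o i = segment (point i%:R 0 j%:R) (point i%:R 0 j.+1%:R).
Proof.
move=> mi si; rewrite strandE mi si /=.
rewrite [RHS](@segment_split _ _ _ 2^-1); last by lra.
suff -> : (1 - 2^-1) *: point i%:R 0 j%:R + 2^-1 *: point i%:R 0 j.+1%:R =
  point i%:R 0 (j%:R + 2^-1) :> 'rV[R]_3 by [].
rewrite -(natr1 j).
by apply/rowP => -[[|[|[|c]]] //= ?]; rewrite !mxE /=; lra.
Qed.

Lemma layer_opt n j l : (0 < l.1 < n)%N -> layer n j l = opt_layer n j (Some l).
Proof.
case: l => k e /= /andP[k0 kn].
have kk : k.+1 == k = false by rewrite gtn_eqF.
have Ek : strand j (Some (k, e)) k = polyline (point k%:R 0 j%:R)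
    [:: point (k%:R + 2^-1) (if e then 1 else - 1) (j%:R + 2^-1);
        point k.+1%:R 0 j.+1%:R] :> set 'rV[R]_3.
  by rewrite strandE /= eqxx setU0.
have Ek1 : strand j (Some (k, e)) k.+1 = polyline (point k.+1%:R 0 j%:R)
    [:: point (k%:R + 2^-1) (- (if e then 1 else - 1)) (j%:R + 2^-1);
        point k%:R 0 j.+1%:R] :> set 'rV[R]_3.
  by rewrite strandE /= kk eqxx setU0.
have Ei i : i <> k -> i <> k.+1 -> strand j (Some (k, e)) i =
    segment (point i%:R 0 j%:R) (point i%:R 0 j.+1%:R) :> set 'rV[R]_3.
  move=> /eqP/negPf ik /eqP/negPf ik1.
  by rewrite strand_straight//= ik ik1.
apply/seteqP; split => v.
  move=> [[H|H]|[i /= [in1 [ik ik1]] H]].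
  - by exists k; rewrite Ek k0 ltnW.
  - by exists k.+1; rewrite Ek1.
  - by exists i; rewrite Ei.
move=> [i [in1]]; have [->|ik] := eqVneq i k; first by rewrite Ek; left; left.
have [->|ik1] := eqVneq i k.+1; first by rewrite Ek1; left; right.
rewrite Ei; [|exact/eqP|exact/eqP] => H; right; exists i => //=.
by split => //; split; exact/eqP.
Qed.

(** The layout parameter [N] is separate from the number [n] of arcs: during a destabilization, [n]
    strands are closed by arcs laid out for [n + 1]. *)
Definition closing_arcs (N m n : nat) : set 'rV[R]_3 :=
  \bigcup_(i in [set i : nat | (1 <= i <= n)%N]) closing_arc N m i.

Lemma bigcup_layers n j w : on_strands n w ->
  \bigcup_(i in `I_(size w)) layer n (j + i) (nth (0%N, true) w i) =
  opt_braid n j (map Some w).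
Proof.
elim: w j => [|l w IH] j /=; first by rewrite II0 bigcup_set0.
move=> /andP[ln wn]; rewrite -layer_opt// -IH//.
apply/seteqP; split => v.
  move=> [[|i] /= iw H]; first by left; rewrite addn0 in H.
  by right; exists i => //; rewrite addSnnS.
move=> [H|[i /= iw H]]; first by exists 0%N; rewrite //= addn0.
by exists i.+1 => //=; rewrite -addSnnS.
Qed.

Lemma closure_opt n w : on_strands n w ->
  closure_R3 n w = opt_braid n 0 (map Some w) `|` closing_arcs n (size w) n.
Proof. by move=> wn; rewrite -bigcup_layers. Qed.

Lemma segment_coord (c : 'I_3) (u v w : 'rV[R]_3) (a b : R) : segment u v w ->
  a <= u 0 c <= b -> a <= v 0 c <= b -> a <= w 0 c <= b.
Proof.
move=> /segmentP[t [/andP[t0 t1] ->]] /andP[au ub] /andP[av vb].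
by rewrite !mxE; apply/andP; split; nra.
Qed.

Lemma strand_height j o i v : strand j o i v -> j%:R <= v 0 2 <= j.+1%:R.
Proof.
rewrite strandE -(natr1 j) => -[] /segment_coord; apply; rewrite !point2; lra.
Qed.

Lemma strand_x_straight j o i v : mid o i = (i%:R, 0) -> step o i = i ->
  strand j o i v -> v 0 0 = i%:R.
Proof.
move=> mi si; rewrite strand_straight// => /segmentP[t [_ ->]].
by rewrite !mxE /=; lra.
Qed.

Lemma strand_x j k e i v : i = k \/ i = k.+1 -> strand j (Some (k, e)) i v ->
  k%:R <= v 0 0 <= k.+1%:R.
Proof.
have kk : k.+1 == k = false by rewrite gtn_eqF.
rewrite strandE => -[] -> /=; rewrite ?kk eqxx -(natr1 k);
by case=> /segment_coord; apply; rewrite !point0 /=; lra.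
Qed.

Lemma step_far k e i : i <> k -> i <> k.+1 ->
  mid (Some (k, e)) i = (i%:R, 0) /\ step (Some (k, e)) i = i.
Proof. by move=> /eqP/negPf ik /eqP/negPf ik1; rewrite /= ik ik1. Qed.

Lemma strand_far j k e i : i <> k -> i <> k.+1 ->
  strand j (Some (k, e)) i = strand j None i.
Proof.
move=> ik ik1; have [mi si] := step_far e ik ik1.
by rewrite !strand_straight.
Qed.

Lemma low_pairE j k e :
  zigs j%:R (low_pair k%:R (if e then 1 else - 1)) =
  (strand j (Some (k, e)) k `|` strand j.+1 None k.+1) `|`
  (strand j (Some (k, e)) k.+1 `|` strand j.+1 None k).
Proof.
have kk : k.+1 == k = false by rewrite gtn_eqF.
have j1 : j%:R + 2^-1 + 2^-1 = j.+1%:R :> R by rewrite -(natr1 j); lra.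
by rewrite /zigs /strand /= kk !eqxx !setU0 !j1 -(natr1 k) !setUA.
Qed.

Lemma high_pairE j k e :
  zigs j%:R (high_pair k%:R (if e then 1 else - 1)) =
  (strand j None k `|` strand j.+1 (Some (k, e)) k) `|`
  (strand j None k.+1 `|` strand j.+1 (Some (k, e)) k.+1).
Proof.
have kk : k.+1 == k = false by rewrite gtn_eqF.
have j1 : j%:R + 2^-1 + 2^-1 = j.+1%:R :> R by rewrite -(natr1 j); lra.
by rewrite /zigs /strand /= kk !eqxx !setU0 !j1 -(natr1 k) !setUA.
Qed.

(** What the rest of a closed diagram satisfies in a slab of the braid: only descending edges of
    closing arcs run there, at distance at least 1 from the last strand. *)
Definition clear_of (n a b : nat) (C : set 'rV[R]_3) :=
  forall q, C q -> a%:R < q 0 2 < b%:R -> n.+1%:R <= q 0 0.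

(** Letting the letter depend on the strand also describes pictures with two crossings in the same
    layer, which no word represents. *)
Definition two_layers (n j : nat) (o1 o2 : nat -> option (nat * bool)) :
    set 'rV[R]_3 :=
  [set v | exists i, (1 <= i <= n)%N /\
     (strand j (o1 i) i `|` strand j.+1 (o2 i) i) v].

Lemma two_layersE n j o1 o2 (C : set 'rV[R]_3) :
  C `|` (opt_layer n j o1 `|` opt_layer n j.+1 o2) =
  C `|` two_layers n j (fun=> o1) (fun=> o2).
Proof.
congr (_ `|` _); apply/seteqP; split => v.
  by move=> [|] [i [iv H]]; exists i; split => //; [left|right].
by move=> [i [iv [H|H]]]; [left|right]; exists i.
Qed.

(** Only the strands entering at [k] and [k + 1] move; all others form the same point set in both
    pictures and join [C] as obstacle for [pair_slide]. *)
Lemma slide_two_layers n j k e (o1 o2 o1' o2' : nat -> option (nat * bool)) C :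
  (0 < k < n)%N -> clear_of n j j.+2 C ->
  (forall i, i = k \/ i = k.+1 ->
    [/\ o1 i = Some (k, e), o2 i = None, o1' i = None & o2' i = Some (k, e)]) ->
  (forall i v, (1 <= i <= n)%N -> i <> k -> i <> k.+1 ->
    (strand j (o1 i) i `|` strand j.+1 (o2 i) i =
     strand j (o1' i) i `|` strand j.+1 (o2' i) i) /\
    ((strand j (o1 i) i `|` strand j.+1 (o2 i) i) v ->
      v 0 0 <= k%:R - 1 \/ k%:R + 2 <= v 0 0)) ->
  isotopic (Some @` (C `|` two_layers n j o1 o2))
           (Some @` (C `|` two_layers n j o1' o2')).
Proof.
move=> /andP[k0 kn] Cn ok other.
pose rest := [set v | exists i, [/\ (1 <= i <= n)%N, i <> k, i <> k.+1 &
  (strand j (o1 i) i `|` strand j.+1 (o2 i) i) v]].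
have lowE : C `|` two_layers n j o1 o2 =
    (C `|` rest) `|` zigs j%:R (low_pair k%:R (if e then 1 else - 1)).
  rewrite low_pairE -setUA; congr (_ `|` _).
  have [p1 p2 _ _] := ok k (or_introl erefl).
  have [p3 p4 _ _] := ok k.+1 (or_intror erefl).
  apply/seteqP; split => v.
    move=> [i [iv]]; have [->|ik] := eqVneq i k.
      by rewrite p1 p2 => -[H|H]; right; [left; left|right; right].
    have [->|ik1] := eqVneq i k.+1.
      by rewrite p3 p4 => -[H|H]; right; [right; left|left; right].
    by left; exists i; split => //; exact/eqP.
  move=> [[i [iv _ _ H]]|[[H|H]|[H|H]]].
  - by exists i.
  - by exists k; rewrite k0 ltnW//; split => //; left; rewrite p1.
  - by exists k.+1; rewrite kn/=; split => //; right; rewrite p4.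
  - by exists k.+1; rewrite kn/=; split => //; left; rewrite p3.
  - by exists k; rewrite k0 ltnW//; split => //; right; rewrite p2.
have highE : C `|` two_layers n j o1' o2' =
    (C `|` rest) `|` zigs j%:R (high_pair k%:R (if e then 1 else - 1)).
  rewrite high_pairE -setUA; congr (_ `|` _).
  have [_ _ p1 p2] := ok k (or_introl erefl).
  have [_ _ p3 p4] := ok k.+1 (or_intror erefl).
  apply/seteqP; split => v.
    move=> [i [iv]]; have [->|ik] := eqVneq i k.
      by rewrite p1 p2 => H; right; left.
    have [->|ik1] := eqVneq i k.+1.
      by rewrite p3 p4 => H; right; right.
    by left; exists i; split => //; try exact/eqP; rewrite (other i v iv _ _).1//; exact/eqP.
  move=> [[i [iv ik ik1 H]]|[H|H]].
  - by exists i; split => //; rewrite -(other i v iv _ _).1.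
  - by exists k; rewrite k0 ltnW// p1 p2.
  - by exists k.+1; rewrite kn/= p3 p4.
rewrite lowE highE; apply: pair_slide => q Cq qz.
have j2 : j.+2%:R = j%:R + 2 :> R by rewrite -addn2 natrD.
case: Cq => [Cq|[i [iv ik ik1 H]]].
  right; have := Cn q Cq; rewrite j2 => /(_ qz); apply: le_trans.
  by rewrite -[2]/(2%:R) -natrD ler_nat addn2 ltnS.
exact: (other i q iv ik ik1).2.
Qed.

End Layers.

Section BraidMoves.
Variable R : realType.
Implicit Types C : set 'rV[R]_3.

Definition on_pair (k : nat) (o o' : option (nat * bool)) (i : nat) :=
  if (i == k) || (i == k.+1) then o else o'.

Definition far_letter (k : nat) (o : option (nat * bool)) :=
  if o is Some (k', _) then (k.+1 < k')%N || (k'.+1 < k)%N else true.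

Lemma two_layers_eq n j (o1 o2 o1' o2' : nat -> option (nat * bool)) :
  (forall i, strand j (o1 i) i = strand j (o1' i) i :> set 'rV[R]_3 /\
             strand j.+1 (o2 i) i = strand j.+1 (o2' i) i :> set 'rV[R]_3) ->
  two_layers n j o1 o2 = two_layers n j o1' o2' :> set 'rV[R]_3.
Proof.
move=> H; apply/seteqP; split => v [i [iv Hi]]; exists i; split => //.
  by rewrite -(H i).1 -(H i).2.
by rewrite (H i).1 (H i).2.
Qed.

Lemma far_coord (k i : nat) : i <> k -> i <> k.+1 ->
  (i%:R : R) <= k%:R - 1 \/ k%:R + 2 <= (i%:R : R).
Proof.
move=> ik ik1; have [lt_ik|le_ki] := ltnP i k.
  by left; rewrite lerBrDr natr1 ler_nat.
by right; rewrite -[2]/(2%:R) -natrD ler_nat; lia.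
Qed.

Lemma far_strand_x (k i j : nat) o (v : 'rV[R]_3) : far_letter k o ->
  i <> k -> i <> k.+1 -> strand j o i v ->
  v 0 0 <= k%:R - 1 \/ k%:R + 2 <= v 0 0.
Proof.
move=> ko ik ik1 H.
have straight : mid R o i = (i%:R, 0) -> step o i = i ->
    v 0 0 <= k%:R - 1 \/ k%:R + 2 <= v 0 0.
  by move=> m s; rewrite (strand_x_straight m s H); exact: far_coord.
case: o ko H straight => [[k' e]|] ko H straight; last exact: straight.
suff cross : i = k' \/ i = k'.+1 -> v 0 0 <= k%:R - 1 \/ k%:R + 2 <= v 0 0.
  have [ik'|/eqP ik'] := eqVneq i k'; first by apply: cross; left.
  have [ik1'|/eqP ik1'] := eqVneq i k'.+1; first by apply: cross; right.
  by have [m s] := step_far R e ik' ik1'; exact: straight.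
move=> ik'; have /andP[x1 x2] := strand_x ik' H.
case/orP: ko => kk'; [right|left].
  by apply: le_trans x1; rewrite -[2]/(2%:R) -natrD ler_nat addn2.
by apply: le_trans x2 _; rewrite lerBrDr natr1 ler_nat.
Qed.

Lemma slide_up n j k e o C : (0 < k < n)%N -> far_letter k o ->
  clear_of n j j.+2 C ->
  isotopic (Some @` (C `|` two_layers n j (fun=> Some (k, e)) (on_pair k None o)))
           (Some @` (C `|` two_layers n j (on_pair k None (Some (k, e)))
                                          (on_pair k (Some (k, e)) o))).
Proof.
move=> kn ko Cn; apply: (@slide_two_layers _ n j k e) => //.
  by move=> i ik; rewrite /on_pair; case: ik => ->; rewrite ?eqxx ?orbT.
move=> i v iv ik ik1; have offk : (i == k) || (i == k.+1) = false.
  by apply/negbTE; rewrite negb_or; apply/andP; split; apply/eqP.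
rewrite /on_pair offk; split => // -[H|H].
  by rewrite (strand_far R j e ik ik1) in H; apply: far_strand_x ik ik1 H.
exact: far_strand_x ik ik1 H.
Qed.

Lemma strand_on_pair j k (o : option (nat * bool)) i (A B : option (nat * bool)) :
  (i = k \/ i = k.+1 -> strand j A i = strand j o i :> set 'rV[R]_3) ->
  (i <> k -> i <> k.+1 -> strand j B i = strand j o i :> set 'rV[R]_3) ->
  strand j (on_pair k A B i) i = strand j o i :> set 'rV[R]_3.
Proof.
rewrite /on_pair => HA HB; have [ik|/eqP ik] := eqVneq i k.
  by rewrite /=; apply: HA; left.
have [ik1|/eqP ik1] := eqVneq i k.+1; first by rewrite /=; apply: HA; right.
exact: HB.
Qed.

(** Both words slide to the same picture, with both crossings side by side in the upper layer. *)
Lemma far_commute n j (a b : nat * bool) C :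
  (0 < a.1 < n)%N -> (0 < b.1 < n)%N -> (a.1.+1 < b.1)%N || (b.1.+1 < a.1)%N ->
  clear_of n j j.+2 C ->
  isotopic (Some @` (C `|` opt_braid n j [:: Some a; Some b]))
           (Some @` (C `|` opt_braid n j [:: Some b; Some a])).
Proof.
case: a b => [ka ea] [kb eb] /= an bn ab Cn; rewrite !setU0 !two_layersE.
have ba : (kb.+1 < ka)%N || (ka.+1 < kb)%N by rewrite orbC.
have straight j' k k' e i : (k.+1 < k')%N || (k'.+1 < k)%N -> i = k \/ i = k.+1 ->
    strand j' None i = strand j' (Some (k', e)) i :> set 'rV[R]_3.
  by move=> kk' ik; rewrite strand_far//; move: kk'; case: ik => ->; lia.
apply: (isotopic_trans (L := Some @` (C `|` two_layers n j
    (on_pair ka None (Some (ka, ea))) (on_pair ka (Some (ka, ea)) (Some (kb, eb)))))).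
  rewrite -(@two_layers_eq n j (fun=> Some (ka, ea)) (on_pair ka None (Some (kb, eb)))).
    exact: slide_up.
  move=> i; split=> //; apply: strand_on_pair => // ik; exact: straight ab ik.
apply: isotopic_sym.
rewrite (@two_layers_eq n j (on_pair ka None (Some (ka, ea))) _
  (on_pair kb None (Some (kb, eb))) (on_pair kb (Some (kb, eb)) (Some (ka, ea)))).
  rewrite -(@two_layers_eq n j (fun=> Some (kb, eb)) (on_pair kb None (Some (ka, ea)))).
    exact: slide_up.
  move=> i; split=> //; apply: strand_on_pair => // ik; exact: straight ba ik.
move=> i; split.
  apply: (@eq_trans _ _ (strand j None i)).
    by apply: strand_on_pair => // ik ik1; rewrite strand_far.
  by apply/esym; apply: strand_on_pair => // ik ik1; rewrite strand_far.
apply: strand_on_pair => [ia|ia ia1].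
  by apply/esym; apply: strand_on_pair => // ik; exfalso; case: ia ik => ->; lia.
apply/esym; apply: strand_on_pair => // ik ik1.
by rewrite !strand_far.
Qed.

Lemma slide_straight n j l C : (0 < l.1 < n)%N -> clear_of n j j.+2 C ->
  isotopic (Some @` (C `|` opt_braid n j [:: None; Some l]))
           (Some @` (C `|` opt_braid n j [:: Some l; None])).
Proof.
case: l => k e /= kn Cn; rewrite !setU0 !two_layersE; apply: isotopic_sym.
rewrite (@two_layers_eq n j (fun=> Some (k, e)) _
  (fun=> Some (k, e)) (on_pair k None None)); last first.
  by move=> i; rewrite /on_pair; case: ifP.
rewrite (@two_layers_eq n j (fun=> None) _
  (on_pair k None (Some (k, e))) (on_pair k (Some (k, e)) None)).
  exact: slide_up.
move=> i; split; apply/esym; apply: strand_on_pair => // ik ik1;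
  by rewrite strand_far.
Qed.

Lemma yang_baxter n j k C : (0 < k)%N -> (k.+1 < n)%N -> clear_of n j j.+3 C ->
  let s i := Some (i, true) in
  isotopic (Some @` (C `|` opt_braid n j [:: s k; s k.+1; s k]))
           (Some @` (C `|` opt_braid n j [:: s k.+1; s k; s k.+1])).
Proof.
move=> k0 kn Cn s.
have kk : k.+1 == k = false by rewrite gtn_eqF.
have kk2 : k.+2 == k = false by rewrite gtn_eqF// ltnW.
have kk3 : k == k.+1 = false by rewrite ltn_eqF.
have kk4 : k.+2 == k.+1 = false by rewrite gtn_eqF.
have kk5 : k.+1 == k.+2 = false by rewrite ltn_eqF.
have kk6 : k == k.+2 = false by rewrite ltn_eqF// ltnW.
pose rest := [set v : 'rV[R]_3 | exists i, [/\ (1 <= i <= n)%N, (i < k)%N || (k.+2 < i)%N &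
  (strand j None i `|` (strand j.+1 None i `|` strand j.+2 None i)) v]].
have H2 : j%:R + 2^-1 + 2^-1 = j.+1%:R :> R by rewrite -(natr1 j); lra.
have H4 : j.+1%:R + 2^-1 + 2^-1 = j.+2%:R :> R by rewrite -(natr1 j.+1); lra.
have h32 : k%:R + 3 / 2 = k%:R + 1 + 2^-1 :> R by lra.
have h2 : k%:R + 2 = k%:R + 1 + 1 :> R by lra.
(* A word in the letters [k] and [k + 1] bends only the strands at [k], [k + 1] and [k + 2], so both
   sides of the relation have the same vertical [rest]. *)
have layers (o1 o2 o3 : nat) (V : seq (seq (R * R))) :
    o1 = k \/ o1 = k.+1 -> o2 = k \/ o2 = k.+1 -> o3 = k \/ o3 = k.+1 ->
    zigs j%:R V = 
      (strand j (s o1) k `|` strand j (s o1) k.+1 `|` strand j (s o1) k.+2) `|`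
      (strand j.+1 (s o2) k `|` strand j.+1 (s o2) k.+1 `|` strand j.+1 (s o2) k.+2) `|`
      (strand j.+2 (s o3) k `|` strand j.+2 (s o3) k.+1 `|` strand j.+2 (s o3) k.+2) ->
    C `|` opt_braid n j [:: s o1; s o2; s o3] = (C `|` rest) `|` zigs j%:R V.
  move=> h1 h2' h3 ->; rewrite /= setU0 -setUA; congr (_ `|` _).
  have off o i j' : o = k \/ o = k.+1 -> (i < k)%N || (k.+2 < i)%N ->
      strand j' (s o) i = strand j' None i :> set 'rV[R]_3.
    by move=> ok ik; rewrite /s strand_far//; move: ik; case: ok => ->; lia.
  have cases i : [\/ i = k, i = k.+1, i = k.+2 | (i < k)%N || (k.+2 < i)%N].
    have [?|?|?] := ltngtP i k; [by constructor 4; lia| |by constructor 1].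
    have [?|?|?] := ltngtP i k.+1; [lia| |by constructor 2].
    by have [?|?|?] := ltngtP i k.+2; [lia|constructor 4; lia|constructor 3].
  have in0 : (1 <= k <= n)%N by lia.
  have in1 : (1 <= k.+1 <= n)%N by lia.
  have in2 : (1 <= k.+2 <= n)%N by lia.
  apply/seteqP; split => v.
    move=> [|[|]] [i [iv]].
    - case: (cases i) => [->|->|->|ik] H; last by left; exists i; rewrite (off o1) in H => //; split => //; left.
      + by right; left; left; left; left.
      + by right; left; left; left; right.
      + by right; left; left; right.
    - case: (cases i) => [->|->|->|ik] H; last by left; exists i; rewrite (off o2) in H => //; split => //; right; left.
      + by right; left; right; left; left.
      + by right; left; right; left; right.
      + by right; left; right; right.
    - case: (cases i) => [->|->|->|ik] H; last by left; exists i; rewrite (off o3) in H => //; split => //; right; right.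
      + by right; right; left; left.
      + by right; right; left; right.
      + by right; right; right.
  move=> [[i [iv ik [H|[H|H]]]]|[[[[H|H]|H]|[[H|H]|H]]|[[H|H]|H]]].
  - by left; exists i; rewrite (off o1).
  - by right; left; exists i; rewrite (off o2).
  - by right; right; exists i; rewrite (off o3).
  - by left; exists k.
  - by left; exists k.+1.
  - by left; exists k.+2.
  - by right; left; exists k.
  - by right; left; exists k.+1.
  - by right; left; exists k.+2.
  - by right; right; exists k.
  - by right; right; exists k.+1.
  - by right; right; exists k.+2.
rewrite (layers k k.+1 k (yb_word1 k%:R)); [|by left|by right|by left|]; last first.
  rewrite /zigs /strand /= !(eqxx, kk, kk2, kk3, kk4, kk5, kk6) !setU0 !H2 !H4.
  rewrite -(natr1 k.+1) -(natr1 k) h32 h2.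
  by apply/seteqP; split => v /=; tauto.
rewrite (layers k.+1 k k.+1 (yb_word2 k%:R)); [|by right|by left|by right|]; last first.
  rewrite /zigs /strand /= !(eqxx, kk, kk2, kk3, kk4, kk5, kk6) !setU0 !H2 !H4.
  rewrite -(natr1 k.+1) -(natr1 k) h32 h2.
  by apply/seteqP; split => v /=; tauto.
apply: yang_baxter_move => q Cq qz.
have k3 : k.+3%:R = k%:R + 3 :> R by rewrite -addn3 natrD.
have j3 : j.+3%:R = j%:R + 3 :> R by rewrite -addn3 natrD.
case: Cq => [Cq|[i [iv ik H]]].
  right; have := Cn q Cq; rewrite j3 => /(_ qz); apply: le_trans.
  by rewrite -k3 ler_nat; lia.
have -> : q 0 0 = i%:R.
  by case: H => [|[|]]; apply: strand_x_straight.
case/orP: ik => ik; [left|right].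
  by rewrite lerBrDr natr1 ler_nat.
by rewrite -k3 ler_nat.
Qed.

End BraidMoves.

(** * Braid relations inside a closure *)

Section ClosureMoves.
Variable R : realType.
Implicit Types A C : set 'rV[R]_3.

Lemma opt_braid_height n j w (v : 'rV[R]_3) :
  opt_braid n j w v -> j%:R <= v 0 2 <= (j + size w)%:R.
Proof.
elim: w j => [//|o w IH] j /= [[i [_ /strand_height/andP[z0 z1]]]|/IH/andP[z0 z1]].
  by rewrite z0 (le_trans z1)// ler_nat addnS ltnS leq_addr.
by rewrite -addSnnS z1 (le_trans _ z0)// ler_nat.
Qed.

Lemma clear_ofU n a b A C : clear_of n a b A -> clear_of n a b C ->
  clear_of n a b (A `|` C).
Proof. by move=> HA HC q [/HA|/HC]; exact. Qed.

Lemma clear_of_sub n a b a' b' A : (a <= a')%N -> (b' <= b)%N ->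
  clear_of n a b A -> clear_of n a' b' A.
Proof.
move=> aa bb HA q Aq /andP[q1 q2]; apply: HA => //.
by rewrite (le_lt_trans _ q1) ?ler_nat// (lt_le_trans q2)// ler_nat.
Qed.

Lemma clear_of_below n n' j w b : clear_of n (j + size w) b (opt_braid n' j w : set 'rV[R]_3).
Proof.
by move=> q /opt_braid_height/andP[_ q1] /andP[/(le_lt_trans q1)]; rewrite ltxx.
Qed.

Lemma clear_of_above n n' j w a : clear_of n a j (opt_braid n' j w : set 'rV[R]_3).
Proof.
by move=> q /opt_braid_height/andP[q1 _] /andP[_ /lt_le_trans/(_ q1)]; rewrite ltxx.
Qed.

(** As both words have the same length, the layers above them keep their heights. Everything outside
    the slab is then one passive set, which does not enter the open slab except far to the right. *)
Lemma opt_braid_context n u x y w A : size x = size y ->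
  (forall C, clear_of n (size u) (size u + size x) C ->
    isotopic (Some @` (C `|` opt_braid n (size u) x))
             (Some @` (C `|` opt_braid n (size u) y))) ->
  clear_of n 0 (size (u ++ x ++ w)) A ->
  isotopic (Some @` (opt_braid n 0 (u ++ x ++ w) `|` A))
           (Some @` (opt_braid n 0 (u ++ y ++ w) `|` A)).
Proof.
move=> xy move_xy An; rewrite !opt_braid_cat add0n -xy.
pose C := opt_braid n 0 u `|` (opt_braid n (size u + size x) w `|` A).
have E (z : set 'rV[R]_3) : opt_braid n 0 u `|` (z `|` opt_braid n (size u + size x) w)
    `|` A = C `|` z.
  by rewrite /C; apply/seteqP; split => v /=; tauto.
rewrite !E; apply: move_xy; apply: clear_ofU; first exact: clear_of_below.
apply: clear_ofU; first exact: clear_of_above.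
by apply: clear_of_sub An => //; rewrite !size_cat addnA leq_addr.
Qed.

(** Strictly between the bottom and the top of the braid, an arc has only its descending edge at
    [x = N + d], with [d >= 1]. *)
Lemma clear_of_closing_arcs N m n n' : (n' <= N)%N -> (n <= N)%N ->
  clear_of n' 0 m (closing_arcs N m n : set 'rV[R]_3).
Proof.
move=> n'N nN q [i /= /andP[i1 iN] H] /andP[q0 q1].
have d1 : (N.+1%:R - i%:R : R) >= 1.
  by rewrite lerBrDr addrC natr1 ler_nat ltnS (leq_trans iN).
move: H; rewrite /closing_arc; set d : R := _ - _ in d1 *.
rewrite /= => -[H|[H|[H|[H|[H|//]]]]].
- have : m%:R <= q 0 2 <= m%:R + d by apply: (segment_coord H); rewrite point2; lra.
  lra.
- have : m%:R + d <= q 0 2 <= m%:R + d by apply: (segment_coord H); rewrite point2; lra.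
  lra.
- have /andP[+ _] : N%:R + d <= q 0 0 <= N%:R + d.
    by apply: (segment_coord H); rewrite point0; lra.
  apply: le_trans; have : (n'%:R : R) <= N%:R by rewrite ler_nat.
  by rewrite -(natr1 n'); lra.
- have : - d <= q 0 2 <= - d by apply: (segment_coord H); rewrite point2; lra.
  lra.
- have : - d <= q 0 2 <= 0 by apply: (segment_coord H); rewrite point2; lra.
  lra.
Qed.

End ClosureMoves.

Definition positive (w : seq nat) : braid_word := [seq (i, true) | i <- w].

Definition letters_below (n : nat) (w : seq nat) := all (fun i => 0 < i < n)%N w.

Lemma on_strands_positive n w : on_strands n (positive w) = letters_below n w.
Proof. by rewrite /on_strands all_map. Qed.

(** Equality in the monoid of positive braids, where the two braid relations may be applied inside
    any word. *)
Inductive braid_eq (n : nat) : seq nat -> seq nat -> Prop :=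
| braid_eq_refl w : braid_eq n w w
| braid_eq_sym u w : braid_eq n u w -> braid_eq n w u
| braid_eq_trans u w x : braid_eq n u w -> braid_eq n w x -> braid_eq n u x
| braid_eq_far u w a b : (0 < a < n)%N -> (0 < b < n)%N ->
    (a.+1 < b)%N || (b.+1 < a)%N ->
    braid_eq n (u ++ [:: a; b] ++ w) (u ++ [:: b; a] ++ w)
| braid_eq_yang_baxter u w a : (0 < a)%N -> (a.+1 < n)%N ->
    braid_eq n (u ++ [:: a; a.+1; a] ++ w) (u ++ [:: a.+1; a; a.+1] ++ w).

Lemma letters_below_cat n u w :
  letters_below n (u ++ w) = letters_below n u && letters_below n w.
Proof. exact: all_cat. Qed.

Lemma braid_eq_letters n u w : braid_eq n u w -> letters_below n u = letters_below n w.
Proof.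
elim=> {u w} [//|//|u w x _ -> _ ->//|u w a b an bn _|u w a a0 an].
  by rewrite !letters_below_cat /= an bn.
by rewrite !letters_below_cat /= a0 an ltnW.
Qed.

Lemma braid_closure_opt (R : realType) n w : on_strands n w ->
  braid_closure R n w =
  Some @` (opt_braid n 0 (map Some w) `|` closing_arcs n (size w) n).
Proof. by move=> wn; rewrite /braid_closure closure_opt. Qed.

Lemma braid_eq_closure (R : realType) n u w : braid_eq n u w -> letters_below n u ->
  isotopic (braid_closure R n (positive u)) (braid_closure R n (positive w)).
Proof.
elim=> {u w} [w _|u w e IH wn|u w x e IH1 _ IH2 un|u w a b an bn ab|u w a a0 an].
- exact: isotopic_refl.
- by apply: isotopic_sym; apply: IH; rewrite (braid_eq_letters e).
- by apply: isotopic_trans (IH1 un) (IH2 _); rewrite -(braid_eq_letters e).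
- rewrite !letters_below_cat => /and3P[un _ wn].
  rewrite !braid_closure_opt;
    try by rewrite on_strands_positive !letters_below_cat un wn /= an bn.
  rewrite /positive !map_cat !size_cat /=.
  apply: (@opt_braid_context R n (map Some _) [:: Some (a, true); Some (b, true)]
    [:: Some (b, true); Some (a, true)] (map Some _)) => // [C|].
    by rewrite addn2; exact: far_commute.
  by rewrite !size_cat !size_map; exact: clear_of_closing_arcs.
- rewrite !letters_below_cat => /and3P[un _ wn].
  rewrite !braid_closure_opt;
    try by rewrite on_strands_positive !letters_below_cat un wn /= a0 an (ltnW an).
  rewrite /positive !map_cat !size_cat /=.
  apply: (@opt_braid_context R n (map Some _) [:: Some (a, true); Some (a.+1, true); Some (a, true)]
    [:: Some (a.+1, true); Some (a, true); Some (a.+1, true)] (map Some _)) => // [C|].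
    by rewrite addn3; exact: yang_baxter.
  by rewrite !size_cat !size_map; exact: clear_of_closing_arcs.
Qed.

(** * Closing arcs and polygons in coordinates *)

Section ClosingArcs.
Variable R : realType.

Lemma point_mix (t x y z x' y' z' : R) :
  (1 - t) *: point x y z + t *: point x' y' z' =
  point ((1 - t) * x + t * x') ((1 - t) * y + t * y') ((1 - t) * z + t * z').
Proof. by apply/rowP => -[[|[|[|c]]] //= ?]; rewrite !mxE. Qed.

Lemma between_mix (a b x : R) : a <= x <= b ->
  exists2 t, 0 <= t <= 1 & x = (1 - t) * a + t * b.
Proof.
move=> /andP[ax xb]; have [ab|ab] := eqVneq a b.
  by exists 0; [rewrite lexx ler01|apply/le_anti; rewrite -ab in xb; lra].
have ba : 0 < b - a by rewrite subr_gt0 lt_def eq_sym ab (le_trans ax).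
exists ((x - a) / (b - a)).
  by rewrite divr_ge0 ?ler_pdivrMr ?mul1r//; lra.
by field; rewrite gt_eqF.
Qed.

Lemma segment_zP (x y a b : R) (v : 'rV[R]_3) : a <= b ->
  segment (point x y a) (point x y b) v <-> [/\ v 0 0 = x, v 0 1 = y & a <= v 0 2 <= b].
Proof.
move=> ab; split.
  move=> /segmentP[t [/andP[t0 t1] ->]]; rewrite point_mix point0 point1 point2.
  by split; [lra|lra|apply/andP; split; nra].
move=> [v0 v1 /between_mix[t t01 v2]]; apply/segmentP; exists t; split => //.
by rewrite point_mix [LHS]pointP v0 v1 v2; congr (point _ _ _); ring.
Qed.

Lemma segment_xP (y z a b : R) (v : 'rV[R]_3) : a <= b ->
  segment (point a y z) (point b y z) v <-> [/\ v 0 1 = y, v 0 2 = z & a <= v 0 0 <= b].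
Proof.
move=> ab; split.
  move=> /segmentP[t [/andP[t0 t1] ->]]; rewrite point_mix point0 point1 point2.
  by split; [lra|lra|apply/andP; split; nra].
move=> [v1 v2 /between_mix[t t01 v0]]; apply/segmentP; exists t; split => //.
by rewrite point_mix [LHS]pointP v0 v1 v2; congr (point _ _ _); ring.
Qed.

Lemma closing_arcP N m i (v : 'rV[R]_3) : (i <= N)%N ->
  let d : R := N.+1%:R - i%:R in
  closing_arc N m i v <-> v 0 1 = 0 /\
    [\/ v 0 0 = i%:R /\ m%:R <= v 0 2 <= m%:R + d,
        v 0 2 = m%:R + d /\ i%:R <= v 0 0 <= N%:R + d,
        v 0 0 = N%:R + d /\ - d <= v 0 2 <= m%:R + d |
        v 0 2 = - d /\ i%:R <= v 0 0 <= N%:R + d \/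
        v 0 0 = i%:R /\ - d <= v 0 2 <= 0].
Proof.
move=> iN d; have iN' : (i%:R : R) <= N%:R by rewrite ler_nat.
have d1 : 1 <= d by rewrite /d -(natr1 N); lra.
have m0 : 0 <= (m%:R : R) by [].
rewrite /closing_arc -/d /=; split.
- move=> [|[|[|[|[|//]]]]].
  + move=> /segment_zP[]; first by lra.
    by split => //; constructor 1.
  + move=> /segment_xP[]; first by lra.
    by split => //; constructor 2.
  + rewrite segmentC => /segment_zP[]; first by lra.
    by split => //; constructor 3.
  + rewrite segmentC => /segment_xP[]; first by lra.
    by split => //; constructor 4; left.
  + move=> /segment_zP[]; first by lra.
    by split => //; constructor 4; right.
- move=> [v1 [[v0 v2]|[v2 v0]|[v0 v2]|[[v2 v0]|[v0 v2]]]].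
  + by left; apply/segment_zP; [lra|].
  + by right; left; apply/segment_xP; [lra|].
  + by right; right; left; rewrite segmentC; apply/segment_zP; [lra|].
  + by right; right; right; left; rewrite segmentC; apply/segment_xP; [lra|].
  + by right; right; right; right; left; apply/segment_zP; [lra|].
Qed.

Lemma polyline_trails (a : 'rV[R]_3) (s : seq 'rV[R]_3) :
  polyline a s = trails (size s) (fun _ : 'I_1 => nth 0 (a :: s)).
Proof.
elim: s a => [|b s IH] a.
  by apply/seteqP; split => // v [i [l []]].
rewrite [LHS]/= IH; apply/seteqP; split => v.
  move=> [H|[i [l [ls H]]]]; first by exists ord0, 0%N.
  by exists ord0, l.+1.
move=> [i [[|l] [ls H]]]; first by left.
by right; exists i, l.
Qed.

(** Subdividing a straight segment at prescribed parameters lets it be compared vertex by vertex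
    with the kink. *)
Lemma affine_trails r (s : nat -> R) (u w : 'rV[R]_3) : (0 < r)%N ->
  (forall l, (l < r)%N -> s l < s l.+1) ->
  trails r (fun (_ : 'I_1) l => u + s l *: w) =
  segment (u + s 0%N *: w) (u + s r *: w).
Proof.
move=> r0 s_inc; have s0r : s 0%N <= s r by apply: (level_le s_inc); rewrite leqnn.
have mix t x y : (1 - t) *: (u + x *: w) + t *: (u + y *: w) =
    u + ((1 - t) * x + t * y) *: w.
  by apply/rowP => i; rewrite !mxE; ring.
apply/seteqP; split => v.
  move=> [_ [l [lr /segmentP[t [/andP[t0 t1] ->]]]]]; rewrite mix; apply/segmentP.
  have sl := s_inc l lr.
  have h0 : s 0%N <= s l by apply: (level_le s_inc); rewrite /= ltnW.
  have h1 : s l.+1 <= s r by apply: (level_le s_inc); rewrite lr leqnn.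
  have [|x x01 ->] := @between_mix (s 0%N) (s r) ((1 - t) * s l + t * s l.+1).
    by apply/andP; split; nra.
  by exists x; rewrite mix.
move=> /segmentP[t [/andP[t0 t1] ->]]; rewrite mix.
have [|l lr xl] := @level_locate _ s r ((1 - t) * s 0%N + t * s r) r0.
  by apply/andP; split; nra.
have [x x01 ->] := between_mix xl.
by exists ord0, l; split => //; apply/segmentP; exists x; rewrite mix.
Qed.

End ClosingArcs.

(** * Destabilization *)

Section Kink.
Variable R : realType.

Definition clamp (lo hi x : R) : R := Num.min hi (Num.max lo x).

Lemma clamp_in (lo hi x : R) : lo <= x <= hi -> clamp lo hi x = x.
Proof. by rewrite /clamp => /andP[/max_idPr -> /min_idPr ->]. Qed.

Lemma clamp_lo (lo hi x : R) : lo <= hi -> x <= lo -> clamp lo hi x = lo.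
Proof. by rewrite /clamp => /min_idPr lh /max_idPl ->. Qed.

Lemma clamp_hi (lo hi x : R) : lo <= hi -> hi <= x -> clamp lo hi x = hi.
Proof.
by rewrite /clamp => lh hx; rewrite (max_idPr (le_trans lh hx)) (min_idPl hx).
Qed.

Lemma clamp_bound (lo hi x : R) : lo <= hi -> lo <= clamp lo hi x <= hi.
Proof. by move=> lh; rewrite /clamp le_min le_max ge_min !lexx lh. Qed.

Lemma continuous_clamp (T : topologicalType) (lo hi f : T -> R) :
  continuous lo -> continuous hi -> continuous f ->
  continuous (fun v => clamp (lo v) (hi v) (f v)).
Proof.
move=> clo chi cf v.
apply: (@continuous_min _ _ hi (fun v => Num.max (lo v) (f v))); first exact: chi.
by apply: (@continuous_max _ _ lo f); [exact: clo|exact: cf].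
Qed.

(* Added to the [y]-coordinate, [kink_shear] makes [y] strictly monotone along
   the whole kink.  Coordinates are centred at the crossing of the kink: it
   runs along [Z = X] and [Z = - X] for [|X| <= 1/2], and closes up along the
   line [X = 1/2], the line [X = 3/2] and two lines [Z = const]. *)
Definition kink_shear (M mu X Z0 : R) : R :=
  let Z := clamp (- M) M Z0 in
  let p := clamp 0 2^-1 X in
  let c := clamp (- p) p Z in
  let e := mu * (Z - clamp (- 2^-1) 2^-1 Z) in
  let w := clamp 0 1 (X - 2^-1) in
  (1 - w) * (c - e) + w * (2 * mu * Z) - 3 * (1 - 2 * p) * (Z - c).

Section Regions.
Variables (M mu : R).

(** On each region met by the diagram the nested clamps collapse. What remains is affine along every
    edge of the kink, so its effect there can be read off from the end points. *)
Lemma shear_left_mid (X Z : R) : 1 <= M -> X <= 0 -> - 2^-1 <= Z <= 2^-1 ->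
  kink_shear M mu X Z = - 3 * Z.
Proof.
move=> M1 X0 Z2; rewrite /kink_shear (clamp_in (x := Z) (hi := M)); last by lra.
rewrite (clamp_lo (x := X)); [|lra|lra].
rewrite (clamp_in Z2) (clamp_lo (x := X - _)); [|lra|lra].
have -> : clamp (- 0) 0 Z = 0.
  have : - 0 <= clamp (- 0) 0 Z <= 0 by apply: clamp_bound; lra.
  by move=> c0; apply/le_anti; lra.
by lra.
Qed.

Lemma shear_left_up (X Z : R) : 1 <= M -> X <= 0 -> 2^-1 <= Z <= M ->
  kink_shear M mu X Z = - 3 * Z - mu * (Z - 2^-1).
Proof.
move=> M1 X0 Z2; rewrite /kink_shear (clamp_in (x := Z) (hi := M)); last by lra.
rewrite (clamp_lo (x := X)); [|lra|lra].
rewrite (clamp_hi (x := Z) (lo := - 2^-1)); [|lra|lra].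
rewrite (clamp_lo (x := X - _)); [|lra|lra].
by rewrite (clamp_hi (x := Z)); [field|lra|lra].
Qed.

Lemma shear_left_down (X Z : R) : 1 <= M -> X <= 0 -> - M <= Z <= - 2^-1 ->
  kink_shear M mu X Z = - 3 * Z - mu * (Z + 2^-1).
Proof.
move=> M1 X0 Z2; rewrite /kink_shear (clamp_in (x := Z) (hi := M)); last by lra.
rewrite (clamp_lo (x := X)); [|lra|lra].
rewrite (clamp_lo (x := Z) (lo := - 2^-1)); [|lra|lra].
rewrite (clamp_lo (x := X - _)); [|lra|lra].
by rewrite (clamp_lo (x := Z)); [field|lra|lra].
Qed.

Lemma shear_diag (X Z : R) : 1 <= M -> 0 <= X <= 2^-1 -> Z = X \/ Z = - X ->
  kink_shear M mu X Z = Z.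
Proof.
move=> M1 X0 ZX; have Z2 : - 2^-1 <= Z <= 2^-1 by case: ZX => ->; lra.
have Z3 : - X <= Z <= X by case: ZX => ->; lra.
rewrite /kink_shear (clamp_in (x := Z) (hi := M)); last by lra.
rewrite (clamp_in X0) (clamp_in Z2) (clamp_in Z3).
by rewrite (clamp_lo (x := X - _)); [field|lra|lra].
Qed.

Lemma shear_right_up (X Z : R) : 1 <= M -> 2^-1 <= X <= 3 / 2 -> 2^-1 <= Z <= M ->
  kink_shear M mu X Z =
  (3 / 2 - X) * (2^-1 - mu * (Z - 2^-1)) + (X - 2^-1) * (2 * mu * Z).
Proof.
move=> M1 X0 Z2; rewrite /kink_shear (clamp_in (x := Z) (hi := M)); last by lra.
rewrite (clamp_hi (x := X)); [|lra|lra].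
rewrite (clamp_hi (x := Z)); [|lra|lra].
rewrite (clamp_in (x := X - _)); last by lra.
by field.
Qed.

Lemma shear_right_down (X Z : R) : 1 <= M -> 2^-1 <= X <= 3 / 2 -> - M <= Z <= - 2^-1 ->
  kink_shear M mu X Z =
  (3 / 2 - X) * (- 2^-1 - mu * (Z + 2^-1)) + (X - 2^-1) * (2 * mu * Z).
Proof.
move=> M1 X0 Z2; rewrite /kink_shear (clamp_in (x := Z) (hi := M)); last by lra.
rewrite (clamp_hi (x := X)); [|lra|lra].
rewrite (clamp_lo (x := Z)); [|lra|lra].
rewrite (clamp_in (x := X - _)); last by lra.
by field.
Qed.

Lemma shear_far (X Z : R) : 1 <= M -> X = 3 / 2 -> - M <= Z <= M ->
  kink_shear M mu X Z = 2 * mu * Z.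
Proof.
move=> M1 X0 Z2; rewrite /kink_shear (clamp_in (x := Z) (hi := M)); last by lra.
rewrite (clamp_hi (x := X)); [|lra|lra].
rewrite (clamp_hi (x := X - _)); [|lra|lra].
by field.
Qed.

(** Clamping [Z0] between [- M] and [M] serves this bound, which [perturb_isotopy] requires. *)
Lemma kink_shear_bounded : 1 <= M -> 0 <= mu -> exists B, forall X Z, `|kink_shear M mu X Z| <= B.
Proof.
move=> M1 mu0; exists (2^-1 + mu * (M + 2^-1) + 2 * mu * M + 3 * (M + 2^-1)) => X Z0.
rewrite /kink_shear; set Z := clamp (- M) _ _; set p := clamp 0 _ X.
set c := clamp (- p) _ _; set z := clamp (- 2^-1) _ _; set w := clamp 0 1 _.
have hZ : - M <= Z <= M by apply: clamp_bound; lra.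
have hp : 0 <= p <= 2^-1 by apply: clamp_bound; lra.
have hc : - p <= c <= p by apply: clamp_bound; lra.
have hz : - 2^-1 <= z <= 2^-1 by apply: clamp_bound; lra.
have hw : 0 <= w <= 1 by apply: clamp_bound; lra.
have scale (s x B : R) : 0 <= s <= 1 -> `|x| <= B -> `|s * x| <= B.
  move=> /andP[s0 s1] xB; rewrite normrM ger0_norm//.
  by apply: le_trans xB; rewrite ler_piMl.
have muZ (x B : R) : - B <= x <= B -> `|mu * x| <= mu * B.
  by move=> xB; rewrite normrM ger0_norm// ler_wpM2l// ler_norml.
apply: le_trans (ler_normB _ _) _; apply: lerD.
  apply: le_trans (ler_normD _ _) _; apply: lerD.
    apply: scale; first by lra.
    apply: le_trans (ler_normB _ _) _; apply: lerD; first by rewrite ler_norml; lra.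
    by apply: muZ; lra.
  apply: scale; first by [].
  rewrite -!mulrA normrM ger0_norm// ler_wpM2l//.
  exact: muZ.
rewrite -mulrA normrM ger0_norm// ler_wpM2l//; apply: scale; first by lra.
by rewrite ler_norml; lra.
Qed.

End Regions.

Lemma continuous_kink_shear (T : topologicalType) (M mu : R) (X Z : T -> R) :
  continuous X -> continuous Z -> continuous (fun v => kink_shear M mu (X v) (Z v)).
Proof.
move=> cX cZ; rewrite /kink_shear.
have cc (a : R) : continuous (fun _ : T => a) by move=> v; exact: cvg_cst.
have cD (f g : T -> R) : continuous f -> continuous g -> continuous (fun v => f v + g v).
  by move=> cf cg v; apply: cvgD; [exact: cf|exact: cg].
have cB (f g : T -> R) : continuous f -> continuous g -> continuous (fun v => f v - g v).
  by move=> cf cg v; apply: cvgB; [exact: cf|exact: cg].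
have cM (f g : T -> R) : continuous f -> continuous g -> continuous (fun v => f v * g v).
  by move=> cf cg v; apply: cvgM; [exact: cf|exact: cg].
have cN (f : T -> R) : continuous f -> continuous (fun v => - f v).
  by move=> cf v; apply: cvgN; exact: cf.
have cZc : continuous (fun v => clamp (- M) M (Z v)) by exact: continuous_clamp.
have cp : continuous (fun v => clamp 0 2^-1 (X v)) by exact: continuous_clamp.
have ccc : continuous (fun v => clamp (- clamp 0 2^-1 (X v)) (clamp 0 2^-1 (X v))
    (clamp (- M) M (Z v))) by apply: continuous_clamp => //; exact: cN.
have ce : continuous (fun v => mu * (clamp (- M) M (Z v) -
    clamp (- 2^-1) 2^-1 (clamp (- M) M (Z v)))).
  by apply: cM => //; apply: cB => //; exact: continuous_clamp.
have cw : continuous (fun v => clamp 0 1 (X v - 2^-1)).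
  by apply: continuous_clamp => //; exact: cB.
apply: (cB); first apply: (cD).
- by apply: (cM); [exact: cB|exact: cB].
- by apply: (cM) => //; exact: cM.
- by apply: (cM); [apply: (cM) => //; apply: (cB) => //; exact: cM|exact: cB].
Qed.

End Kink.

Section RemoveKink.
Variables (R : realType) (n j T D : R).
Hypotheses (T1 : 3 / 2 <= T) (D1 : 3 / 2 <= D).

Definition centred (X y Z : R) : 'rV[R]_3 := point (n + 2^-1 + X) y (j + 2^-1 + Z).

(** The starting vertex, the upper left end of the crossing, is supplied by [polyline]. The path
    descends along the strand with [y <= 0], runs once around the closing arc of the last position,
    and returns along the strand with [y >= 0] to the lower left end. [T] and [D] are the distances
    of the top and the bottom of that arc from the crossing. *)
Definition kink : seq 'rV[R]_3 :=
  [:: centred 0 (- 1) 0; centred 2^-1 0 (- 2^-1); centred 2^-1 0 (- D);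
      centred (3 / 2) 0 (- D); centred (3 / 2) 0 T; centred 2^-1 0 T;
      centred 2^-1 0 2^-1; centred 0 1 0; centred (- 2^-1) 0 (- 2^-1)].

Lemma centred_mix (t X y Z X' y' Z' : R) :
  (1 - t) *: centred X y Z + t *: centred X' y' Z' =
  centred ((1 - t) * X + t * X') ((1 - t) * y + t * y') ((1 - t) * Z + t * Z').
Proof. by rewrite /centred point_mix; congr (point _ _ _); ring. Qed.

Definition sheared (M mu : R) (v : 'rV[R]_3) : 'rV[R]_3 :=
  v + kink_shear M mu (v 0 0 - (n + 2^-1)) (v 0 2 - (j + 2^-1)) *: point 0 1 0.

Lemma shearedE M mu (v : 'rV[R]_3) : sheared M mu v =
  point (v 0 0) (v 0 1 + kink_shear M mu (v 0 0 - (n + 2^-1)) (v 0 2 - (j + 2^-1)))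
        (v 0 2).
Proof.
rewrite /sheared; set s := kink_shear _ _ _ _; rewrite {1}(pointP v).
by apply/rowP => -[[|[|[|c]]] //= ?]; rewrite !mxE /= ?mulr0 ?mulr1 ?addr0.
Qed.

Lemma sheared_centred M mu X y Z :
  sheared M mu (centred X y Z) = centred X (y + kink_shear M mu X Z) Z.
Proof.
rewrite shearedE /centred !(point0, point1, point2).
by congr (point _ (_ + kink_shear _ _ _ _) _); ring.
Qed.

Lemma sheared_segment M mu X y Z X' y' Z' h h' :
  (forall t, 0 <= t <= 1 ->
    (1 - t) * y + t * y' + kink_shear M mu ((1 - t) * X + t * X') ((1 - t) * Z + t * Z') =
    (1 - t) * h + t * h') ->
  sheared M mu @` segment (centred X y Z) (centred X' y' Z') =
  segment (centred X h Z) (centred X' h' Z').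
Proof.
move=> H.
have mixE t : 0 <= t <= 1 -> sheared M mu ((1 - t) *: centred X y Z + t *: centred X' y' Z') =
    (1 - t) *: centred X h Z + t *: centred X' h' Z'.
  by move=> t01; rewrite !centred_mix sheared_centred H.
apply/seteqP; split => v.
  by move=> [_ /segmentP[t [t01 ->]] <-]; apply/segmentP; exists t; rewrite mixE.
move=> /segmentP[t [t01 ->]]; exists ((1 - t) *: centred X y Z + t *: centred X' y' Z').
  by apply/segmentP; exists t.
by rewrite mixE.
Qed.

(** The displacement depends on [x] and [z] only and is parallel to the [y]-axis; with [x] and [z]
    fixed it is constant, so the contraction factor is 0. *)
Lemma sheared_isotopic (M mu : R) (K : set 'rV[R]_3) : 1 <= M -> 0 <= mu ->
  isotopic (Some @` K) (Some @` (sheared M mu @` K)).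
Proof.
move=> M1 mu0; have [B HB] := kink_shear_bounded M1 mu0.
have e1 : `|point 0 1 0 : 'rV[R]_3| <= 1.
  apply: normv_le => // -[[|[|[|c]]] //= ?]; rewrite mxE /= ?normr0 ?normr1//.
apply: (@perturb_isotopy _ (fun i => i != 1) _ B 0).
- have cc (c : 'I_3) (a : R) : continuous (fun v : 'rV[R]_3 => v 0 c - a).
    move=> v; apply: (@cvgB _ _ _ (nbhs v)); last exact: cvg_cst.
    exact: coord_continuous.
  have ck := @continuous_kink_shear R _ M mu _ _ (cc 0 (n + 2^-1)) (cc 2 (j + 2^-1)).
  by move=> v; apply: (@cvgZ _ _ _ (nbhs v)); [exact: ck|exact: cvg_cst].
- move=> v; rewrite normrZ -[leRHS]mulr1 ler_pM//.
- by move=> v [[|[|[|c]]] //= ?] _; rewrite !mxE /= mulr0.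
- by rewrite lexx ltr01.
- by move=> v w vw; rewrite !vw// subrr normr0 mul0r.
Qed.

(** The heights between [- D - 1] and [T + 1], where [remove_kink] controls the rest, are not
    affected by the clamp. The slope is chosen with [mu * (T + D + 1) = 1 / 8], small enough for the
    values of [y] on the closing arc to increase from - 1/2 to 1/2. *)
Definition kink_bound : R := T + D + 1.
Definition kink_slope : R := (8 * kink_bound)^-1.
Local Notation M := kink_bound.
Local Notation mu := kink_slope.

Lemma kink_bound_ge1 : 1 <= M.
Proof. by have := T1; have := D1; rewrite /kink_bound; lra. Qed.

Lemma kink_slopeP :
  [/\ 0 < mu, mu * T + mu * D + mu = 8^-1, 3 / 2 * mu <= mu * T & 3 / 2 * mu <= mu * D].
Proof.
have M1 := kink_bound_ge1; have T1' := T1; have D1' := D1.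
have mu0 : 0 < mu by rewrite invr_gt0; lra.
split=> //; [|by nra|by nra].
have -> : mu * T + mu * D + mu = mu * M by rewrite /kink_bound; ring.
by rewrite /kink_slope; field; rewrite gt_eqF//; lra.
Qed.

Definition sheared_kink : seq 'rV[R]_3 := [:: centred (- 2^-1) (- (3 / 2)) 2^-1;
  centred 0 (- 1) 0; centred 2^-1 (- 2^-1) (- 2^-1);
  centred 2^-1 (- 2^-1 + mu * (D - 2^-1)) (- D); centred (3 / 2) (- (2 * mu * D)) (- D);
  centred (3 / 2) (2 * mu * T) T; centred 2^-1 (2^-1 - mu * (T - 2^-1)) T;
  centred 2^-1 2^-1 2^-1; centred 0 1 0; centred (- 2^-1) (3 / 2) (- 2^-1)].

(** After the shear, [y] takes the role that the height has for braids. *)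
Definition kink_height (l : nat) : R := nth 0 sheared_kink l 0 1.

Lemma kink_heightE : kink_height =1 nth 0 [:: - (3 / 2); - 1; - 2^-1;
  - 2^-1 + mu * (D - 2^-1); - (2 * mu * D); 2 * mu * T; 2^-1 - mu * (T - 2^-1); 2^-1; 1; 3 / 2].
Proof.
move=> l; rewrite /kink_height; have [l9|l9] := leqP l 9; last first.
  by rewrite !nth_default// mxE.
by move: l l9 => [|[|[|[|[|[|[|[|[|[|l]]]]]]]]]] // _; rewrite /= point1.
Qed.

Lemma kink_height_inc l : (l < 9)%N -> kink_height l < kink_height l.+1.
Proof.
have [? ? ? ?] := kink_slopeP; have T1' := T1; have D1' := D1; rewrite !kink_heightE.
by move: l => [|[|[|[|[|[|[|[|[|l]]]]]]]]] // _ /=; lra.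
Qed.

Lemma kink_height_bound l : (l <= 9)%N -> - (3 / 2) <= kink_height l <= 3 / 2.
Proof.
have [? ? ? ?] := kink_slopeP; have T1' := T1; have D1' := D1; rewrite !kink_heightE.
by move: l => [|[|[|[|[|[|[|[|[|[|l]]]]]]]]]] // _ /=; lra.
Qed.

Lemma sheared_kink_box l : (l <= 9)%N ->
  n <= nth 0 sheared_kink l 0 0 <= n + 2 /\
  j + 2^-1 - D <= nth 0 sheared_kink l 0 2 <= j + 2^-1 + T.
Proof.
have T1' := T1; have D1' := D1.
by move: l => [|[|[|[|[|[|[|[|[|[|l]]]]]]]]]] // _; rewrite /= point0 point2; split; lra.
Qed.

Lemma sheared_kinkE : sheared M mu @` polyline (centred (- 2^-1) 0 2^-1) kink =
  polyline (nth 0 sheared_kink 0) (behead sheared_kink).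
Proof.
have [mu0 muTD muT muD] := kink_slopeP; have T1' := T1; have D1' := D1.
have M1 := kink_bound_ge1.
rewrite /= !image_setU image_set0.
have -> := @sheared_segment M mu (- 2^-1) 0 2^-1 0 (- 1) 0 (- (3 / 2)) (- 1); last first.
  by move=> t t01; rewrite shear_left_mid//; lra.
have -> := @sheared_segment M mu 0 (- 1) 0 2^-1 0 (- 2^-1) (- 1) (- 2^-1); last first.
  by move=> t t01; rewrite shear_diag//; [lra|lra|right; lra].
have -> := @sheared_segment M mu 2^-1 0 (- 2^-1) 2^-1 0 (- D) (- 2^-1) (- 2^-1 + mu * (D - 2^-1)); last first.
  move=> t /andP[t0 t1]; rewrite shear_right_down//; [by field|lra|].
  by apply/andP; split; [rewrite /kink_bound; nra|nra].
have -> := @sheared_segment M mu 2^-1 0 (- D) (3 / 2) 0 (- D) (- 2^-1 + mu * (D - 2^-1)) (- (2 * mu * D)); last first.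
  move=> t /andP[t0 t1]; rewrite shear_right_down//; [by field|lra|].
  by rewrite /kink_bound; lra.
have -> := @sheared_segment M mu (3 / 2) 0 (- D) (3 / 2) 0 T (- (2 * mu * D)) (2 * mu * T); last first.
  move=> t /andP[t0 t1]; rewrite shear_far//; [ring|lra|].
  by rewrite /kink_bound; apply/andP; split; nra.
have -> := @sheared_segment M mu (3 / 2) 0 T 2^-1 0 T (2 * mu * T) (2^-1 - mu * (T - 2^-1)); last first.
  move=> t /andP[t0 t1]; rewrite shear_right_up//; [by field|lra|].
  by rewrite /kink_bound; lra.
have -> := @sheared_segment M mu 2^-1 0 T 2^-1 0 2^-1 (2^-1 - mu * (T - 2^-1)) 2^-1; last first.
  move=> t /andP[t0 t1]; rewrite shear_right_up//; [by field|lra|].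
  by apply/andP; split; [nra|rewrite /kink_bound; nra].
have -> := @sheared_segment M mu 2^-1 0 2^-1 0 1 0 2^-1 1; last first.
  by move=> t t01; rewrite shear_diag//; [lra|lra|left; lra].
have -> := @sheared_segment M mu 0 1 0 (- 2^-1) 0 (- 2^-1) 1 (3 / 2); last first.
  by move=> t t01; rewrite shear_left_mid//; lra.
by [].
Qed.

Lemma sheared_lineE :
  sheared M mu @` segment (centred (- 2^-1) 0 2^-1) (centred (- 2^-1) 0 (- 2^-1)) =
  segment (centred (- 2^-1) (- (3 / 2)) 2^-1) (centred (- 2^-1) (3 / 2) (- 2^-1)).
Proof.
have M1 := kink_bound_ge1.
by apply: sheared_segment => t t01; rewrite shear_left_mid//; lra.
Qed.

(** Distant parts of the rest are separated from the move by [x] or [z]. The nearby parts lie to the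
    left, in the cones [|y| <= 2 * |Z| - 1] above and below the crossing. There the shear adds at
    least [3 * |Z|] in absolute value, with sign opposite to [Z], hence leaves
    [|y| >= |Z| + 1 >= 3 / 2], outside the range of [y] in which the contraction takes place. The
    factor 3 of the shear has to exceed the slope 2 of the cones. *)
Lemma remove_kink (rest : set 'rV[R]_3) :
  (forall q, rest q -> let X := q 0 0 - (n + 2^-1) in let Z := q 0 2 - (j + 2^-1) in
    [\/ X <= - (3 / 2), 5 / 2 <= X, T + 1 <= Z | Z <= - D - 1] \/
    [/\ X <= - 2^-1, - D - 1 <= Z <= T + 1 &
      (2^-1 <= Z /\ - (2 * Z - 1) <= q 0 1 <= 2 * Z - 1) \/
      (Z <= - 2^-1 /\ 2 * Z + 1 <= q 0 1 <= - (2 * Z) - 1)]) ->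
  isotopic
    (Some @` (rest `|` polyline (centred (- 2^-1) 0 2^-1) kink))
    (Some @` (rest `|` segment (centred (- 2^-1) 0 2^-1) (centred (- 2^-1) 0 (- 2^-1)))).
Proof.
move=> restP; have M1 := kink_bound_ge1; have [mu0 _ _ _] := kink_slopeP.
(* Both pictures undergo the same shear, and the sheared pictures are then joined by a straight-line
   move. *)
apply: isotopic_trans (sheared_isotopic _ M1 (ltW mu0)) _.
apply: isotopic_sym.
apply: isotopic_trans (sheared_isotopic _ M1 (ltW mu0)) _.
apply: isotopic_sym.
rewrite !(image_setU _ rest) sheared_kinkE sheared_lineE polyline_trails /=.
(* The sheared segment, parametrized by [y]: it was sheared by [- 3 * Z], so [Z = - y / 3] on it. *)
pose Q (_ : 'I_1) l := centred (- 2^-1) 0 0 + kink_height l *: point 0 1 (- 3^-1).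
have Q0 i l : Q i l 0 0 = n by rewrite !mxE /=; lra.
have Q1 i l : Q i l 0 1 = kink_height l by rewrite !mxE /=; lra.
have Q2 i l : Q i l 0 2 = j + 2^-1 - kink_height l / 3 by rewrite !mxE /=; lra.
have QE i l : Q i l = point n (kink_height l) (j + 2^-1 - kink_height l / 3).
  by rewrite [LHS]pointP Q0 Q1 Q2.
have -> : segment (centred (- 2^-1) (- (3 / 2)) 2^-1) (centred (- 2^-1) (3 / 2) (- 2^-1)) =
    trails 9 Q.
  rewrite /Q (affine_trails _ _ _ kink_height_inc)// -!/(Q ord0 _) !QE !kink_heightE /=.
  by congr segment; congr point; lra.
apply: (@trail_move R 1 1 9 kink_height _ Q) => //.
- exact: kink_height_inc.
- move=> i; split; rewrite QE kink_heightE /=; congr point; lra.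
- by move=> i i' l; rewrite (ord1 i) (ord1 i').
- move=> _ [q Cq <-]; rewrite shearedE !(point0, point1, point2).
  set X := q 0 0 - _; set Z := q 0 2 - _ => hq.
  have qX : q 0 0 = n + 2^-1 + X by rewrite /X; ring.
  have qZ : q 0 2 = j + 2^-1 + Z by rewrite /Z; ring.
  case: (restP q Cq) => /=; rewrite -/X -/Z.
  + move=> [hX|hX|hZ|hZ].
    * by exists 0; right => i l /sheared_kink_box[h _]; rewrite point0 qX Q0; lra.
    * by exists 0; left => i l /sheared_kink_box[h _]; rewrite point0 qX Q0; lra.
    * exists 2; left => i l l9; have [_ h] := sheared_kink_box l9.
      by have := kink_height_bound l9; have := T1; rewrite point2 qZ Q2; lra.
    * exists 2; right => i l l9; have [_ h] := sheared_kink_box l9.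
      by have := kink_height_bound l9; have := D1; rewrite point2 qZ Q2; lra.
  + have T1' := T1; have D1' := D1.
    move=> [hX hZ [[Z2 y]|[Z2 y]]]; exfalso; move: hq; rewrite !kink_heightE /=.
      rewrite shear_left_up//; [|lra|rewrite /kink_bound; lra].
      have : 0 <= mu * (Z - 2^-1) by rewrite mulr_ge0//; lra.
      by lra.
    rewrite shear_left_down//; [|lra|rewrite /kink_bound; lra].
    have : 0 <= mu * (- Z - 2^-1) by rewrite mulr_ge0//; lra.
    by lra.
Qed.

End RemoveKink.

(** * The kink inside a closed braid diagram *)

Section KinkClosure.
Variable R : realType.
Implicit Types v q : 'rV[R]_3.

(** Within a half-layer [y] changes by at most 1, that is, with slope at most 2 in the height; this
    yields the cones of [remove_kink]. *)
Lemma strand_box n j o i v : opt_letter n o -> (i <= n)%N -> strand j o i v ->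
  [/\ v 0 0 <= n%:R, - (2 * (v 0 2 - j%:R)) <= v 0 1 <= 2 * (v 0 2 - j%:R) &
      - (2 * (j.+1%:R - v 0 2)) <= v 0 1 <= 2 * (j.+1%:R - v 0 2)].
Proof.
move=> on iN; rewrite strandE -(natr1 j).
have iR : (i%:R : R) <= n%:R by rewrite ler_nat.
have sR : ((step o i)%:R : R) <= n%:R.
  rewrite ler_nat; case: o on => [[k e]|] //= /andP[k0 kn].
  by case: eqP => // _; case: eqP => // _; rewrite ltnW.
have [mx my] : (mid R o i).1 <= n%:R /\ - 1 <= (mid R o i).2 <= 1.
  have ok : - 1 <= (0 : R) <= 1 by lra.
  case: o on {sR} => [[k e]|] //= /andP[k0 kn].
  have kR : (k%:R + 2^-1 : R) <= n%:R.
    by have : (k.+1%:R : R) <= n%:R; [rewrite ler_nat|rewrite -(natr1 k); lra].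
  by case: eqP => _ /=; [|case: eqP => _ /=]; split => //; case: e; lra.
by move=> [] /segmentP[t [/andP[t0 t1] ->]]; rewrite point_mix !(point0, point1, point2);
  split; try (apply/andP; split); nra.
Qed.

Lemma opt_braid_box n j w v : all (opt_letter n) w -> opt_braid n j w v ->
  [/\ v 0 0 <= n%:R, - (2 * (v 0 2 - j%:R)) <= v 0 1 <= 2 * (v 0 2 - j%:R) &
      - (2 * ((j + size w)%:R - v 0 2)) <= v 0 1 <= 2 * ((j + size w)%:R - v 0 2)].
Proof.
elim: w j => [//|o w IH] j /= /andP[on wn] [[i [/andP[_ iN] H]]|H].
  have [h1 h2 h3] := strand_box on iN H.
  have : (j.+1%:R : R) <= (j + (size w).+1)%:R by rewrite ler_nat addnS ltnS leq_addr.
  by move=> h4; split => //; lra.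
have [h1 h2 h3] := IH j.+1 wn H; rewrite addSnnS in h3; split => //.
by rewrite -(natr1 j) in h2; lra.
Qed.

(** No letter touches the last position, so its strand is one vertical column. The extra point on
    the left accounts for the empty word, whose column degenerates to a point. *)
Lemma opt_braid_column n j w v : all (opt_letter n) w ->
  (opt_braid n.+1 j w v \/ v = point n.+1%:R 0 j%:R) <->
  (opt_braid n j w v \/ segment (point n.+1%:R 0 j%:R) (point n.+1%:R 0 (j + size w)%:R) v).
Proof.
have jj a : (a <= a.+1)%N by [].
elim: w j => [|o w IH] j /=.
  move=> _; rewrite addn0; split => -[//|H]; right.
    by rewrite H; exact: segment_left.
  move/segment_zP: H => /(_ (lexx _)) [v0 v1 v2].
  rewrite (pointP v) v0 v1; congr (point _ _ _).
  by case/andP: v2 => v2 v2'; apply/le_anti; rewrite v2 v2'.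
move=> /andP[on wn]; have IHw := IH j.+1 wn.
have stn : strand j o n.+1 = segment (point n.+1%:R 0 j%:R) (point n.+1%:R 0 j.+1%:R)
    :> set 'rV[R]_3.
  case: o on => [[k e] /= /andP[_ kn]|_]; last by rewrite strand_straight.
  by rewrite strand_far ?strand_straight// => ?; lia.
have layerE : opt_layer n.+1 j o v <->
    (opt_layer n j o v \/ segment (point n.+1%:R 0 j%:R) (point n.+1%:R 0 j.+1%:R) v).
  rewrite -stn; split.
    move=> [i [/andP[i1]]]; rewrite leq_eqVlt => /orP[/eqP -> H|iN H]; first by right.
    by left; exists i; rewrite i1.
  move=> [[i [/andP[i1 iN] H]]|H]; last by exists n.+1; rewrite leqnn.
  by exists i; rewrite i1 leqW.
have segE : segment (point n.+1%:R 0 j%:R) (point n.+1%:R 0 (j + (size w).+1)%:R) v <->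
    (segment (point n.+1%:R 0 j%:R) (point n.+1%:R 0 j.+1%:R) v \/
     segment (point n.+1%:R 0 j.+1%:R) (point n.+1%:R 0 (j.+1 + size w)%:R) v).
  have h1 : (j%:R : R) <= j.+1%:R by rewrite ler_nat.
  have h2 : (j.+1%:R : R) <= (j.+1 + size w)%:R by rewrite ler_nat leq_addr.
  rewrite -addSnnS !segment_zP//; last by apply: le_trans h1 h2.
  split => [[v0 v1 /andP[v2 v3]]|[[v0 v1 /andP[v2 v3]]|[v0 v1 /andP[v2 v3]]]].
  - by have [v4|v4] := leP (v 0 2) j.+1%:R; [left|right]; split => //; lra.
  - by split => //; lra.
  - by split => //; lra.
have pj : v = point n.+1%:R 0 j%:R ->
    segment (point n.+1%:R 0 j%:R) (point n.+1%:R 0 j.+1%:R) v.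
  by move=> ->; exact: segment_left.
have pj1 : v = point n.+1%:R 0 j.+1%:R ->
    segment (point n.+1%:R 0 j%:R) (point n.+1%:R 0 j.+1%:R) v.
  by move=> ->; exact: segment_right.
rewrite /setU /=; clear -IHw layerE segE pj pj1; tauto.
Qed.

Lemma closing_arcsS N m n v : closing_arcs N m n.+1 v <->
  (closing_arcs N m n v \/ closing_arc N m n.+1 v).
Proof.
split.
  move=> [i /= /andP[i1]]; rewrite leq_eqVlt => /orP[/eqP -> H|iN H]; first by right.
  by left; exists i; rewrite //= i1.
move=> [[i /= /andP[i1 iN] H]|H]; last by exists n.+1; rewrite //= leqnn.
by exists i; rewrite //= i1 leqW.
Qed.

Section LastStrand.
Variables (n : nat) (X Y : opt_word).
Hypotheses (n0 : (0 < n)%N) (Xn : all (opt_letter n) X) (Yn : all (opt_letter n) Y).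
Local Notation j := (size X).
Local Notation m := (size X + (size Y).+1)%N.
(** The last closing arc has its horizontal edges at the heights [m + 1] and [- 1]; [T] and [D] are
    measured from the centre of the crossing at height [j + 1 / 2]. *)
Local Notation T := ((size Y)%:R + 3 / 2 : R).
Local Notation D := ((size X)%:R + 3 / 2 : R).

Definition other_straight : set 'rV[R]_3 :=
  [set v | exists i, (1 <= i < n)%N /\ strand j None i v].

Definition kink_rest : set 'rV[R]_3 :=
  opt_braid n 0 X `|` (other_straight `|` (opt_braid n j.+1 Y `|` closing_arcs n.+1 m n)).

(** The columns at position [n + 1] next to [X] and [Y] merge with the vertical ends of the last
    closing arc into the two long inner edges of the kink. *)
Lemma kink_diagram :
  opt_braid n.+1 0 (X ++ Some (n, true) :: Y) `|` closing_arcs n.+1 m n.+1 =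
  kink_rest `|` polyline (centred n%:R j%:R (- 2^-1) 0 2^-1) (kink n%:R j%:R T D).
Proof.
have mE : m%:R = j%:R + (size Y)%:R + 1 :> R by rewrite natrD -(natr1 (size Y)) addrA.
have nS : n.+1%:R = n%:R + 1 :> R by rewrite -(natr1 n).
have jS : j.+1%:R = j%:R + 1 :> R by rewrite -(natr1 j).
have nN : (n == n.+1) = false by rewrite ltn_eqF.
have nN' : (n.+1 == n) = false by rewrite gtn_eqF.
apply/seteqP; suff H v : (opt_braid n.+1 0 (X ++ Some (n, true) :: Y) `|` closing_arcs n.+1 m n.+1) v <->
  (kink_rest `|` polyline (centred n%:R j%:R (- 2^-1) 0 2^-1) (kink n%:R j%:R T D)) v.
  by split => v /H.
have XE := @opt_braid_column n 0 X v Xn.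
have YE := @opt_braid_column n j.+1 Y v Yn.
have AE := closing_arcsS n.+1 m n v.
have LE : opt_layer n.+1 j (Some (n, true)) v <-> (other_straight v \/
    (strand j (Some (n, true)) n v \/ strand j (Some (n, true)) n.+1 v)).
  split.
    move=> [i [/andP[i1]]]; rewrite leq_eqVlt => /orP[/eqP -> H|]; first by right; right.
    rewrite ltnS leq_eqVlt => /orP[/eqP -> H|iN H]; first by right; left.
    left; exists i; rewrite i1 iN; split => //.
    by rewrite strand_far in H => // ?; lia.
  move=> [[i [/andP[i1 iN] H]]|[H|H]].
  - exists i; rewrite i1 leqW ?(ltnW iN)//; split => //.
    by rewrite strand_far// => ?; lia.
  - by exists n; rewrite n0 leqnSn.
  - by exists n.+1; rewrite leqnn.
have aE : point n%:R 0 j%:R = centred n%:R j%:R (- 2^-1) 0 (- 2^-1) :> 'rV[R]_3.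
  by congr (point _ _ _); lra.
have a'E : point n%:R 0 j.+1%:R = centred n%:R j%:R (- 2^-1) 0 2^-1 :> 'rV[R]_3.
  by congr (point _ _ _); lra.
have bE : point (n%:R + 2^-1) 1 (j%:R + 2^-1) = centred n%:R j%:R 0 1 0 :> 'rV[R]_3.
  by congr (point _ _ _); lra.
have b'E : point (n%:R + 2^-1) (- 1) (j%:R + 2^-1) = centred n%:R j%:R 0 (- 1) 0 :> 'rV[R]_3.
  by congr (point _ _ _); lra.
have c1E : point n.+1%:R 0 j.+1%:R = centred n%:R j%:R 2^-1 0 2^-1 :> 'rV[R]_3.
  by congr (point _ _ _); lra.
have c2E : point n.+1%:R 0 j%:R = centred n%:R j%:R 2^-1 0 (- 2^-1) :> 'rV[R]_3.
  by congr (point _ _ _); lra.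
have t1E : centred n%:R j%:R 2^-1 0 T = point n.+1%:R 0 (m%:R + 1) :> 'rV[R]_3.
  by congr (point _ _ _); rewrite ?mE; lra.
have t2E : centred n%:R j%:R (3 / 2) 0 T = point (n.+1%:R + 1) 0 (m%:R + 1) :> 'rV[R]_3.
  by congr (point _ _ _); rewrite ?mE; lra.
have b1E : centred n%:R j%:R 2^-1 0 (- D) = point n.+1%:R 0 (- 1) :> 'rV[R]_3.
  by congr (point _ _ _); rewrite ?mE; lra.
have b2E : centred n%:R j%:R (3 / 2) 0 (- D) = point (n.+1%:R + 1) 0 (- 1) :> 'rV[R]_3.
  by congr (point _ _ _); rewrite ?mE; lra.
have dE : n.+2%:R - n.+1%:R = 1 :> R by rewrite -(natr1 n.+1); lra.
have j0 : (0 : R) <= j%:R by [].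
have jm : (j.+1%:R : R) <= m%:R by rewrite ler_nat addnS ltnS leq_addr.
have low : segment (centred n%:R j%:R 2^-1 0 (- 2^-1)) (centred n%:R j%:R 2^-1 0 (- D)) v <->
    (segment (point n.+1%:R 0 0%:R) (point n.+1%:R 0 (0 + j)%:R) v \/
     segment (point n.+1%:R 0 (- 1)) (point n.+1%:R 0 0) v).
  rewrite -c2E b1E segmentC add0n !segment_zP; try by lra.
  split => [[v0 v1 /andP[v2 v3]]|[[v0 v1 /andP[v2 v3]]|[v0 v1 /andP[v2 v3]]]].
  - by have [v4|v4] := leP (v 0 2) 0; [right|left]; split => //; lra.
  - by split => //; lra.
  - by split => //; lra.
have high : segment (centred n%:R j%:R 2^-1 0 T) (centred n%:R j%:R 2^-1 0 2^-1) v <->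
    (segment (point n.+1%:R 0 j.+1%:R) (point n.+1%:R 0 (j.+1 + size Y)%:R) v \/
     segment (point n.+1%:R 0 m%:R) (point n.+1%:R 0 (m%:R + 1)) v).
  rewrite t1E -c1E segmentC addSnnS !segment_zP; try by lra.
  split => [[v0 v1 /andP[v2 v3]]|[[v0 v1 /andP[v2 v3]]|[v0 v1 /andP[v2 v3]]]].
  - by have [v4|v4] := leP (v 0 2) m%:R; [left|right]; split => //; lra.
  - by split => //; lra.
  - by split => //; lra.
have p0 : v = point n.+1%:R 0 0%:R -> segment (point n.+1%:R 0 (- 1)) (point n.+1%:R 0 0) v.
  by move=> ->; exact: segment_right.
have p1 : v = point n.+1%:R 0 j.+1%:R -> segment (centred n%:R j%:R 2^-1 0 2^-1) (centred n%:R j%:R 0 1 0) v.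
  by rewrite c1E => ->; exact: segment_left.
rewrite opt_braid_cat add0n /=.
move: LE; rewrite !strandE /= nN' !eqxx /= aE a'E bE b'E c1E c2E.
move: AE; rewrite /closing_arc /= dE -t1E -t2E -b1E -b2E.
move: low high p0 p1 XE YE; rewrite add0n -t1E -b1E c1E c2E.
rewrite /kink_rest /setU /set0 /mkset /=.
rewrite (segmentC (centred _ _ (- 2^-1) 0 2^-1)) (segmentC (centred _ _ 0 (- 1) 0) (centred _ _ 2^-1 _ _)).
rewrite (segmentC (centred _ _ 2^-1 0 (- D)) (centred _ _ (3 / 2) _ _)).
rewrite (segmentC (centred _ _ (3 / 2) 0 (- D)) (centred _ _ (3 / 2) 0 T)).
rewrite (segmentC (centred _ _ (3 / 2) 0 T) (centred _ _ 2^-1 0 T)).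
rewrite (segmentC (centred _ _ 2^-1 0 2^-1) (centred _ _ 0 1 0)).
rewrite (segmentC (centred _ _ 0 1 0) (centred _ _ (- 2^-1) _ _)).
(* With the point sets turned into propositional atoms, only a rearrangement of unions is left. *)
repeat match goal with
  | |- context [@segment R ?a ?b v] => generalize (@segment R a b v); intro
  | |- context [@opt_braid R ?a ?b ?c v] => generalize (@opt_braid R a b c v); intro
  | |- context [@closing_arcs R ?a ?b ?c v] => generalize (@closing_arcs R a b c v); intro
  end.
move=> low high p0 p1 XE YE AE LE; split.
  move=> [[H|[H|H]]|H].
  - by have := XE.1 (or_introl H); clear -low; tauto.
  - by have := LE.1 H; clear; tauto.
  - by have := YE.1 (or_introl H); clear -high; tauto.
  - by have := AE.1 H; clear -low high; tauto.
move=> [[H|[H|[H|H]]]|[H|[H|[H|[H|[H|[H|[H|[H|[H|//]]]]]]]]]].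
- by have := XE.2 (or_introl H); clear -AE p0; tauto.
- by clear -LE H; tauto.
- by have := YE.2 (or_introl H); clear -LE p1; tauto.
- by clear -AE H; tauto.
- by clear -LE H; tauto.
- by clear -LE H; tauto.
- case: (low.1 H) => {}H; last by clear -AE H; tauto.
  by have := XE.2 (or_intror H); clear -AE p0; tauto.
- by clear -AE H; tauto.
- by clear -AE H; tauto.
- by clear -AE H; tauto.
- case: (high.1 H) => {}H; last by clear -AE H; tauto.
  by have := YE.2 (or_intror H); clear -LE p1; tauto.
- by clear -LE H; tauto.
- by clear -LE H; tauto.
Qed.

Lemma straight_diagram :
  opt_braid n 0 (X ++ None :: Y) `|` closing_arcs n.+1 m n =
  kink_rest `|` segment (centred n%:R j%:R (- 2^-1) 0 2^-1) (centred n%:R j%:R (- 2^-1) 0 (- 2^-1)).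
Proof.
rewrite opt_braid_cat add0n /=.
have -> : segment (centred n%:R j%:R (- 2^-1) 0 2^-1) (centred n%:R j%:R (- 2^-1) 0 (- 2^-1)) =
    strand j None n :> set 'rV[R]_3.
  rewrite segmentC strand_straight//; congr segment; congr (point _ _ _); lra.
have -> : opt_layer n j None = other_straight `|` strand j None n :> set 'rV[R]_3.
  apply/seteqP; split => v.
    move=> [i [/andP[i1]]]; rewrite leq_eqVlt => /orP[/eqP -> H|iN H]; first by right.
    by left; exists i; rewrite i1.
  move=> [[i [/andP[i1 iN] H]]|H]; first by exists i; rewrite i1 ltnW.
  by exists n; rewrite n0 leqnn.
by rewrite /kink_rest; apply/seteqP; split => v; rewrite /setU /=; tauto.
Qed.

(* The strand at position [n + 1] only serves the crossing [sigma_n]. *)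
Lemma pull_last_strand :
  @isotopic R (Some @` (opt_braid n.+1 0 (X ++ Some (n, true) :: Y) `|` closing_arcs n.+1 m n.+1))
           (Some @` (opt_braid n 0 (X ++ None :: Y) `|` closing_arcs n.+1 m n)).
Proof.
have T1 : 3 / 2 <= T by rewrite lerDr.
have D1 : 3 / 2 <= D by rewrite lerDr.
have mE : m%:R = j%:R + (size Y)%:R + 1 :> R by rewrite natrD -(natr1 (size Y)) addrA.
have nS : n.+1%:R = n%:R + 1 :> R by rewrite -(natr1 n).
have jS : j.+1%:R = j%:R + 1 :> R by rewrite -(natr1 j).
rewrite kink_diagram straight_diagram; apply: remove_kink => // q.
have nR : (1 : R) <= n%:R by rewrite (ler_nat _ 1).
have j0 : (0 : R) <= j%:R by [].
have Y0 : (0 : R) <= (size Y)%:R by [].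
case=> [H|[[i [/andP[i1 iN] H]]|[H|[i /= /andP[i1 iN] H]]]].
- have [x0 y1 y2] := opt_braid_box Xn H; have := opt_braid_height H.
  rewrite !add0n in y1 y2 * => hz.
  by right; split; [lra|lra|right; lra].
- left; constructor 1; rewrite (strand_x_straight _ _ H)//.
  by have : (i.+1%:R : R) <= n%:R; [rewrite ler_nat|rewrite -(natr1 i); lra].
- have [x0 y1 y2] := opt_braid_box Yn H; have := opt_braid_height H.
  rewrite natrD jS in y1 y2 * => hz.
  by right; split; [lra|lra|left; lra].
have iR : (i%:R : R) <= n%:R by rewrite ler_nat.
have dE : n.+2%:R = n%:R + 2 :> R by rewrite -addn2 natrD.
have i1R : (1 : R) <= i%:R by rewrite (ler_nat _ 1).
have col : q 0 0 = i%:R -> q 0 1 = 0 ->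
    j%:R + 1 <= q 0 2 <= m%:R + (n%:R + 2 - i%:R) \/ - (n%:R + 2 - i%:R) <= q 0 2 <= j%:R ->
    [\/ q 0 0 - (n%:R + 2^-1) <= - (3 / 2), 5 / 2 <= q 0 0 - (n%:R + 2^-1),
      T + 1 <= q 0 2 - (j%:R + 2^-1) | q 0 2 - (j%:R + 2^-1) <= - D - 1] \/
    [/\ q 0 0 - (n%:R + 2^-1) <= - 2^-1, - D - 1 <= q 0 2 - (j%:R + 2^-1) <= T + 1 &
      (2^-1 <= q 0 2 - (j%:R + 2^-1) /\ - (2 * (q 0 2 - (j%:R + 2^-1)) - 1) <= q 0 1 <= 2 * (q 0 2 - (j%:R + 2^-1)) - 1) \/
      (q 0 2 - (j%:R + 2^-1) <= - 2^-1 /\ 2 * (q 0 2 - (j%:R + 2^-1)) + 1 <= q 0 1 <= - (2 * (q 0 2 - (j%:R + 2^-1))) - 1)].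
  move=> q0 q1 q2; rewrite q0 q1.
  (* Columns at positions below [n] have [X <= - 3 / 2]. The column at [n] starts at the left ends
     of the crossing and lies in the cones, since [y = 0] on it. *)
  move: iN; rewrite leq_eqVlt => /orP[/eqP iN|iN]; last first.
    left; constructor 1.
    by have : (i.+1%:R : R) <= n%:R; [rewrite ler_nat|rewrite -(natr1 i); lra].
  rewrite iN in q2; rewrite mE in q2.
  by right; split; [rewrite iN; lra|lra|case: q2 => q2; [left|right]; lra].
move: H => /closing_arcP[]; first by rewrite leqW.
rewrite dE => q1 [[q0 q2]|[q2 q0]|[q0 q2]|[[q2 q0]|[q0 q2]]].
- by apply: col => //; left; rewrite mE in q2 *; lra.
- by left; constructor 3; rewrite q2 mE; lra.
- by left; constructor 2; rewrite q0 nS; lra.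
- by left; constructor 4; rewrite q2; lra.
- by apply: col => //; right; lra.
Qed.

End LastStrand.

End KinkClosure.

(** * Rescaling away the spare layer and the spare position *)

Section Rescaling.
Variable R : realType.

Section OneCoordinate.
Variables (psi : R -> R) (k B : R).
Hypotheses (k01 : 0 <= k < 1) (psiB : forall x, `|psi x| <= B).
Hypothesis psiL : forall x y, `|psi x - psi y| <= k * `|x - y|.

Lemma lipschitz_continuous : continuous psi.
Proof.
move=> x; apply/cvgrPdist_le => /= e e0; near=> y.
apply: le_trans (psiL _ _) _; apply: (@le_trans _ _ `|x - y|).
  by case/andP: k01 => k0 k1; rewrite ler_piMl// ltW.
by near: y; apply/nbhs_ballP; exists e => //= y /ltW.
Unshelve. all: by end_near. Qed.

Lemma shift_lt x y : x < y -> x + psi x < y + psi y.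
Proof.
move=> xy; have yx : 0 < y - x by rewrite subr_gt0.
have h := le_trans (ler_norm _) (psiL x y).
have : k * `|x - y| < y - x.
  rewrite distrC gtr0_norm// -[ltRHS]mul1r ltr_pM2r//.
  by case/andP: k01.
lra.
Qed.

Lemma shift_le x y : (x + psi x <= y + psi y) = (x <= y).
Proof.
apply/idP/idP => [|]; last by rewrite le_eqVlt => /orP[/eqP -> //|/shift_lt/ltW].
by apply: contraTT; rewrite -!ltNge; exact: shift_lt.
Qed.

Lemma shift_eq x y : (x + psi x = y + psi y) <-> (x = y).
Proof.
split => [H|-> //]; apply/le_anti.
by rewrite -(shift_le x y) -(shift_le y x) H lexx.
Qed.

Lemma shift_surj y : exists x, x + psi x = y.
Proof.
have B0 : 0 <= B by apply: le_trans (psiB 0).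
have psi_in x : - B <= psi x <= B by rewrite -ler_norml.
have [|||x _ xE] := @IVT R (fun x => x + psi x) (y - B) (y + B) y.
- lra.
- apply: continuous_subspaceT => x; apply: cvgD; first exact: cvg_id.
  exact: lipschitz_continuous.
- have h1 := psi_in (y - B); have h2 := psi_in (y + B).
  by rewrite ge_min le_max; apply/andP; split; apply/orP; [left|right]; lra.
- by exists x.
Qed.

Lemma shift_isotopic (c : 'I_3) (K : set 'rV[R]_3) :
  isotopic (Some @` K) (Some @` ((fun v => v + psi (v 0 c) *: delta_mx 0 c) @` K)).
Proof.
have e1 : `|delta_mx 0 c : 'rV[R]_3| <= 1.
  by apply: normv_le => // i; rewrite mxE /=; case: eqP => _; rewrite ?normr1 ?normr0.
apply: (@perturb_isotopy _ (fun i => i != c) _ B k) => //.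
- have cc : continuous (fun v : 'rV[R]_3 => psi (v 0 c)).
    move=> v; apply: (cvg_comp (fun v : 'rV[R]_3 => v 0 c) psi).
      exact: coord_continuous.
    exact: lipschitz_continuous.
  by move=> v; apply: (@cvgZ _ _ _ (nbhs v)); [exact: cc|exact: cvg_cst].
- by move=> v; rewrite normrZ -[leRHS]mulr1 ler_pM.
- by move=> v i /negPf ic; rewrite !mxE ic andbF mulr0.
- move=> v w _; rewrite -scalerBl normrZ -[leRHS]mulr1 ler_pM//.
  apply: le_trans (psiL _ _) _; case/andP: k01 => k0 _; rewrite ler_wpM2l//.
  have -> : v 0 c - w 0 c = (v - w) 0 c by rewrite !mxE.
  exact: normv_coord.
Qed.

End OneCoordinate.

Lemma ramp_lipschitz (u v x y : R) : u < v ->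
  `|ramp u v x - ramp u v y| <= (v - u)^-1 * `|x - y|.
Proof.
move=> uv; have vu : 0 < v - u by rewrite subr_gt0.
have max_lip (a b : R) : `|Num.max 0 a - Num.max 0 b| <= `|a - b|.
  have h1 := ler_norm (a - b).
  have h2 : b - a <= `|a - b| by rewrite distrC ler_norm.
  by rewrite ler_norml; case: (leP 0 a); case: (leP 0 b) => *; lra.
have min_lip (a b : R) : `|Num.min 1 a - Num.min 1 b| <= `|a - b|.
  have h1 := ler_norm (a - b).
  have h2 : b - a <= `|a - b| by rewrite distrC ler_norm.
  by rewrite ler_norml; case: (leP 1 a); case: (leP 1 b) => *; lra.
apply: le_trans (min_lip _ _) _; apply: le_trans (max_lip _ _) _.
rewrite -mulrBl opprB addrA subrK normrM mulrC ler_wpM2r//.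
by rewrite ger0_norm// invr_ge0 ltW.
Qed.

(** For [0 < L' < L], the map [x + squeeze p L L' x] fixes [x <= p], takes the interval of length
    [L] after [p] affinely to one of length [L'], and translates what lies beyond. *)
Definition squeeze (p L L' x : R) := - (L - L') * ramp p (p + L) x.

Lemma squeeze_lipschitz (p L L' x y : R) : 0 < L' < L ->
  `|squeeze p L L' x - squeeze p L L' y| <= (1 - L' / L) * `|x - y|.
Proof.
move=> /andP[L0 L1]; have pL : p < p + L by lra.
rewrite /squeeze -mulrBr normrM normrN (@ger0_norm _ (L - L')); last by lra.
apply: le_trans (ler_wpM2l _ (ramp_lipschitz _ _ pL)) _; first by lra.
rewrite mulrA ler_wpM2r//.
have -> : p + L - p = L by ring.
by rewrite mulrBl divff// gt_eqF//; lra.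
Qed.

Lemma squeeze_bound (p L L' x : R) : 0 < L' < L -> `|squeeze p L L' x| <= L - L'.
Proof.
move=> /andP[L0 L1]; rewrite /squeeze normrM normrN (@ger0_norm _ (L - L')); last by lra.
have /andP[r0 r1] := ramp01 p (p + L) x.
by rewrite ger0_norm// ler_piMr//; lra.
Qed.

Lemma squeeze_low (p L L' x : R) : 0 < L -> x <= p -> squeeze p L L' x = 0.
Proof. by move=> L0 xp; rewrite /squeeze ramp_le ?mulr0//; lra. Qed.

Lemma squeeze_high (p L L' x : R) : 0 < L -> p + L <= x -> squeeze p L L' x = L' - L.
Proof. by move=> L0 xp; rewrite /squeeze ramp_ge ?mulr1 ?opprB//; lra. Qed.

(** A change of [x] and a change of [z], both increasing, fix the braid and carry one layout of arcs
    to the other; the straight layer is absorbed by the vertical starts of the arcs. *)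
Lemma shrink_closure n (w : opt_word) : all (opt_letter n) w ->
  @isotopic R (Some @` (opt_braid n 0 (rcons w None) `|` closing_arcs n.+1 (size w).+1 n))
              (Some @` (opt_braid n 0 w `|` closing_arcs n (size w) n)).
Proof.
move=> wn; pose m := size w; set K := opt_braid n 0 (rcons w None) `|` _.
(* For [i <= n] the offset [d = n + 2 - i >= 2] of an arc has to become [d - 1]. The right edge at
   [n + 1 + d] and the top edge at [m + 1 + d] thus move by 2, the bottom edge at [- d] by 1. These
   edges lie beyond [n + 3], [m + 3] and [- 2], respectively. *)
pose psix := squeeze n%:R 3 1 : R -> R.
pose psiz := squeeze m%:R 3 1 : R -> R.
pose psib x := squeeze (- 2) 2 1 x + 1 : R.
have c1 : 0 < (1 : R) < 3 by lra.
have c2 : 0 < (1 : R) < 2 by lra.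
have kx : 0 <= (1 - 1 / 3 : R) < 1 by lra.
have kb : 0 <= (1 - 1 / 2 : R) < 1 by lra.
have xB x : `|psix x| <= 3 - 1 by exact: squeeze_bound.
have zB x : `|psiz x| <= 3 - 1 by exact: squeeze_bound.
have bB x : `|psib x| <= 2 - 1 + 1.
  by apply: le_trans (ler_normD _ _) _; rewrite normr1 lerD2r; exact: squeeze_bound.
have xL x y : `|psix x - psix y| <= (1 - 1 / 3) * `|x - y| by exact: squeeze_lipschitz.
have zL x y : `|psiz x - psiz y| <= (1 - 1 / 3) * `|x - y| by exact: squeeze_lipschitz.
have bL x y : `|psib x - psib y| <= (1 - 1 / 2) * `|x - y|.
  have -> : psib x - psib y = squeeze (- 2) 2 1 x - squeeze (- 2) 2 1 y.
    by rewrite /psib; ring.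
  exact: squeeze_lipschitz.
pose fx x := x + psix x.
pose fz z := (z + psiz z) + psib (z + psiz z).
pose F (v : 'rV[R]_3) := point (fx (v 0 0)) (v 0 1) (fz (v 0 2)).
pose h (psi : R -> R) (c : 'I_3) (v : 'rV[R]_3) := v + psi (v 0 c) *: delta_mx 0 c.
have FE : F @` K = h psib 2 @` (h psiz 2 @` (h psix 0 @` K)).
  rewrite !image_comp; congr (_ @` _); apply/funext => v /=.
  rewrite /F /h /fx /fz; apply/rowP => -[[|[|[|c]]] //= ?];
    rewrite !mxE /= ?mulr0 ?mulr1 ?addr0 //.
  - by rewrite (_ : Ordinal _ = 0 :> 'I_3)//; exact/val_inj.
  - by rewrite (_ : Ordinal _ = 1 :> 'I_3)//; exact/val_inj.
  - by rewrite (_ : Ordinal _ = 2 :> 'I_3)//; exact/val_inj.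
apply: (@isotopic_trans _ (Some @` (F @` K))).
  rewrite FE; apply: isotopic_trans (shift_isotopic kx xB xL 0 K) _.
  apply: isotopic_trans (shift_isotopic kx zB zL 2 _) _.
  exact: (shift_isotopic kb bB bL 2 _).
have fx_le a b : (fx a <= fx b) = (a <= b) by exact: shift_le kx xL _ _.
have fx_eq a b : (fx a = fx b) = (a = b) by apply/propext; exact: shift_eq kx xL _ _.
have fz_le a b : (fz a <= fz b) = (a <= b).
  by rewrite /fz (shift_le kb bL) (shift_le kx zL).
have fz_eq a b : (fz a = fz b) = (a = b).
  by apply/propext; rewrite /fz (shift_eq kb bL) (shift_eq kx zL).
have fx_low x : x <= n%:R -> fx x = x.
  by move=> xn; rewrite /fx /psix squeeze_low ?addr0//; lra.
have fx_high x : n%:R + 3 <= x -> fx x = x - 2.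
  by move=> xn; rewrite /fx /psix squeeze_high//; lra.
have m0 : (0 : R) <= m%:R by [].
have fz_mid z : 0 <= z <= m%:R -> fz z = z.
  move=> /andP[z0 zm]; rewrite /fz /psiz squeeze_low ?addr0//.
  by rewrite /psib squeeze_high; [ring|lra|lra].
have fz_high z : m%:R + 3 <= z -> fz z = z - 2.
  move=> zm; rewrite /fz /psiz squeeze_high//.
  by rewrite /psib squeeze_high; [ring|lra|lra].
have fz_low z : z <= - 2 -> fz z = z + 1.
  move=> zm; rewrite /fz /psiz squeeze_low//; last by lra.
  by rewrite /psib squeeze_low; [ring|lra|lra].
(* As [F] is onto, the image can be tested by pulling back; monotonicity turns each inequality for
   [F v] into one for [v]. *)
suff KF v : K v <-> (opt_braid n 0 w `|` closing_arcs n m n) (F v).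
  suff -> : F @` K = opt_braid n 0 w `|` closing_arcs n m n by exact: isotopic_refl.
  apply/seteqP; split => [_ [v /KF Kv <-] //|v Kv].
  have [x xE] := shift_surj kx xB xL (v 0 0).
  have [z' z'E] := shift_surj kb bB bL (v 0 2).
  have [z zE] := shift_surj kx zB zL z'.
  suff Fv : F (point x (v 0 1) z) = v by exists (point x (v 0 1) z); first by apply/KF; rewrite Fv.
  by rewrite /F !(point0, point1, point2) /fx /fz zE z'E xE -pointP.
have braidE : opt_braid n 0 w v <-> opt_braid n 0 w (F v).
  have fixF : v 0 0 <= n%:R -> 0 <= v 0 2 <= m%:R -> F v = v.
    by move=> x z; rewrite /F fx_low// fz_mid// -pointP.
  split => H.
    have [x _ _] := opt_braid_box wn H; have := opt_braid_height H; rewrite add0n => z.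
    by rewrite fixF.
  have [x _ _] := opt_braid_box wn H; have := opt_braid_height H; rewrite add0n => z.
  rewrite -fixF//.
    by move: x; rewrite /F point0 -[X in _ <= X](fx_low n%:R)// fx_le.
  have e0 : fz 0 = 0 by rewrite fz_mid// lexx m0.
  have em : fz m%:R = m%:R by rewrite fz_mid// m0 lexx.
  move: z; rewrite /F point2 => /andP[z0 z1].
  by apply/andP; split; rewrite -fz_le ?e0 ?em.
have arcE i : (1 <= i <= n)%N ->
    (strand m None i v \/ closing_arc n.+1 m.+1 i v) <-> closing_arc n m i (F v).
  move=> /andP[i1 iN]; have iR : (i%:R : R) <= n%:R by rewrite ler_nat.
  have mS : (m%:R : R) <= m.+1%:R by rewrite ler_nat.
  rewrite strand_straight// segment_zP// !closing_arcP//; last by rewrite leqW.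
  rewrite /F !(point0, point1, point2).
  pose d : R := n.+2%:R - i%:R.
  have d2 : 2 <= d by rewrite /d -(natr1 n.+1) -(natr1 n); lra.
  have e1 : fx i%:R = i%:R by rewrite fx_low.
  have e2 : fx (n.+1%:R + d) = n%:R + (n.+1%:R - i%:R).
    by rewrite fx_high /d -(natr1 n.+1) -(natr1 n); lra.
  have e3 : fz m%:R = m%:R by rewrite fz_mid// m0 lexx.
  have e4 : fz (m.+1%:R + d) = m%:R + (n.+1%:R - i%:R).
    by rewrite fz_high -(natr1 m); [rewrite /d -(natr1 n.+1) -(natr1 n); lra|lra].
  have e5 : fz (- d) = - (n.+1%:R - i%:R).
    by rewrite fz_low; [rewrite /d -(natr1 n.+1) -(natr1 n); lra|lra].
  have e6 : fz 0 = 0 by rewrite fz_mid// lexx m0.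
  have a1 x : (fx x = i%:R) = (x = i%:R) by rewrite -{1}e1 fx_eq.
  have a2 x : (i%:R <= fx x) = (i%:R <= x) by rewrite -{1}e1 fx_le.
  have a3 z : (m%:R <= fz z) = (m%:R <= z) by rewrite -{1}e3 fz_le.
  have a4 z : (fz z <= 0) = (z <= 0) by rewrite -{1}e6 fz_le.
  rewrite -/d -e2 -e4 -e5 !a1 !a2 !a3 !a4 !fx_le !fz_le !fx_eq !fz_eq.
  rewrite -(natr1 m).
  split.
    move=> [[v0 v1 v2]|[v1 [[v0 v2]|[v2 v0]|[v0 v2]|[[v2 v0]|[v0 v2]]]]]; split => //.
    - by constructor 1; split => //; lra.
    - by constructor 1; split => //; lra.
    - by constructor 2.
    - by constructor 3.
    - by constructor 4; left.
    - by constructor 4; right.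
  move=> [v1 [[v0 v2]|[v2 v0]|[v0 v2]|[[v2 v0]|[v0 v2]]]].
  - have [v3|v3] := leP (v 0 2) (m%:R + 1); first by left; split => //; lra.
    by right; split => //; constructor 1; split => //; lra.
  - by right; split => //; constructor 2.
  - by right; split => //; constructor 3.
  - by right; split => //; constructor 4; left.
  - by right; split => //; constructor 4; right.
rewrite /K -cats1 opt_braid_cat add0n /= -/m; split.
  move=> [[H|[[i [iN H]]|//]]|[i iN H]]; first by left; apply/braidE.
    by right; exists i => //; apply/arcE => //; left.
  by right; exists i => //; apply/arcE => //; right.
move=> [/braidE H|[i iN /arcE -/(_ iN) [H|H]]]; first by left; left.
  by left; right; left; exists i.
by right; exists i.
Qed.

Lemma slide_to_top n m (X Y : opt_word) : (m = size X + (size Y).+1)%N ->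
  all (fun o => opt_letter n o && (o != None)) Y -> forall N, (n <= N)%N ->
  @isotopic R (Some @` (opt_braid n 0 (X ++ None :: Y) `|` closing_arcs N m n))
              (Some @` (opt_braid n 0 (rcons (X ++ Y) None) `|` closing_arcs N m n)).
Proof.
move=> mE Yn N nN; elim: Y X mE Yn => [|[l|//] Y IH] X mE /=.
  by rewrite cats0 cats1 => _; exact: isotopic_refl.
rewrite andbT => /andP[ln Yn].
apply: isotopic_trans (_ : isotopic _ (Some @` (opt_braid n 0 (X ++ [:: Some l; None] ++ Y)
  `|` closing_arcs N m n))) _.
  apply: (@opt_braid_context R n X [:: None; Some l] [:: Some l; None] Y) => // [C|].
    by rewrite addn2; exact: slide_straight.
  rewrite !size_cat /= -/(size _).
  have -> : (size X + (size Y).+2)%N = m by rewrite mE.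
  exact: clear_of_closing_arcs.
have := IH (rcons X (Some l)); rewrite !cat_rcons /=; apply.
  by rewrite mE size_rcons addSnnS.
exact: Yn.
Qed.

(** The kink is pulled away and leaves a straight layer, the straight layer slides to the top, and
    rescaling absorbs it. *)
Lemma destabilize n (X Y : seq nat) : (0 < n)%N ->
  letters_below n X -> letters_below n Y ->
  isotopic (braid_closure R n.+1 (positive (X ++ n :: Y)))
           (braid_closure R n (positive (X ++ Y))).
Proof.
move=> n0 Xn Yn.
have wide k Z : (k <= n)%N -> letters_below k Z -> letters_below n.+1 Z.
  by move=> kn; apply: sub_all => i /andP[i0 ik]; rewrite i0 (leq_trans ik)// leqW.
rewrite !braid_closure_opt; first last.
- by rewrite on_strands_positive letters_below_cat /= n0 leqnn !(wide n).
- by rewrite on_strands_positive letters_below_cat Xn.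
pose S (Z : seq nat) : opt_word := map Some (positive Z).
have ok Z : letters_below n Z -> all (fun o => opt_letter n o && (o != None)) (S Z).
  move=> Zn; rewrite /S /positive -map_comp all_map.
  by apply: sub_all Zn => i /= ->.
have ok' Z : letters_below n Z -> all (opt_letter n) (S Z).
  by move/ok; apply: sub_all => o /andP[].
rewrite {1}/positive !map_cat /= -/(positive X) -/(positive Y) -/(S X) -/(S Y).
have sizeE Z : size (S Z) = size Z by rewrite !size_map.
rewrite !size_map !size_cat /=.
apply: isotopic_trans (_ : isotopic _ (Some @` (opt_braid n 0 (S X ++ None :: S Y) `|`
  closing_arcs n.+1 (size X + (size Y).+1) n))) _.
  by have := pull_last_strand R n0 (ok' X Xn) (ok' Y Yn); rewrite !sizeE.
apply: isotopic_trans (slide_to_top _ (ok Y Yn) (leqnSn n)) _; first by rewrite !sizeE.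
rewrite (_ : map Some _ = S X ++ S Y); last by rewrite /S /positive !map_cat.
have := @shrink_closure n (S X ++ S Y); rewrite size_cat !sizeE addnS; apply.
by rewrite all_cat !ok'.
Qed.

End Rescaling.

(** * Powers of full twists *)

Section BraidWords.
Local Open Scope nat_scope.
Implicit Types (u w x : seq nat) (n i k p c : nat).

Lemma braid_eq_context n u w a b : braid_eq n u w ->
  braid_eq n (a ++ u ++ b) (a ++ w ++ b).
Proof.
elim=> {u w} [w|u w _|u w x _ IH1 _ IH2|u w i j ni nj ij|u w i i0 ni].
- exact: braid_eq_refl.
- exact: braid_eq_sym.
- exact: braid_eq_trans IH1 IH2.
- by have := @braid_eq_far n (a ++ u) (w ++ b) i j ni nj ij; rewrite -!catA.
- by have := @braid_eq_yang_baxter n (a ++ u) (w ++ b) i i0 ni; rewrite -!catA.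
Qed.

Lemma braid_eq_catl n u w x : braid_eq n u w -> braid_eq n (x ++ u) (x ++ w).
Proof. by move/(@braid_eq_context n u w x [::]); rewrite !cats0. Qed.

Lemma braid_eq_catr n u w x : braid_eq n u w -> braid_eq n (u ++ x) (w ++ x).
Proof. exact: (@braid_eq_context n u w [::] x). Qed.

Lemma braid_eq_cat n u u' w w' : braid_eq n u u' -> braid_eq n w w' ->
  braid_eq n (u ++ w) (u' ++ w').
Proof.
by move=> H1 H2; apply: braid_eq_trans (braid_eq_catr w H1) (braid_eq_catl u' H2).
Qed.

Lemma braid_eq_rev n u w : braid_eq n u w -> braid_eq n (rev u) (rev w).
Proof.
elim=> {u w} [w|u w _|u w x _ IH1 _ IH2|u w i j ni nj ij|u w i i0 ni].
- exact: braid_eq_refl.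
- exact: braid_eq_sym.
- exact: braid_eq_trans IH1 IH2.
- rewrite !rev_cat -!catA; apply: braid_eq_far => //.
  by rewrite orbC.
- by rewrite !rev_cat -!catA; exact: braid_eq_yang_baxter.
Qed.

Lemma braid_eq_widen n m u w : n <= m -> braid_eq n u w -> braid_eq m u w.
Proof.
move=> nm; elim=> {u w} [w|u w _|u w x _ IH1 _ IH2|u w i j ni nj ij|u w i i0 ni].
- exact: braid_eq_refl.
- exact: braid_eq_sym.
- exact: braid_eq_trans IH1 IH2.
- by apply: braid_eq_far => //; lia.
- by apply: braid_eq_yang_baxter => //; lia.
Qed.

Lemma far_word n i w : 0 < i < n -> all (fun j => (0 < j < n) && ((i.+1 < j) || (j.+1 < i))) w ->
  braid_eq n (i :: w) (rcons w i).
Proof.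
move=> ni; elim: w => [|j w IH] /=; first by move=> _; exact: braid_eq_refl.
move=> /andP[/andP[nj ij] wn]; apply: braid_eq_trans (braid_eq_catl [:: j] (IH wn)).
exact: (@braid_eq_far n [::] w i j).
Qed.

Definition power w k := flatten (nseq k w).

Lemma powerS w k : power w k.+1 = w ++ power w k. Proof. by []. Qed.

Lemma powerD w k k' : power w (k + k') = power w k ++ power w k'.
Proof. by rewrite /power nseqD flatten_cat. Qed.

Lemma powerSr w k : power w k.+1 = power w k ++ w.
Proof. by rewrite -addn1 powerD /power /= cats0. Qed.

Lemma powerM w k k' : power w (k * k') = power (power w k) k'.
Proof.
elim: k' => [|k' IH]; first by rewrite muln0.
by rewrite mulnS powerD IH.
Qed.

Lemma rev_power w k : rev (power w k) = power (rev w) k.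
Proof. by elim: k => [//|k IH]; rewrite powerS rev_cat IH powerSr. Qed.

Lemma map_power (f : nat -> nat) w k : map f (power w k) = power (map f w) k.
Proof. by rewrite /power map_flatten map_nseq. Qed.

Lemma braid_eq_power n u w k : braid_eq n u w -> braid_eq n (power u k) (power w k).
Proof.
move=> uw; elim: k => [|k IH]; first exact: braid_eq_refl.
exact: braid_eq_cat.
Qed.

Lemma all_power (P : pred nat) w k : all P w -> all P (power w k).
Proof. by move=> Pw; elim: k => [//|k IH]; rewrite powerS all_cat Pw. Qed.

(** The last letter [i] commutes leftwards past the letters above [i + 1], meets [i, i + 1] in a
    Yang-Baxter move, and the resulting [i + 1] commutes past the letters below [i]. *)
Lemma asc_shift n a k i : 0 < a -> a + k <= n -> a <= i -> i.+1 < a + k ->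
  braid_eq n (iota a k ++ [:: i]) (i.+1 :: iota a k).
Proof.
move=> a0 akn ai ik.
have -> : iota a k = iota a (i - a) ++ [:: i; i.+1] ++ iota i.+2 (a + k - i.+2).
  have {1}-> : k = (i - a) + (2 + (a + k - i.+2)) by lia.
  by rewrite iotaD subnKC// iotaD /= addn2.
set A := iota a _; set B := iota i.+2 _.
apply: (@braid_eq_trans _ _ (A ++ [:: i; i.+1] ++ [:: i] ++ B)).
  rewrite -!catA; apply: braid_eq_catl; apply: (braid_eq_catl [:: i; i.+1]).
  apply: braid_eq_sym; rewrite cats1; apply: far_word; first by lia.
  by apply/allP => j; rewrite mem_iota; lia.
apply: (@braid_eq_trans _ _ (A ++ [:: i.+1; i; i.+1] ++ B)).
  by apply: (@braid_eq_yang_baxter n A B i); lia.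
have -> : A ++ [:: i.+1; i; i.+1] ++ B = rcons A i.+1 ++ [:: i; i.+1] ++ B.
  by rewrite cat_rcons.
apply: braid_eq_sym; apply: (@braid_eq_catr n (i.+1 :: A)).
apply: far_word; first by lia.
by apply/allP => j; rewrite mem_iota; lia.
Qed.

Lemma desc_shift n a k i : 0 < a -> a + k <= n -> a <= i -> i.+1 < a + k ->
  braid_eq n (rev (iota a k) ++ [:: i.+1]) (i :: rev (iota a k)).
Proof.
move=> a0 akn ai ik; have := braid_eq_rev (asc_shift a0 akn ai ik).
by rewrite cats1 rev_rcons rev_cons -cats1 => /braid_eq_sym.
Qed.

Lemma word_asc n a k w : 0 < a -> a + k <= n ->
  all (fun i => a < i < a + k) w ->
  braid_eq n (w ++ iota a k) (iota a k ++ map predn w).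
Proof.
move=> a0 akn; elim: w => [_|i w IH /= /andP[ai wn]].
  by rewrite cats0; exact: braid_eq_refl.
apply: (@braid_eq_trans _ _ (i :: (iota a k ++ map predn w))).
  exact: (braid_eq_catl [:: i] (IH wn)).
rewrite -cat_cons (_ : iota a k ++ _ = (iota a k ++ [:: i.-1]) ++ map predn w);
  last by rewrite -catA.
apply: braid_eq_catr.
have iE : i = i.-1.+1 by rewrite prednK//; lia.
by rewrite {1}iE; apply: braid_eq_sym; apply: asc_shift; lia.
Qed.

Lemma desc_word n a k w : 0 < a -> a + k <= n ->
  all (fun i => a < i < a + k) w ->
  braid_eq n (rev (iota a k) ++ w) (map predn w ++ rev (iota a k)).
Proof.
move=> a0 akn; elim: w => [_|i w IH /= /andP[ai wn]].
  by rewrite cats0; exact: braid_eq_refl.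
have iE : i = i.-1.+1 by rewrite prednK//; lia.
apply: (@braid_eq_trans _ _ ((i.-1 :: rev (iota a k)) ++ w)).
  rewrite -cat1s catA; apply: braid_eq_catr.
  by rewrite {1}iE; apply: desc_shift; lia.
exact: (braid_eq_catl [:: i.-1] (IH wn)).
Qed.

Definition up n := iota 1 n.-1.
(** The word [n - 1, ..., n - k]; on [n] strands, [down n u.-1] is one factor of the overlined block
    with first entry [u]. *)
Definition down n k := rev (iota (n - k) k).

Lemma upS n : 0 < n -> up n.+1 = rcons (up n) n.
Proof.
by case: n => // n _; rewrite /up -!pred_Sn -{1}[n.+1]addn1 iotaD add1n cats1.
Qed.

Lemma downS n k : k < n -> down n.+1 k.+1 = n :: down n k.
Proof.
move=> kn; rewrite /down subSS -[in iota _ k.+1](addn1 k) iotaD rev_cat /=.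
by rewrite subnK// ltnW.
Qed.

Lemma down_pred n k : 0 < k -> k <= n -> map predn (down n.+1 k.-1) = down n k.-1.
Proof.
move=> k0 kn; rewrite /down map_rev; congr rev.
have -> : n.+1 - k.-1 = (n - k.-1).+1 by rewrite subSn//; lia.
by rewrite -[_.+1]add1n iotaDl -map_comp map_id_in.
Qed.

(** In the inductive step the descending word passes through [up n.+1] with all letters lowered by
    1. The last letter [n] of [up n.+1] then stands in front of it and makes it one letter
    longer. *)
Lemma up_power n k : k < n.+1 ->
  braid_eq n.+1 (power (up n.+1) k) (power (up n) k ++ down n.+1 k).
Proof.
elim: k => [_|k IH kn]; first exact: braid_eq_refl.
have n0 : 0 < n by lia.
apply: (@braid_eq_trans _ _ (power (up n) k ++ (down n.+1 k ++ up n.+1))).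
  by rewrite powerSr catA; apply: braid_eq_catr; apply: IH; lia.
rewrite powerSr -catA; apply: braid_eq_catl.
apply: (@braid_eq_trans _ _ (up n.+1 ++ map predn (down n.+1 k))).
  apply: word_asc => //; apply/allP => i.
  by rewrite /down mem_rev mem_iota /=; lia.
have -> : map predn (down n.+1 k) = down n k by have := @down_pred n k.+1; apply; lia.
rewrite upS// cat_rcons downS//; exact: braid_eq_refl.
Qed.

(** By [up_power], the full twist on [n + 1] strands is the one on [n] strands followed by the
    palindrome [rev (up n.+1) ++ up n.+1]. Reversal fixes the palindrome and puts it in front; as it
    commutes with words on [n] strands, the induction hypothesis finishes. *)
Lemma full_twist n : braid_eq n (power (up n) n) (power (rev (up n)) n).
Proof.
elim: n => [|n IH]; first exact: braid_eq_refl.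
have [->|n0] := posnP n; first exact: braid_eq_refl.
have down_up : down n.+1 n = rev (up n.+1) by rewrite /down subSnn.
have up_full : braid_eq n.+1 (power (up n.+1) n.+1)
    (power (up n) n ++ (rev (up n.+1) ++ up n.+1)).
  rewrite powerSr catA -down_up; apply: braid_eq_catr.
  exact: up_power.
(* A letter [i] becomes [i + 1] after the descending half and [i] again after the ascending half. *)
have comm w : letters_below n w -> braid_eq n.+1 (w ++ (rev (up n.+1) ++ up n.+1))
    ((rev (up n.+1) ++ up n.+1) ++ w).
  elim: w => [_|i w IHw /= /andP[ni wn]]; first by rewrite cats0; exact: braid_eq_refl.
  apply: (@braid_eq_trans _ _ (i :: (rev (up n.+1) ++ up n.+1) ++ w)).
    exact: (braid_eq_catl [:: i] (IHw wn)).
  apply: (@braid_eq_trans _ _ ((rev (up n.+1) ++ [:: i.+1]) ++ up n.+1 ++ w)).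
    have := @desc_shift n.+1 1 n i; rewrite -/(up n.+1) => H.
    rewrite -catA; apply: (@braid_eq_catr n.+1 (i :: rev (up n.+1))).
    by apply: braid_eq_sym; apply: H; lia.
  have := @asc_shift n.+1 1 n i; rewrite -/(up n.+1) => H.
  rewrite -!catA; apply: braid_eq_catl.
  have -> : up n.+1 ++ i :: w = (up n.+1 ++ [:: i]) ++ w by rewrite -catA.
  by apply: (@braid_eq_catr n.+1 (i.+1 :: up n.+1)); apply: braid_eq_sym; apply: H; lia.
apply: (braid_eq_trans up_full); apply: braid_eq_sym.
have := braid_eq_rev up_full; rewrite rev_power => /braid_eq_trans; apply.
rewrite rev_cat rev_power rev_cat revK; apply: braid_eq_sym.
apply: braid_eq_trans (comm _ _) _.
  by apply: all_power; apply/allP => i; rewrite /up mem_iota; lia.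
apply: braid_eq_catl; exact: braid_eq_widen IH.
Qed.

End BraidWords.

(** * Trading strands for descending factors *)

Section TorusLinkPresentations.
Local Open Scope nat_scope.
Variable R : realType.

Lemma letters_below_up n m k : n <= m -> letters_below m (power (up n) k).
Proof.
by move=> nm; apply: all_power; apply/allP => i; rewrite /up mem_iota; lia.
Qed.

Lemma letters_below_down n m k l : n <= m -> k < n -> letters_below m (power (down n k) l).
Proof.
by move=> nm kn; apply: all_power; apply/allP => i; rewrite /down mem_rev mem_iota; lia.
Qed.

(** By [up_power], [power (up n.+1) u] is [power (up n) u ++ down n.+1 u]. The existing descending
    factors move left through [down n.+1 u] with their letters lowered, which takes them to [n]
    strands. The letter [n] then occurs only once, at the head of [down n.+1 u], and destabilizing
    removes it; the remainder [down n u.-1] is the new factor. *)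
Lemma trade_strand p c n u k : p <= n -> 0 < u -> u <= n ->
  isotopic
    (braid_closure R n.+1 (positive (power (up p) c ++ power (up n.+1) u ++
                                     power (down n.+1 u.-1) k)))
    (braid_closure R n (positive (power (up p) c ++ power (up n) u ++
                                  power (down n u.-1) k.+1))).
Proof.
move=> pn u0 un; have n0 : 0 < n by lia.
pose X := power (up p) c ++ power (up n) u ++ power (down n u.-1) k.
have -> : power (up p) c ++ power (up n) u ++ power (down n u.-1) k.+1 = X ++ down n u.-1.
  by rewrite /X powerSr !catA.
have Xn : letters_below n X.
  rewrite /X !letters_below_cat !letters_below_up// letters_below_down//.
  by lia.
have Yn : letters_below n (down n u.-1).
  by have := @letters_below_down n n u.-1 1; rewrite /power /= cats0; apply => //; lia.
apply: isotopic_trans (destabilize R n0 Xn Yn).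
apply: braid_eq_closure; last first.
  rewrite !letters_below_cat !letters_below_up ?leqnn//; last by lia.
  by rewrite letters_below_down//; lia.
rewrite /X -!catA; apply: braid_eq_catl.
apply: braid_eq_trans (braid_eq_catr _ (up_power (_ : u < n.+1))) _; first by [].
rewrite -catA; apply: braid_eq_catl.
have dE : n :: down n u.-1 = down n.+1 u.
  by have := @downS n u.-1; rewrite prednK//; move=> ->//; lia.
rewrite dE; have -> : power (down n u.-1) k = map predn (power (down n.+1 u.-1) k).
  by rewrite map_power down_pred.
apply: desc_word; first by lia.
  by lia.
apply: all_power; apply/allP => i; rewrite /down mem_rev mem_iota; lia.
Qed.

Lemma trade_strands p c u v k : 0 < u -> u <= p ->
  isotopic
    (braid_closure R (p + v) (positive (power (up p) c ++ power (up (p + v)) u ++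
                                        power (down (p + v) u.-1) k)))
    (braid_closure R p (positive (power (up p) c ++ power (up p) u ++
                                  power (down p u.-1) (v + k)))).
Proof.
move=> u0 up'; elim: v k => [|v IH] k; first by rewrite addn0 add0n; exact: isotopic_refl.
have := IH k.+1; rewrite -addSnnS; apply: isotopic_trans.
by rewrite addnS; apply: trade_strand; rewrite ?leq_addr//; lia.
Qed.

Lemma down_full p : down p p.-1 = rev (up p).
Proof. by rewrite /down /up; case: p => // p; rewrite subSnn. Qed.

Lemma torus_T_link p c a : 0 < p ->
  isotopic
    (braid_closure R (p + p * a) (positive (power (up p) c ++ power (up (p + p * a)) p)))
    (braid_closure R p (positive (power (up p) (c + p + p * a)))).
Proof.
move=> p0; have := @trade_strands p c p (p * a) 0 p0 (leqnn p).
rewrite cats0 addn0 => /isotopic_trans; apply.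
apply: braid_eq_closure; last first.
  rewrite !letters_below_cat !letters_below_up// letters_below_down//.
  by lia.
rewrite !powerD -catA; apply: braid_eq_catl; apply: braid_eq_catl.
rewrite down_full !powerM; apply: braid_eq_power.
by apply: braid_eq_sym; exact: full_twist.
Qed.

Lemma torus_V_link p a c :
  isotopic
    (braid_closure R p (positive (power (rev (up p)) (p * a) ++ power (up p) c)))
    (braid_closure R p (positive (power (up p) (p * a + c)))).
Proof.
apply: braid_eq_closure.
  rewrite powerD; apply: braid_eq_catr; rewrite !powerM; apply: braid_eq_power.
  by apply: braid_eq_sym; exact: full_twist.
rewrite letters_below_cat letters_below_up// -rev_power.
by rewrite /letters_below all_rev; rewrite -/(letters_below p _) letters_below_up.
Qed.

End TorusLinkPresentations.

(** * Components and the braid index *)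

(** Each connected set lies in a single [L i], so choosing for every [i] a connected set through a
    point of [L i] gives an injection. *)
Lemma connected_cover_leq (T : topologicalType) (m p : nat)
    (S : 'I_m -> set T) (L : 'I_p -> set T) :
  (forall a, connected (S a)) -> (forall i, closed (L i)) ->
  (forall i, L i !=set0) -> (forall i j, i != j -> L i `&` L j = set0) ->
  (forall v, (exists a, S a v) <-> (exists i, L i v)) -> (p <= m)%N.
Proof.
move=> cS cL L0 Ldis SL.
have /choice[x xL] : forall i, exists x, L i x by exact: L0.
have /choice[f fS] : forall i, exists a, S a (x i).
  by move=> i; apply/SL; exists i.
have finj : injective f.
  move=> i j fij; apply/eqP; apply: contraT => ij.
  suff Li : S (f i) `<=` L i.
    have Lij : (L i `&` L j) (x j).
      by split=> //; apply: Li; rewrite fij.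
    by rewrite Ldis in Lij.
  pose C := \bigcup_(k in [set k | k != i]) L k.
  have cC : closed C.
    apply: closed_bigcup => [|k _]; last exact: cL.
    exact: finite_finset.
  (* The other pieces have a closed union, so [L i] is relatively open as well as relatively closed
     in the connected set. *)
  have SLi : S (f i) `&` L i = S (f i) `&` ~` C.
    apply/seteqP; split => v [Sv Lv]; split => //.
      move=> [k /= ki Lk].
      by have : (L k `&` L i) v by []; rewrite Ldis.
    have [k Lk] : exists k, L k v by apply/SL; exists (f i).
    by have [<-//|ki] := eqVneq k i; exfalso; apply: Lv; exists k.
  rewrite -(cS (f i) (S (f i) `&` L i)); first by move=> v [].
  - by exists (x i).
  - by exists (~` C); [exact: closed_openC|].
  - by exists (L i).
by have := leq_card f finj; rewrite !card_ord.
Qed.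

Lemma connected_image (S T : topologicalType) (f : S -> T) (A : set S) :
  continuous f -> connected A -> connected (f @` A).
Proof.
by move=> cf cA; apply: connected_continuous_connected => //; exact: continuous_subspaceT.
Qed.

Fixpoint final_position (w : braid_word) (i : nat) : nat :=
  if w is l :: w' then final_position w' (step (Some l) i) else i.

Lemma stepK o : involutive (step o).
Proof.
case: o => [[k e]|] i //=.
have kk : k.+1 == k = false by rewrite gtn_eqF.
have [->|ik] := eqVneq i k; first by rewrite kk eqxx.
by have [->|ik1] := eqVneq i k.+1; rewrite ?eqxx // (negPf ik) (negPf ik1).
Qed.

Lemma step_range n l i : (0 < l.1 < n)%N -> (0 < i <= n)%N ->
  (0 < step (Some l) i <= n)%N.
Proof. by case: l => k e /= kn iN; do 2?[case: eqP => ?]; lia. Qed.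

Local Arguments step : simpl never.

Lemma final_position_range n w i : on_strands n w -> (0 < i <= n)%N ->
  (0 < final_position w i <= n)%N.
Proof.
elim: w i => [//|l w IH] i /= /andP[ln wn] iN.
by apply: IH => //; exact: step_range.
Qed.

Lemma final_position_surj n w i : on_strands n w -> (0 < i <= n)%N ->
  exists2 i', (0 < i' <= n)%N & final_position w i' = i.
Proof.
elim: w i => [|l w IH] i /=; first by exists i.
move=> /andP[ln wn] iN; have [i' iN' <-] := IH i wn iN.
by exists (step (Some l) i'); rewrite ?step_range// stepK.
Qed.

Section Components.
Variable R : realType.

Fixpoint run (j : nat) (w : braid_word) (i : nat) : set 'rV[R]_3 :=
  if w is l :: w' then strand j (Some l) i `|` run j.+1 w' (step (Some l) i)
  else set0.

(** A whole component when the braid is pure. In general it is just a connected piece of one, which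
    suffices for bounding the number of components by the number of strands. *)
Definition component (n : nat) (w : braid_word) (i : nat) : set 'rV[R]_3 :=
  run 0 w i `|` closing_arc n (size w) (final_position w i).

Lemma opt_braid_run n j w v : on_strands n w ->
  opt_braid n j (map Some w) v <-> exists i, (0 < i <= n)%N /\ run j w i v.
Proof.
elim: w j => [|l w IH] j /=; first by move=> _; split => // -[i []].
move=> /andP[ln wn]; split.
  move=> [[i [iN H]]|/IH-/(_ wn) [i [iN H]]]; first by exists i; split=> //; left.
  by exists (step (Some l) i); rewrite step_range//; split=> //; right; rewrite stepK.
move=> [i [iN [H|H]]]; first by left; exists i.
by right; apply/IH => //; exists (step (Some l) i); rewrite step_range.
Qed.

Lemma closure_components n w v : on_strands n w ->
  closure_R3 n w v <-> exists i, (0 < i <= n)%N /\ component n w i v.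
Proof.
move=> wn; rewrite closure_opt//; split.
  move=> [/opt_braid_run-/(_ wn) [i [iN H]]|[i iN H]]; first by exists i; split=> //; left.
  have [i' iN' iE] := final_position_surj wn iN.
  by exists i'; split=> //; right; rewrite iE.
move=> [i [iN [H|H]]]; first by left; apply/opt_braid_run => //; exists i.
by right; exists (final_position w i) => //=; exact: final_position_range.
Qed.

Lemma continuous_segment (u v : 'rV[R]_3) :
  continuous (fun t : R => (1 - t) *: u + t *: v).
Proof.
move=> t; apply: cvgD.
  by apply: cvgZ; [apply: cvgB; [exact: cvg_cst|exact: cvg_id]|exact: cvg_cst].
by apply: cvgZ; [exact: cvg_id|exact: cvg_cst].
Qed.

Lemma connected_segment (u v : 'rV[R]_3) : connected (segment u v).
Proof.
apply: connected_continuous_connected; first exact: segment_connected.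
by apply: continuous_subspaceT; exact: continuous_segment.
Qed.

Lemma compact_segment (u v : 'rV[R]_3) : compact (segment u v).
Proof.
apply: continuous_compact; last exact: segment_compact.
by apply: continuous_subspaceT; exact: continuous_segment.
Qed.

Lemma connected_segmentU (u v : 'rV[R]_3) A : connected A -> A v ->
  connected (segment u v `|` A).
Proof.
move=> cA Av; apply: connectedU => //; last exact: connected_segment.
by exists v; split => //; exact: segment_right.
Qed.

Lemma connected_polyline (a b : 'rV[R]_3) s : connected (polyline a (b :: s)).
Proof.
elim: s a b => [|c s IH] a b; first by rewrite /= setU0; exact: connected_segment.
apply: connected_segmentU; first exact: IH.
by left; exact: segment_left.
Qed.

Lemma compact_polyline (a : 'rV[R]_3) s : compact (polyline a s).
Proof.
elim: s a => [|b s IH] a; first exact: compact0.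
by apply: compactU; [exact: compact_segment|exact: IH].
Qed.

(** The bottom end point is part of the conclusion so that the strand of the layer below can be
    attached there. *)
Lemma run_connected j w i (A : set 'rV[R]_3) : connected A ->
  A (point (final_position w i)%:R 0 (j + size w)%:R) ->
  connected (run j w i `|` A) /\ (run j w i `|` A) (point i%:R 0 j%:R).
Proof.
move=> cA; elim: w j i => [|l w IH] j i /=.
  by rewrite addn0 set0U => Aw; split=> //; right.
rewrite -addSnnS => Aw; have [cr rs] := IH j.+1 _ Aw.
rewrite strandE; split; last by left; left; left; exact: segment_left.
rewrite -!setUA; apply: connected_segmentU; last by left; exact: segment_left.
exact: connected_segmentU.
Qed.

Lemma component_connected n w i :
  connected (component n w i) /\ component n w i (point i%:R 0 0).
Proof.
apply: (@run_connected 0 w i); last by left; exact: segment_left.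
exact: connected_polyline.
Qed.

Lemma run_compact j w i : compact (run j w i).
Proof.
elim: w j i => [|l w IH] j i /=; first exact: compact0.
apply: compactU; last exact: IH.
by rewrite strandE; apply: compactU; exact: compact_segment.
Qed.

Lemma component_compact n w i : compact (component n w i).
Proof. by apply: compactU; [exact: run_compact|exact: compact_polyline]. Qed.

Lemma strand_ends j o i (v : 'rV[R]_3) : strand j o i v ->
  (v 0 2 = j%:R -> v = point i%:R 0 j%:R) /\
  (v 0 2 = j.+1%:R -> v = point (step o i)%:R 0 j.+1%:R).
Proof.
rewrite strandE -(natr1 j) => -[] /segmentP[t [/andP[t0 t1] ->]]; rewrite point_mix point2.
  split => h; last by exfalso; lra.
  have -> : t = 0 by lra.
  by congr (point _ _ _); ring.
split => h; first by exfalso; lra.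
have -> : t = 1 by lra.
by congr (point _ _ _); ring.
Qed.

Lemma strand_crossing j k e i (v : 'rV[R]_3) :
  let s : R := if e then 1 else - 1 in
  strand j (Some (k, e)) i v ->
  [/\ i = k -> v 0 0 = k%:R + (v 0 2 - j%:R) /\
        (v 0 2 - j%:R = 2^-1 -> v 0 1 = s) &
      i = k.+1 -> v 0 0 = k.+1%:R - (v 0 2 - j%:R) /\
        (v 0 2 - j%:R = 2^-1 -> v 0 1 = - s)].
Proof.
move=> s; have kk : k.+1 == k = false by rewrite gtn_eqF.
rewrite strandE -(natr1 j) => -[] /segmentP[t [/andP[t0 t1] ->]];
  rewrite point_mix !(point0, point1, point2); split => ->;
  rewrite /step /= ?kk !eqxx -?(natr1 k) /= -/s; split; try lra.
- by move=> h; rewrite (_ : t = 1); lra.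
- by move=> h; rewrite (_ : t = 1); lra.
- by move=> h; rewrite (_ : t = 0); lra.
- by move=> h; rewrite (_ : t = 0); lra.
Qed.

(** The two crossing strands have the same [x] only at mid-height, where their [y] are 1 and - 1;
    all other pairs are separated by [x]. *)
Lemma strand_disjoint j l i i' (v : 'rV[R]_3) : i != i' -> strand j (Some l) i v ->
  strand j (Some l) i' v -> False.
Proof.
case: l => k e.
wlog ii' : i i' / (i < i')%N.
  move=> W; rewrite neq_ltn => /orP[lt|lt] H H'.
    by apply: (W i i' lt _ H H'); rewrite ltn_eqF.
  by apply: (W i' i lt _ H' H); rewrite ltn_eqF.
move=> _ H H'; have iR : (i.+1%:R : R) <= i'%:R by rewrite ler_nat.
have straight a : a <> k -> a <> k.+1 -> strand j (Some (k, e)) a v -> v 0 0 = a%:R.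
  move=> ak ak1 Ha; have [m s] := step_far R e ak ak1.
  exact: strand_x_straight m s Ha.
have [c1 c2] := strand_crossing H; have [c1' c2'] := strand_crossing H'.
have kS : k.+1%:R = k%:R + 1 :> R by rewrite -(natr1 k).
have iS : i.+1%:R = i%:R + 1 :> R by rewrite -(natr1 i).
have [ik|/eqP ik] := eqVneq i k.
  have [ik'|/eqP ik'] := eqVneq i' k.+1.
    have [x1 y1] := c1 ik; have [x2 y2] := c2' ik'.
    have z : v 0 2 - j%:R = 2^-1 by lra.
    by have := y1 z; have := y2 z; case: (e); lra.
  have xi' : v 0 0 = i'%:R by apply: straight => //; lia.
  have /andP[_ x1] := strand_x (or_introl ik) H.
  have : (k.+2%:R : R) <= i'%:R by rewrite ler_nat; lia.
  by rewrite -(natr1 k.+1); lra.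
have [ik1|/eqP ik1] := eqVneq i k.+1.
  have xi' : v 0 0 = i'%:R by apply: straight => //; lia.
  have /andP[_ x1] := strand_x (or_intror ik1) H.
  have : (k.+2%:R : R) <= i'%:R by rewrite ler_nat; lia.
  by rewrite -(natr1 k.+1); lra.
have xi := straight i ik ik1 H.
have [ik'|/eqP ik'] := eqVneq i' k.
  by have /andP[x1 _] := strand_x (or_introl ik') H'; rewrite ik' in iR; lra.
have [ik1'|/eqP ik1'] := eqVneq i' k.+1; last by have := straight i' ik' ik1' H'; lra.
have /andP[x1 _] := strand_x (or_intror ik1') H'.
have : (i.+1%:R : R) <= k%:R by rewrite ler_nat; lia.
lra.
Qed.

Lemma run_opt_braid n j w i v : on_strands n w -> (0 < i <= n)%N -> run j w i v ->
  opt_braid n j (map Some w) v.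
Proof. by move=> wn iN H; apply/opt_braid_run => //; exists i. Qed.

Lemma run_height j w i v : run j w i v -> j%:R <= v 0 2 <= (j + size w)%:R.
Proof.
elim: w j i => [//|l w IH] j i /= [/strand_height/andP[z0 z1]|/IH/andP[z0 z1]].
  by rewrite z0 (le_trans z1)// ler_nat addnS ltnS leq_addr.
by rewrite -addSnnS z1 (le_trans _ z0)// ler_nat.
Qed.

Lemma run_bottom j w i v : run j w i v -> v 0 2 = j%:R -> v = point i%:R 0 j%:R.
Proof.
case: w => [//|l w] /= [/strand_ends[+ _]|/run_height/andP[z0 _] z]; first exact.
by move: z0; rewrite z ler_nat ltnn.
Qed.

Lemma run_top j w i v : run j w i v -> v 0 2 = (j + size w)%:R ->
  v = point (final_position w i)%:R 0 (j + size w)%:R.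
Proof.
elim: w j i => [//|l w IH] j i /= [H|H]; rewrite -addSnnS => z; last exact: IH.
case: w IH z => [|l' w] IH; rewrite ?addn0 => z; first exact: (strand_ends H).2.
have /andP[_] := strand_height H; rewrite z ler_nat /= addnS ltnS => h.
by have := leq_addr (size w) j.+1; lia.
Qed.

Lemma run_disjoint j w i i' v : i != i' -> run j w i v -> run j w i' v -> False.
Proof.
elim: w j i i' => [//|l w IH] j i i' /= ii'.
have sii' : step (Some l) i != step (Some l) i'.
  by apply: contra_neq ii' => E; rewrite -(stepK (Some l) i) E stepK.
have meet a b : step (Some l) a != step (Some l) b -> strand j (Some l) a v ->
    run j.+1 w (step (Some l) b) v -> False.
  move=> ab H H'; have /andP[z0 _] := run_height H'; have /andP[_ z1] := strand_height H.
  have z : v 0 2 = j.+1%:R by apply/le_anti; rewrite z0 z1.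
  have := (strand_ends H).2 z; rewrite (run_bottom H' z).
  move=> /(congr1 (fun v : 'rV[R]_3 => v 0 0)); rewrite !point0 => /eqP.
  by rewrite eqr_nat eq_sym (negPf ab).
move=> [H|H] [H'|H'].
- exact: strand_disjoint ii' H H'.
- exact: meet sii' H H'.
- by apply: meet H' H; rewrite eq_sym.
- exact: IH sii' H H'.
Qed.

Lemma closing_arc_disjoint n m i i' (v : 'rV[R]_3) : i != i' ->
  (i <= n)%N -> (i' <= n)%N ->
  closing_arc n m i v -> closing_arc n m i' v -> False.
Proof.
wlog ii' : i i' / (i < i')%N.
  move=> W; rewrite neq_ltn => /orP[lt|lt] iN iN' H H'.
    by apply: (W i i' lt _ iN iN' H H'); rewrite ltn_eqF.
  by apply: (W i' i lt _ iN' iN H' H); rewrite ltn_eqF.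
move=> _ iN iN'; have iR : (i.+1%:R : R) <= i'%:R by rewrite ler_nat.
have iR' : (i'%:R : R) <= n%:R by rewrite ler_nat.
have m0 : (0 : R) <= m%:R by [].
rewrite -(natr1 i) in iR; rewrite !closing_arcP// -(natr1 n).
move=> [_ H] [_ H'].
by case: H => [[h1 h2]|[h1 h2]|[h1 h2]|[[h1 h2]|[h1 h2]]];
   case: H' => [[k1 k2]|[k1 k2]|[k1 k2]|[[k1 k2]|[k1 k2]]]; lra.
Qed.

(** In the box of the braid a closing arc has only its two end points, so a common point would be
    the bottom or the top end of the run. *)
Lemma run_closing_arc n w i i' v : on_strands n w -> (0 < i <= n)%N -> (i' <= n)%N ->
  i != i' -> final_position w i != i' ->
  run 0 w i v -> closing_arc n (size w) i' v -> False.
Proof.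
move=> wn iN iN' ii' fi H.
have := run_height H; rewrite add0n => /andP[z0 z1].
have wn' : all (opt_letter n) (map Some w) by rewrite all_map; apply: sub_all wn => -[].
have [hx _ _] := opt_braid_box wn' (run_opt_braid wn iN H).
have iR' : (i'%:R : R) <= n%:R by rewrite ler_nat.
have x_ne a : v 0 0 = a%:R -> a != i' -> v 0 0 = i'%:R -> False.
  by move=> -> + /eqP; rewrite eqr_nat => /negPf ->.
have top z : v 0 2 = (size w)%:R -> v 0 0 = i'%:R -> False.
  move=> zE; apply: x_ne fi; have := run_top H; rewrite add0n => /(_ zE) ->.
  by rewrite point0.
have bottom : v 0 2 = 0 -> v 0 0 = i'%:R -> False.
  by move=> zE; apply: x_ne ii'; rewrite (run_bottom H)// point0.
move=> /(closing_arcP _ _ iN'); rewrite -(natr1 n) => -[_].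
case=> [[h1 h2]|[h1 h2]|[h1 h2]|[[h1 h2]|[h1 h2]]].
- by apply: (top _ h1); case/andP: h2 => h2 _; lra.
- by lra.
- by lra.
- by lra.
- by apply: (bottom _ h1); case/andP: h2 => _ h2; lra.
Qed.

Lemma component_disjoint n w i i' : on_strands n w ->
  (forall a, (0 < a <= n)%N -> final_position w a = a) ->
  (0 < i <= n)%N -> (0 < i' <= n)%N -> i != i' ->
  component n w i `&` component n w i' = set0.
Proof.
move=> wn pure iN iN' ii'; apply/seteqP; split => // v.
have i'i : i' != i by rewrite eq_sym.
have [/andP[_ in_] /andP[_ in_']] := (iN, iN').
rewrite /component !pure// => -[[H|H] [H'|H']].
- exact: run_disjoint ii' H H'.
- by apply: (run_closing_arc wn iN in_' ii' _ H H'); rewrite pure.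
- by apply: (run_closing_arc wn iN' in_ i'i _ H' H); rewrite pure.
- exact: closing_arc_disjoint ii' in_ in_' H H'.
Qed.

(* A closed braid with [m] strands is covered by [m] connected sets, while
   the closure of a pure braid has as many components as strands. *)
Lemma braid_index_pure p w : on_strands p w ->
  (forall i, (0 < i <= p)%N -> final_position w i = i) ->
  braid_index (braid_closure R p w) p.
Proof.
move=> wp pure; split; first by exists w; split => //; exact: isotopic_refl.
move=> m w' wm [H [_ hH _ HL]].
have [g [gK _ cH _]] : homeomorphism (H 1) by apply: hH; rewrite in_itv /= ler01 lexx.
have cS : continuous (Some : 'rV[R]_3 -> S3 R).
  exact: one_point_compactification_some_continuous.
pose K n u i : set (S3 R) := Some @` component n u i.
have K_connected n u i : connected (K n u i).
  exact: (@connected_image _ (S3 R) Some _ cS (component_connected _ _ _).1).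
have K_compact n u i : compact (K n u i).
  apply: (@continuous_compact _ (S3 R) Some); last exact: component_compact.
  exact: continuous_subspaceT.
apply: (@connected_cover_leq (S3 R) m p (fun a => H 1 @` K m w' a.+1) (fun i => K p w i.+1)).
- by move=> a; exact: (connected_image cH (K_connected _ _ _)).
- by move=> i; apply: compact_closed; [exact: S3_hausdorff|exact: K_compact].
- by move=> i; exists (Some (point i.+1%:R 0 0)), (point i.+1%:R 0 0) => //; exact: (component_connected _ _ _).2.
- move=> i j ij; apply/seteqP; split => // _ [[v Hv <-] [u Hu [uv]]].
  have : (component p w i.+1 `&` component p w j.+1) v by rewrite -uv in Hv *.
  by rewrite component_disjoint// ?ltn_ord.
- move=> v; have -> : (exists i : 'I_p, K p w i.+1 v) <->
      braid_closure R p w v.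
    split.
      move=> [i [u Hu <-]]; exists u => //; apply/closure_components => //.
      by exists i.+1; rewrite ltn_ord.
    move=> [u /closure_components-/(_ wp) [[|i] [ip Hu]] <-]; first by [].
    by exists (Ordinal (ip : (i < p)%N)), u.
  rewrite -HL; split.
    move=> [a [_ [u Hu <-] <-]]; exists (Some u) => //; exists u => //.
    by apply/closure_components => //; exists a.+1; rewrite ltn_ord.
  move=> [_ [u /closure_components-/(_ wm) [[|i] [ip Hu]] <-] <-]; first by [].
  by exists (Ordinal (ip : (i < m)%N)), (Some u) => //; exists u.
Qed.

End Components.

Lemma final_position_cat u w i :
  final_position (u ++ w) i = final_position w (final_position u i).
Proof. by elim: u i => //= l u IH i; rewrite IH. Qed.

Lemma positive_cat u w : positive (u ++ w) = positive u ++ positive w.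
Proof. exact: map_cat. Qed.

(** The strand at [a] takes part in every crossing and rides up to [a + k]; each strand that it
    passes drops by one position. *)
Lemma final_position_asc a k i : final_position (positive (iota a k)) i =
  if (i < a)%N || (a + k < i)%N then i else if i == a then (a + k)%N else i.-1.
Proof.
elim: k a i => [|k IH] a i /=.
  by do ![case: ifP => //]; lia.
by rewrite IH /step; do ![case: ifP]; lia.
Qed.

Lemma final_position_up p i : (0 < i <= p)%N ->
  final_position (positive (up p)) i = if i == 1%N then p else i.-1.
Proof. by move=> ip; rewrite /up final_position_asc; do ![case: ifP]; lia. Qed.

Lemma final_position_shift p l i : (0 < i <= p)%N -> (l < i)%N ->
  final_position (positive (power (up p) l)) i = (i - l)%N.
Proof.
elim: l i => [|l IH] i ip li; first by rewrite subn0.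
rewrite powerS positive_cat final_position_cat final_position_up//.
by rewrite ifN; [rewrite IH; lia|lia].
Qed.

Lemma final_position_full p k i : (0 < i <= p)%N ->
  final_position (positive (power (up p) (p * k))) i = i.
Proof.
move=> ip; elim: k => [|k IH]; first by rewrite muln0.
(* One full twist on the strand at [i]: it reaches position 1 after [i - 1] factors, jumps to [p]
   with the next one, and returns to [i] after [p - i] more. *)
have -> : (p * k.+1 = i.-1 + (p - i).+1 + p * k)%N by nia.
rewrite !powerD powerS !positive_cat !final_position_cat.
rewrite (@final_position_shift p i.-1) ?final_position_up//; [|lia..].
rewrite ifT; last by lia.
rewrite (@final_position_shift p (p - i)); [|lia..].
by rewrite subKn//; lia.
Qed.

(** * The presentations *)

Local Close Scope ring_scope.

Lemma up_blockE r s : up_block (r, s) = positive (power (up r) s).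
Proof.
rewrite /up_block /power /positive map_flatten map_nseq.
by [].
Qed.

Lemma down_blockE p v : down_block p (p, v) = positive (power (rev (up p)) v).
Proof.
have -> : rev (up p) = [seq (p - i)%N | i <- iota 1 p.-1].
  apply: (@eq_from_nth _ 0%N); rewrite size_rev ?size_map !size_iota// => i ip.
  rewrite nth_rev ?size_iota// (nth_map 0%N) ?size_iota// !nth_iota//; lia.
by rewrite /down_block /power /positive map_flatten map_nseq -map_comp.
Qed.

Lemma card_ge_in_inj (T : Type) (f : nat -> T) (A : set T) n :
  (forall a, (a < n)%N -> A (f a)) -> {in `I_n &, injective f} -> (`I_n #<= A)%card.
Proof.
move=> fA finj; rewrite -(card_le_eql (inj_card_eq finj)).
by apply: subset_card_le => _ [a /= an <-]; exact: fA.
Qed.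

Theorem theorem5p15 (R : realType) (p : nat) (hp : (3 <= p)%N) (k : nat)
    (hk : (1 <= k)%N) :
  exists L : set (S3 R),
    [/\ exists v : V_param, V_presentation L v,
        braid_index L p,
        (`I_k #<= [set v : V_param | V_presentation L v])%card &
        (`I_(2 * k) #<= [set a : T_param | T_presentation L a])%card].
Proof.
have p0 : (0 < p)%N by lia.
(* The exponent is [p * (2 * k - a) + p + p * a.+1] for the T-links and
   [p * a.+1 + p * (2 * k + 1 - a)] for the V-links. The first summand of the former is positive for
   [a < 2 * k], and [a.+1] makes the two strand numbers strictly increasing. For [a < k] the last
   exponent of the V-link is at least [p], as [P <= Q] demands. *)
pose L := braid_closure R p (positive (power (up p) (p * (2 * k + 2)))).
pose V a := VParam [:: (p, p * a.+1)%N] [::] p (p * (2 * k + 1 - a)).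
pose T a := [:: (p, p * (2 * k - a)); (p + p * a.+1, p)]%N.
have VL a : (a < k)%N -> V_presentation L (V a).
  move=> ak; split.
    by rewrite /V_valid /increasing_list /= leqnn !andbT muln_gt0 p0; nia.
  rewrite /V_link /= cats0 down_blockE up_blockE -positive_cat.
  have -> : L = braid_closure R p (positive (power (up p) (p * a.+1 + p * (2 * k + 1 - a)))).
    by rewrite /L -mulnDr; congr (braid_closure R p (positive (power _ (_ * _)))); lia.
  exact: torus_V_link.
have TL a : (a < 2 * k)%N -> T_presentation L (T a).
  move=> ak; split; [|by rewrite /=; lia|].
    by rewrite /T_valid /increasing_list /= !andbT; nia.
  rewrite /T_link /= cats0 !up_blockE -positive_cat.
  have -> : L = braid_closure R p (positive (power (up p) (p * (2 * k - a) + p + p * a.+1))).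
    have -> : L = braid_closure R p (positive (power (up p) (p * ((2 * k - a).+1 + a.+1)))).
      by congr (braid_closure R p (positive (power _ (_ * _)))); lia.
    by rewrite mulnDr [(p * (_ - _).+1)%N]mulnSr.
  exact: torus_T_link.
exists L; split.
- by exists (V 0%N); exact: VL.
- apply: braid_index_pure; first by rewrite on_strands_positive letters_below_up.
  by move=> i ip; exact: final_position_full.
- apply: card_ge_in_inj VL _ => a b _ _ [].
  by move=> /eqP; rewrite eqn_pmul2l// => /eqP [].
- apply: card_ge_in_inj TL _ => a b _ _ [] _.
  by move=> /eqP; rewrite eqn_add2l eqn_pmul2l// => /eqP [].
Qed.
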